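(* Let $P$ be a branched simple polyhedron. If there exists a $1$-form $\beta$ on $P$ with $d\beta>0$, then there exists a $1$-form $\beta'$ on $P$ such that $d\beta'>0$ and the foliation defined by $\beta'=0$ on $P$ is S-stable.
   Context: Simple polyhedra. A (compact) polyhedron $P$ is simple if every point has a neighborhood homeomorphic to one of: (i) a plane; (ii) three half-planes glued along their common boundary line; (iii) the cone over the $1$-skeleton of a tetrahedron. Components of the set of points of type (i) are regions; components of the set of points of type (ii) are triple lines (each is an open arc, called an edge, or a circle); points of type (iii) are vertices. The singular set $S(P)$ is the union of triple lines and vertices. Branching. $P$ is embedded in an oriented $3$-manifold $M$ and its regions are orientable. A branching is a choice of orientations of the regions such that along each triple line the three orientations induced by the adjacent regions do not all coincide. A branched simple polyhedron is a simple polyhedron with a branching. Each triple line is oriented by the orientation induced by the two adjacent regions that agree. $P$ is regarded as smoothed into a branched surface in $M$ compatibly with the branching: $P$ has a well-defined oriented tangent plane at every point; along a triple line the two agreeing regions lie on the same side (the two-sheet side, to the left of the oriented triple line) and the third region on the other side (the one-sheet side). Near any point, projecting along a direction transverse to $P$ maps $P$ to an oriented $\mathbb{R}^2$, preserving the orientation of each region; near a vertex $S(P)$ projects to two curves crossing transversely, so $S(P)$ is the image of an immersion with normal crossings of finitely many circles. $1$-forms. A $1$-form $\beta$ on $P$ is one that is locally the restriction to the tangent planes of $P$ of a smooth $1$-form on an open subset of $M$. $d\beta>0$ means that $d\beta$ is a positive area form on the oriented tangent planes of $P$. The equation $\beta=0$ defines a singular foliation on $P$, with singularities at the points where $\beta$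 vanishes on the tangent plane. S-stability. A simple tangency point of a foliation is a point in the interior of a triple line at which the foliation is non-singular and a leaf has a quadratic (non-degenerate) tangency with $S(P)$. In a local projection to $\mathbb{R}^2$, its index is $+1$ if the tangent leaf lies locally on the two-sheet side of the triple line, and $-1$ if it lies locally on the one-sheet side. A foliation on $P$ is S-stable if it has no singularity on $S(P)$, it is transverse to $S(P)$ (to both branches) at every vertex, and it is transverse to $S(P)$ elsewhere except at finitely many simple tangency points, all of index $+1$. *)

(* Defs.v *)
From HB Require Import structures.
From mathcomp Require Import all_boot all_order all_algebra.
From mathcomp Require Import all_classical all_reals all_analysis.
Set Implicit Arguments.
Unset Strict Implicit.
Unset Printing Implicit Defensive.
Import Order.TTheory GRing.Theory Num.Theory.
Import numFieldNormedType.Exports.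
Local Open Scope classical_set_scope.
Local Open Scope ring_scope.

Fixpoint iterD (R : realType) (E : normedModType R) (s : seq E)
    (f : E -> R^o) : E -> R^o :=
  if s is v :: s' then fun x => 'D_v (iterD s' f) x else f.

(* For E finite-dimensional and U open this is C^oo: all iterated directional
   derivatives exist and are continuous on U. *)
Definition smooth_on (R : realType) (E : normedModType R) (U : set E)
    (f : E -> R^o) : Prop :=
  forall (s : seq E) (x : E), U x ->
    {for x, continuous (iterD s f)} /\ forall v, derivable (iterD s f) x v.

(* A point of R^3 has coordinates x = v 0 0, y = v 0 1, z = v 0 2. *)
Definition xy (R : realType) (v : 'rV[R]_3) : 'rV[R]_2 :=
  \row_(j < 2) (if j == 0 then v 0 0 else v 0 1).

Definition dxdy (R : realType) (u v : 'rV[R]_3) : R :=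
  u 0 0 * v 0 1 - u 0 1 * v 0 0.

Definition e_x (R : realType) : 'rV[R]_3 := delta_mx 0 0.
Definition e_y (R : realType) : 'rV[R]_3 := delta_mx 0 1.

Definition homeomorphic_sets (S T : topologicalType) (A : set S) (B : set T) :
    Prop :=
  exists (f : S -> T) (g : T -> S),
    [/\ {within A, continuous f}, {within B, continuous g},
        forall a, A a -> B (f a) /\ g (f a) = a
      & forall b, B b -> A (g b) /\ f (g b) = b].

Definition plane_in_space (R : realType) : set 'rV[R]_3 :=
  [set v | v 0 2 = 0].

(* (1,0), (0,1) and (-1,-1) span the three rays. *)
Definition three_half_planes (R : realType) : set 'rV[R]_3 :=
  [set v | exists s : R, 0 <= s /\
    [\/ xy v = \row_j (if j == 0 then s else 0),
        xy v = \row_j (if j == 0 then 0 else s)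
      | xy v = \row_j (- s)]].

(* The vertices of a tetrahedron with barycentre 0. *)
Definition tetrahedron (R : realType) (i : 'I_4) : 'rV[R]_3 :=
  if unlift ord0 i is Some j then delta_mx 0 j else const_mx (- 1).

(* The open infinite cone over the union of the six edges. *)
Definition tetrahedral_cone (R : realType) : set 'rV[R]_3 :=
  [set v | exists (i j : 'I_4) (s t : R),
    [/\ 0 <= s, 0 <= t & v = s *: tetrahedron R i + t *: tetrahedron R j]].

Definition simple_polyhedron (R : realType) (T : topologicalType) (P : set T) :
    Prop :=
  compact P /\ forall p, P p -> exists2 U, open_nbhs p U &
    [\/ homeomorphic_sets (P `&` U) (@plane_in_space R),
        homeomorphic_sets (P `&` U) (@three_half_planes R)
      | homeomorphic_sets (P `&` U) (@tetrahedral_cone R)].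

(* chart_inv is only meaningful on the image of dom. *)
Record chart (R : realType) (T : topologicalType) := Chart {
  dom : set T;
  chart_fun :> T -> 'rV[R]_3;
  chart_inv : 'rV[R]_3 -> T }.

Definition chart_axiom (R : realType) (T : topologicalType) (c : chart R T) :
    Prop :=
  [/\ open (dom c), open (c @` dom c),
      forall p, dom c p -> chart_inv c (c p) = p,
      forall p, dom c p -> {for p, continuous c}
    & forall x, (c @` dom c) x -> {for x, continuous (chart_inv c)}].

Definition overlap (R : realType) (T : topologicalType) (c c' : chart R T) :
    set 'rV[R]_3 := c @` (dom c `&` dom c').

Definition transition (R : realType) (T : topologicalType) (c c' : chart R T) :
    'rV[R]_3 -> 'rV[R]_3 := fun x => c' (chart_inv c x).

Definition oriented_compatible (R : realType) (T : topologicalType)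
    (c c' : chart R T) : Prop :=
  (forall i, smooth_on (overlap c c') (fun x => transition c c' x 0 i)) /\
  (forall x, overlap c c' x -> 0 < \det (jacobian (transition c c') x)).

Record oriented_3manifold (R : realType) := Oriented3Manifold {
  space :> topologicalType;
  atlas : set (chart R space);
  manifold_hausdorff : hausdorff_space space;
  manifold_second_countable : @second_countable space;
  atlas_chart : forall c, atlas c -> chart_axiom c;
  atlas_cover : forall p : space, exists2 c, atlas c & dom c p;
  atlas_compatible : forall c c', atlas c -> atlas c' ->
    oriented_compatible c c' }.

(* The charts of the maximal oriented atlas. *)
Definition oriented_chart (R : realType) (M : oriented_3manifold R)
    (c : chart R M) : Prop :=
  chart_axiom c /\
  forall a, atlas a -> oriented_compatible c a /\ oriented_compatible a c.

(* The vectors of T_pP, read in the chart c: velocities of curves in P. *)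
Definition tangent (R : realType) (M : oriented_3manifold R) (P : set M)
    (c : chart R M) (p : M) (v : 'rV[R]_3) : Prop :=
  exists gamma : R^o -> 'rV[R]_3,
    [/\ gamma 0 = c p,
        \forall t \near (0 : R^o), (c @` (dom c `&` P)) (gamma t)
      & is_derive (0 : R^o) (1 : R^o) gamma v].

(* A sheet z = f(x,y) that leaves the sheet z = 0 smoothly along the line where
   the i-th coordinate vanishes, towards the negative side of that line, above
   z = 0 if e > 0 and below if e < 0. *)
Definition wing (R : realType) (i : 'I_2) (e : R) (f : 'rV[R]_2 -> R^o) :
    Prop :=
  [/\ smooth_on setT f,
      forall u : 'rV[R]_2, 0 <= u 0 i -> f u = 0
    & forall u : 'rV[R]_2, u 0 i < 0 -> 0 < e * f u].

Definition plane_model (R : realType) (K : set 'rV[R]_3) : Prop :=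
  K = @plane_in_space R.

(* Three half-planes glued along the line x = z = 0: two sheets over x < 0 and
   one sheet over x > 0. *)
Definition triple_model (R : realType) (K : set 'rV[R]_3) : Prop :=
  exists2 f, wing 0 1 f &
    K = [set v : 'rV[R]_3 | v 0 2 = 0 \/ v 0 2 = f (xy v)].

(* A plane with two wings on opposite sides, attached along x = 0 and y = 0
   respectively: the cone over the 1-skeleton of a tetrahedron. The orientations
   of the six sheets satisfying the branching condition correspond to the 24
   total orders on the vertices of the tetrahedron; up to
   orientation-preserving homeomorphism this leaves two smoothed vertices,
   mirror images of each other, given by the two signs of e. *)
Definition vertex_model (R : realType) (K : set 'rV[R]_3) : Prop :=
  exists e f g, [/\ e != 0, wing 0 e f, wing 1 (- e) g
    & K = [set v : 'rV[R]_3 |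
        [\/ v 0 2 = 0, v 0 2 = f (xy v) | v 0 2 = g (xy v)]]].

(* In the chart c, centred at p, the set P is one of the models. *)
Definition model_chart (R : realType) (M : oriented_3manifold R) (P : set M)
    (model : set 'rV[R]_3 -> Prop) (c : chart R M) (p : M) : Prop :=
  [/\ oriented_chart c, dom c p, c p = 0
    & exists2 K, model K & forall q, dom c q -> (P q <-> K (c q))].

(* o c p u v says that (u, v), read in the chart c, is a positively oriented
   basis of T_pP. *)
Definition orientation (R : realType) (M : oriented_3manifold R) : Type :=
  chart R M -> M -> 'rV[R]_3 -> 'rV[R]_3 -> Prop.

(* The orientation which the region through q induces on its boundary is the
   direction w (in the xy-plane) if n points out of the region: outward normal
   first. *)
Definition induces (R : realType) (M : oriented_3manifold R) (P : set M)
    (o : orientation M) (c : chart R M) (q : M) (n w : 'rV[R]_2) : Prop :=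
  forall u v, tangent P c q u -> tangent P c q v -> xy u = n -> xy v = w ->
    o c q u v.

(* Near p on a triple line, the regions are two sheets over x < 0 and one over
   x > 0; the triple line projects to x = 0. *)
Definition branching_condition (R : realType) (M : oriented_3manifold R)
    (P : set M) (o : orientation M) : Prop :=
  forall c p, P p -> model_chart P (@triple_model R) c p ->
  ~ exists w : 'rV[R]_2, (w = xy (e_y R) \/ w = xy (- e_y R)) /\
      \forall q \near p, dom c q -> P q ->
        (c q 0 0 < 0 -> induces P o c q (xy (e_x R)) w) /\
        (0 < c q 0 0 -> induces P o c q (xy (- e_x R)) w).

(* A flow box: (x,y,z) |-> (x,y) maps all sheets to R^2 preserving their
   orientations. *)
Definition flow_box (R : realType) (M : oriented_3manifold R) (P : set M)
    (o : orientation M) (model : set 'rV[R]_3 -> Prop) (c : chart R M) (p : M) :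
    Prop :=
  model_chart P model c p /\
  forall q, dom c q -> P q -> forall u v,
    o c q u v <-> [/\ tangent P c q u, tangent P c q v & 0 < dxdy u v].

(* A branched simple polyhedron, smoothed compatibly with its branching: pos
   orients the tangent planes of P, and polyhedron_flow_box says that P is a
   smooth branched surface on which this orientation is continuous, with the two
   sheets inducing the same orientation of a triple line on the same side. *)
Record branched_simple_polyhedron (R : realType) (M : oriented_3manifold R) :=
  BranchedSimplePolyhedron {
  carrier :> set M;
  pos : orientation M;
  polyhedron_simple : simple_polyhedron R carrier;
  polyhedron_branching : branching_condition carrier pos;
  pos_transition : forall c c', oriented_chart c -> oriented_chart c' ->
    forall p, carrier p -> dom c p -> dom c' p -> forall u v, pos c p u v ->
    pos c' p ('D_u (transition c c') (c p)) ('D_v (transition c c') (c p));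
  polyhedron_flow_box : forall p, carrier p -> exists c,
    [\/ flow_box carrier pos (@plane_model R) c p,
        flow_box carrier pos (@triple_model R) c p
      | flow_box carrier pos (@vertex_model R) c p] }.

Definition triple_box (R : realType) (M : oriented_3manifold R)
    (P : branched_simple_polyhedron M) (c : chart R M) (p : M) : Prop :=
  carrier P p /\ flow_box (carrier P) (pos P) (@triple_model R) c p.

Definition vertex_box (R : realType) (M : oriented_3manifold R)
    (P : branched_simple_polyhedron M) (c : chart R M) (p : M) : Prop :=
  carrier P p /\ flow_box (carrier P) (pos P) (@vertex_model R) c p.

(* S(P) *)
Definition singular_set (R : realType) (M : oriented_3manifold R)
    (P : branched_simple_polyhedron M) : set M :=
  [set p | exists c, triple_box P c p \/ vertex_box P c p].

(* Along x = 0 the two sheets over x < 0 induce the direction e_y, which has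
   them on its left, and the sheet over x > 0 induces - e_y. *)
Lemma flow_box_branching (R : realType) (M : oriented_3manifold R)
    (P : branched_simple_polyhedron M) (c : chart R M) (p q : M) :
  triple_box P c p -> dom c q -> carrier P q ->
  (c q 0 0 < 0 -> induces P (pos P) c q (xy (e_x R)) (xy (e_y R))) /\
  (0 < c q 0 0 -> induces P (pos P) c q (xy (- e_x R)) (xy (- e_y R))).
Proof.
move=> [_ [_ Hpos]] dq Pq; split=> _ u v tu tv.
all: move=> /rowP hu /rowP hv; apply/(Hpos q dq Pq); split=> //.
all: move: (hu 0) (hu 1) (hv 0) (hv 1); rewrite !mxE /= /dxdy => -> -> -> ->.
  by rewrite !mulr1 mulr0 subr0.
by rewrite oppr0 mulr0 subr0 mulrNN mulr1.
Qed.

(* A 1-form given by its values on the tangent vectors, read in each chart. Only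
   the values at points of P on vectors tangent to P matter. *)
Definition form_on (R : realType) (M : oriented_3manifold R) : Type :=
  chart R M -> M -> 'rV[R]_3 -> R.

(* On the part of P lying in the open set W of the chart c, beta is the
   restriction of the smooth 1-form a_0 dx + a_1 dy + a_2 dz. *)
Definition restricts_to (R : realType) (M : oriented_3manifold R) (P : set M)
    (a : 'rV[R]_3 -> 'rV[R]_3) (c : chart R M) (W : set 'rV[R]_3)
    (beta : form_on M) : Prop :=
  [/\ open W, W `<=` c @` dom c,
      forall i, smooth_on W (fun x => a x 0 i)
    & forall q v, dom c q -> P q -> W (c q) -> tangent P c q v ->
        beta c q v = \sum_i a (c q) 0 i * v 0 i].

Definition one_form (R : realType) (M : oriented_3manifold R) (P : set M)
    (beta : form_on M) : Prop :=
  (forall c c', oriented_chart c -> oriented_chart c' ->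
    forall p v, P p -> dom c p -> dom c' p -> tangent P c p v ->
    beta c' p ('D_v (transition c c') (c p)) = beta c p v) /\
  (forall c, oriented_chart c -> forall p, P p -> dom c p ->
    exists a W, W (c p) /\ restricts_to P a c W beta).

(* (d a)(u, v) at x, for a = a_0 dx + a_1 dy + a_2 dz. *)
Definition dform (R : realType) (a : 'rV[R]_3 -> 'rV[R]_3)
    (x u v : 'rV[R]_3) : R :=
  \sum_i ('D_u (fun y => a y 0 i : R^o) x * v 0 i
          - 'D_v (fun y => a y 0 i : R^o) x * u 0 i).

(* On T_pP the value of d a does not depend on the extension a of beta. *)
Definition d_positive (R : realType) (M : oriented_3manifold R)
    (P : branched_simple_polyhedron M) (beta : form_on M) : Prop :=
  forall c, oriented_chart c -> forall p, carrier P p -> dom c p ->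
    exists a W, [/\ W (c p), restricts_to P a c W beta
      & forall u v, pos P c p u v -> 0 < dform a (c p) u v].

Definition nonsingular_at (R : realType) (M : oriented_3manifold R)
    (P : set M) (beta : form_on M) (p : M) : Prop :=
  exists c v, [/\ oriented_chart c, dom c p, tangent P c p v
    & beta c p v != 0].

(* The line Ker beta in T_pP is transverse to the line spanned by w. *)
Definition transverse_to (R : realType) (M : oriented_3manifold R)
    (beta : form_on M) (c : chart R M) (p : M) (w : 'rV[R]_3) : Prop :=
  beta c p w != 0.

(* gamma parametrizes, in the chart c, an arc through p of a leaf of
   beta = 0. *)
Definition leaf_arc (R : realType) (M : oriented_3manifold R) (P : set M)
    (beta : form_on M) (c : chart R M) (p : M) (gamma : R^o -> 'rV[R]_3) :
    Prop :=
  gamma 0 = c p /\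
  exists r : R, [/\ 0 < r,
    forall i, smooth_on (ball (0 : R^o) r) (fun t => gamma t 0 i)
    & forall t, ball (0 : R^o) r t -> 'D_(1 : R^o) gamma t != 0 /\
        exists q, [/\ dom c q, P q, gamma t = c q
          & beta c q ('D_(1 : R^o) gamma t) = 0]].

(* In a flow box c centred at a point of a triple line, S(P) projects to the
   line x = 0. *)
Definition quadratic_tangency (R : realType) (gamma : R^o -> 'rV[R]_3) : Prop :=
  let x := (fun t : R^o => gamma t 0 0 : R^o) in
  'D_(1 : R^o) x 0 = 0 /\ 'D_(1 : R^o) ('D_(1 : R^o) x) 0 != 0.

Definition on_two_sheet_side (R : realType) (gamma : R^o -> 'rV[R]_3) : Prop :=
  \forall t \near (0 : R^o), gamma t 0 0 <= 0.

(* p is a simple tangency point of index +1 (c a flow box centred at p). *)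
Definition positive_simple_tangency (R : realType) (M : oriented_3manifold R)
    (P : branched_simple_polyhedron M) (beta : form_on M) (c : chart R M)
    (p : M) : Prop :=
  [/\ triple_box P c p, nonsingular_at P beta p
    & exists gamma, [/\ leaf_arc P beta c p gamma, quadratic_tangency gamma
        & on_two_sheet_side gamma]].

Definition S_stable (R : realType) (M : oriented_3manifold R)
    (P : branched_simple_polyhedron M) (beta : form_on M) : Prop :=
  [/\ forall p, singular_set P p -> nonsingular_at P beta p,
      forall p c, vertex_box P c p ->
        transverse_to beta c p (e_x R) /\ transverse_to beta c p (e_y R)
    & exists2 F : set M, finite_set F
        & forall p c, triple_box P c p ->
            (~ F p -> transverse_to beta c p (e_y R)) /\
            (F p -> positive_simple_tangency P beta c p)].

(* Main.v *)
(** If [h] is a smooth function on [M], then [beta + dh] has the same exterior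
derivative as [beta], so it suffices to choose [h].

First, along the lines to which S(P) projects in finitely many flow boxes covering
[P], a small generic [h] makes the restriction of the form to these lines vanish
only to first order, and not at the centres of the boxes (Sard's theorem in
dimension one). Then the foliation is transverse to both branches of S(P) at the
vertices, and there are finitely many tangencies, all on triple lines.

Write the form as [a dx + b dy] near a tangency [p], the triple line being [x = 0]
with the two sheets over [x < 0]; then [b = 0] and [b_y <> 0] at [p], and the index
is the sign of [a b_y]. Adding [d (s x)] changes [a] by [s] without changing [b] on
the line, so the index can be made [+1]. Adding moreover [d (H(y))] for a suitable
[H] makes the parabola [x = - y^2 / 2] a leaf: the quadratic tangency is exhibited
without integrating the foliation. *)
Require Import Defs.
From mathcomp Require Import all_boot all_order all_algebra.
From mathcomp Require Import all_classical all_reals all_analysis.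
From HB Require Import structures.
From mathcomp Require Import ring lra.
(* ssrnat has another iterD, which hides the one of Defs. *)
Import Defs.
Set Implicit Arguments.
Unset Strict Implicit.
Unset Printing Implicit Defensive.
Import Order.TTheory GRing.Theory Num.Theory.
Import numFieldNormedType.Exports.
Local Open Scope classical_set_scope.
Local Open Scope ring_scope.

(** * Smooth functions *)

Section Lines.
Context {R : realType}.
Implicit Types (E W : normedModType R).

(** [S_stable] speaks of every flow box centred at a point of S(P), while the constructions control
    only one. This shapes the proof. Since the tangent plane of [P] is defined even along S(P), it
    cannot detect S(P); instead, a point is singular when every smooth function vanishing on [P]
    nearby is critical there. On a triple line this holds by Rolle's theorem on short segments
    joining two sheets. Transversality is then tested on velocities of curves in this set, which
    transition maps carry along. The side of a tangency is compared between boxes by showing that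
    transition maps preserve the two-sheet side.

    The two perturbations are of different kinds. The generic one moves the form on whole axes, so
    regularity must be an open condition for the axes already treated to survive. The normalizing
    one must keep the tangencies under control although its cutoff has a large derivative: it
    changes nothing outside a closed box, and inside the box only the chosen point remains tangent.
    Hence tangencies can be treated one by one. *)

Lemma is_derive_line E W (f : E -> W) (x v : E) (t : R) :
  derivable f (x + t *: v) v ->
  is_derive t (1 : R) (fun s : R => f (x + s *: v)) ('D_v f (x + t *: v)).
Proof.
move=> df.
have eq : (fun h : R => h^-1 *:
    (((fun s : R => f (x + s *: v)) \o shift t) (h *: (1 : R)) - f (x + t *: v)))
  = (fun h : R => h^-1 *: ((f \o shift (x + t *: v)) (h *: v) - f (x + t *: v))).
  apply/funext => h /=; congr (_ *: (f _ - _)).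
  by rewrite [h *: 1]mulr1 scalerDl addrCA.
by apply: DeriveDef; rewrite /derivable /derive eq.
Qed.

Lemma is_derive_line0 E W (f : E -> W) (x v : E) :
  derivable f x v -> is_derive (0 : R) (1 : R) (fun s : R => f (x + s *: v)) ('D_v f x).
Proof.
move=> df; have := @is_derive_line _ _ f x v 0.
by rewrite scale0r addr0; apply.
Qed.

Lemma line_is_derive E W (f : E -> W) (x v : E) d :
  is_derive (0 : R) (1 : R) (fun s : R => f (x + s *: v)) d -> is_derive x v f d.
Proof.
move=> [df <-].
have eq : (fun h : R => h^-1 *:
    (((fun s : R => f (x + s *: v)) \o shift 0) (h *: (1 : R)) - f (x + 0 *: v)))
  = (fun h : R => h^-1 *: ((f \o shift x) (h *: v) - f x)).
  apply/funext => h /=; rewrite scale0r !addr0; congr (_ *: (f _ - _)).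
  by rewrite [h *: 1]mulr1 addrC.
by apply: DeriveDef; move: df; rewrite /derivable /derive eq.
Qed.

(** No differentiability of [f] is assumed: on the line through [x] it is a differentiable function
    of one variable, and rescaling this variable gives the claim, also for c = 0. *)
Lemma is_deriveZv E W (f : E -> W) (x v : E) (c : R) d :
  is_derive x v f d -> is_derive x (c *: v) f (c *: d).
Proof.
move=> [df <-]; apply: line_is_derive.
have dl := is_derive_line0 df.
have /derivable1_diffP d1 : derivable (fun s : R => f (x + s *: v)) 0 1.
  exact: ex_derive.
have eq : (fun s : R => f (x + s *: (c *: v))) =
    (fun s : R => f (x + s *: v)) \o (fun s : R => c *: s).
  by apply/funext => s /=; rewrite scalerA mulrC.
have d2 : is_diff (0 : R) (fun s : R => c *: s) (fun s : R => c *: s).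
  exact: is_diff_scaler.
have d3 : differentiable (fun s : R => f (x + s *: v)) (c *: (0 : R)).
  by rewrite scaler0.
rewrite eq; apply: DeriveDef.
  by apply/derivable1_diffP; apply: differentiable_comp.
rewrite deriveE; last exact: differentiable_comp.
rewrite diff_comp//= diff_val /= scaler0 linearZ; congr (_ *: _).
rewrite -deriveE //; exact: derive_val.
Qed.

Lemma segment_MVT E (f : E -> R) (x v : E) :
  (forall t : R, 0 <= t <= 1 -> derivable f (x + t *: v) v) ->
  exists2 t : R, 0 < t < 1 & f (x + v) - f x = 'D_v f (x + t *: v).
Proof.
move=> df.
have dl (t : R) : 0 <= t <= 1 ->
    is_derive t (1 : R) (fun s : R => f (x + s *: v)) ('D_v f (x + t *: v)).
  by move=> t01; apply: is_derive_line; exact: df.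
have [||t t01] := @MVT R (fun s : R => f (x + s *: v))
  (fun t => 'D_v f (x + t *: v)) 0 1 ltr01.
- move=> t; rewrite in_itv/= => /andP[t0 t1]; apply: dl.
  by rewrite (ltW t0) (ltW t1).
- apply: derivable_within_continuous => t; rewrite in_itv/= => t01.
  by have dlt := dl t t01; exact: ex_derive.
rewrite scale1r scale0r addr0 subr0 mulr1 => eq.
by exists t => //; move: t01; rewrite in_itv.
Qed.

End Lines.

Section C1.
Context {R : realType} {n : nat}.

(** These rows lead from 0 to [h] one coordinate at a time, so that each increment of a function can
    be handled by the mean value theorem in a basis direction. *)
Definition prefix_row (h : 'rV[R]_n) (k : nat) : 'rV[R]_n :=
  \row_j (if (j < k)%N then h 0 j else 0).

Lemma prefix_rowS h (k : 'I_n) :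
  prefix_row h k.+1 = prefix_row h k + h 0 k *: delta_mx 0 k.
Proof.
apply/rowP => j; rewrite !mxE /= ltnS leq_eqVlt -val_eqE /=.
have [/val_inj->|_] := eqVneq (j : nat) k; first by rewrite ltnn mulr1 add0r.
by rewrite mulr0 addr0.
Qed.

Lemma coord_le_norm (h : 'rV[R]_n) j : `|h 0 j| <= `|h|.
Proof.
rewrite [leRHS]/Num.Def.normr/= mx_normrE.
exact: (le_bigmax _ (fun i : 'I_1 * 'I_n => `|h i.1 i.2|) (0, j)).
Qed.

Lemma norm_le_coord (h : 'rV[R]_n) (e : R) :
  0 <= e -> (forall j, `|h 0 j| <= e) -> `|h| <= e.
Proof.
move=> e0 he; rewrite [leLHS]/Num.Def.normr/= mx_normrE.
by apply: bigmax_le => // -[i j] _ /=; rewrite ord1.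
Qed.

Lemma C1_differentiable (f : 'rV[R]_n -> R) (x : 'rV[R]_n) :
  (\forall y \near x, forall v, derivable f y v) ->
  (forall v, {for x, continuous ('D_v f)}) -> differentiable f x.
Proof.
move=> df cf.
pose d j := 'D_(delta_mx 0 j) f x.
pose A (h : 'rV[R]_n) : R := \sum_j h 0 j * d j.
have lA : linear A.
  move=> a u v; rewrite /A scaler_sumr -big_split /=; apply: eq_bigr => j _.
  by rewrite !mxE mulrDl -mulrA.
pose AM := GRing.isLinear.Build _ _ _ _ _ lA.
pose L : {linear 'rV[R]_n -> R} := HB.pack A AM.
have cL : continuous L.
  move=> h; apply: (@differentiable_continuous _ _ _ h A).
  rewrite (_ : A = \sum_j (fun h : 'rV[R]_n => h 0 j *: d j)); last first.
    by apply/funext => k; rewrite /A fct_sumE.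
  apply: differentiable_sum => j; apply: differentiableZl.
  exact: differentiable_coord.
suff E : f \o shift x = cst (f x) + L +o_ (0 : 'rV[R]_n) id.
  by apply/diff_locallyP; rewrite (diff_unique cL E).
apply/eqaddoP => _/posnumP[e].
(* Each of the [n] coordinate steps contributes an error of at most e' times the norm of h; the + 1
   keeps the denominator positive for n = 0. *)
pose e' := e%:num / (n%:R + 1).
have n1 : (0 : R) < n%:R + 1 by rewrite ltr_wpDl.
have e'0 : 0 < e' by rewrite divr_gt0.
have fj (j : 'I_n) :
    \forall y \near x, `|'D_(delta_mx 0 j) f x - 'D_(delta_mx 0 j) f y| < e'.
  by have /cvgrPdist_lt/(_ _ e'0) := cf (delta_mx 0 j).
have nb : \forall y \near x, (forall v, derivable f y v) /\
    forall j, `|'D_(delta_mx 0 j) f x - 'D_(delta_mx 0 j) f y| < e'.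
  by apply: filterI df _; exact: filter_forall fj.
have /nbhs_ballP[r /= r0 xr] := nb; apply/nbhs_ballP; exists r => //= h.
rewrite -ball_normE /= sub0r normrN => hr.
have inb (g : 'rV[R]_n) : `|g| <= `|h| -> ball x r (x + g).
  by move=> gh; rewrite -ball_normE /= opprD addNKr normrN (le_lt_trans gh).
have est k : (k <= n)%N ->
    `|f (x + prefix_row h k) - f x - \sum_(j < n | (j < k)%N) h 0 j * d j|
      <= k%:R * (e' * `|h|).
  elim: k => [_|k IH kn].
    rewrite big_pred0 // (_ : prefix_row h 0 = 0) ?addr0 ?subrr ?subr0 ?normr0 ?mul0r //.
    by apply/rowP => j; rewrite !mxE.
  pose K := Ordinal kn.
  have {IH} := IH (ltnW kn).
  have -> : \sum_(j < n | (j < k.+1)%N) h 0 j * d j =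
      h 0 K * d K + \sum_(j < n | (j < k)%N) h 0 j * d j.
    rewrite (bigD1 K) //=; congr (_ + _); apply: eq_bigl => j.
    by rewrite ltnS -val_eqE /= [RHS]ltn_neqAle andbC.
  set S := \sum_(_ < n | _) _ => IH.
  rewrite -[k.+1]/(K.+1) prefix_rowS /= addrA.
  have hb (t : R) : 0 <= t <= 1 ->
      ball x r (x + prefix_row h k + t *: (h 0 K *: delta_mx 0 K)).
    move=> /andP[t0 t1]; rewrite -addrA; apply: inb; apply: norm_le_coord => // j.
    rewrite !mxE /=; have [jk|] := ltnP j k.
      have /negbTE -> : j != K by apply/eqP => jK; move: jk; rewrite jK ltnn.
      by rewrite !mulr0 addr0 coord_le_norm.
    rewrite add0r => _; have [_|_] := eqVneq j K; last by rewrite !mulr0 normr0.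
    rewrite mulr1 normrM (ger0_norm t0).
    by rewrite (le_trans _ (coord_le_norm h K)) // ler_piMl.
  have [|t /andP[t0 t1]] := @segment_MVT R _ f (x + prefix_row h k) (h 0 K *: delta_mx 0 K).
    by move=> t t01; apply: (xr _ (hb t t01)).1.
  have /xr[/(_ (delta_mx 0 K)) dfy] : ball x r
      (x + prefix_row h k + t *: (h 0 K *: delta_mx 0 K)).
    by apply: hb; rewrite !ltW.
  move=> /(_ K); set y := x + prefix_row h k + t *: (h 0 K *: delta_mx 0 K) => dy.
  have Dy : 'D_(h 0 K *: delta_mx 0 K) f y = h 0 K * 'D_(delta_mx 0 K) f y.
    have dd : is_derive y (delta_mx 0 K) f ('D_(delta_mx 0 K) f y) by exact: derivableP.
    by have [_ ->] := is_deriveZv (h 0 K) dd.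
  rewrite Dy => fE.
  have -> : f (x + prefix_row h k + h 0 K *: delta_mx 0 K) - f x - (h 0 K * d K + S)
     = (f (x + prefix_row h k) - f x - S) + h 0 K * ('D_(delta_mx 0 K) f y - d K).
    rewrite -[f (_ + h 0 K *: _)](subrK (f (x + prefix_row h k))) fE; ring.
  rewrite -[k.+1%:R]natr1 mulrDl mul1r (le_trans (ler_normD _ _)) // lerD //.
  rewrite normrM mulrC ler_pM // ?coord_le_norm // distrC ltW //.
have := est n (leqnn n).
have -> : prefix_row h n = h by apply/rowP => j; rewrite mxE ltn_ord.
rewrite (eq_bigl xpredT); last by move=> j; rewrite ltn_ord.
rewrite [X in _ -> `|X| <= _](_ : _ = f (x + h) - f x - A h); last first.
  by rewrite !fctE /= [h + x]addrC opprD addrA.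
move=> /le_trans; apply; rewrite mulrA ler_wpM2r // /e'.
by rewrite mulrA ler_pdivrMr // mulrC ler_wpM2l // lerDl.
Qed.

End C1.

Section Chain.
Context {R : realType}.
Implicit Types E W : normedModType R.

(** Only the outer function has to be differentiable: for the inner one, on an arbitrary normed
    module, smoothness provides directional derivatives. *)
Lemma is_derive_comp E W W' (tau : E -> W) (F : W -> W') (x v : E) :
  derivable tau x v -> differentiable F (tau x) ->
  is_derive x v (F \o tau) ('D_('D_v tau x) F (tau x)).
Proof.
move=> dt dF; apply: line_is_derive.
have dl := is_derive_line0 dt.
have d1 : differentiable (fun s : R => tau (x + s *: v)) 0.
  by apply/derivable1_diffP; exact: ex_derive.
have dF' : differentiable F (tau (x + 0 *: v)) by rewrite scale0r addr0.
have d2 : differentiable (F \o (fun s : R => tau (x + s *: v))) 0.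
  exact: differentiable_comp.
apply: DeriveDef; first exact/derivable1_diffP.
rewrite [LHS]deriveE // [LHS](_ : _ = ('d F (tau (x + 0 *: v)) \o 'd (fun s : R => tau (x + s *: v)) 0) 1); last first.
  by rewrite -diff_comp.
rewrite /= -!deriveE // scale0r addr0.
by rewrite derive_val.
Qed.

Lemma continuous_row E n (tau : E -> 'rV[R]_n) (x : E) :
  (forall j, {for x, continuous (fun y => tau y 0 j : R)}) -> {for x, continuous tau}.
Proof.
move=> ct; apply/cvgrPdist_le => e e0.
have : \forall y \near x, forall j, `|tau x 0 j - tau y 0 j| <= e.
  apply: filter_forall => j.
  by have /cvgrPdist_le/(_ _ e0) := ct j.
apply: filterS => y ye; apply: norm_le_coord; first exact: ltW.
by move=> j; rewrite !mxE.
Qed.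

Lemma derivable_row E n (tau : E -> 'rV[R]_n) (x v : E) :
  (forall j, derivable (fun y => tau y 0 j : R) x v) -> derivable tau x v.
Proof. by move=> dt; apply/derivable_mxP => i j; rewrite ord1. Qed.

Lemma derive_row E n (tau : E -> 'rV[R]_n) (x v : E) j : derivable tau x v ->
  ('D_v tau x) 0 j = 'D_v (fun y => tau y 0 j : R) x.
Proof. by move=> dt; rewrite derive_mx // mxE. Qed.

Lemma deriveDv E W (f : E -> W) (x u v : E) : differentiable f x ->
  'D_(u + v) f x = 'D_u f x + 'D_v f x.
Proof. by move=> df; rewrite !deriveE // linearD. Qed.

Lemma deriveZv E W (f : E -> W) (x v : E) (c : R) : differentiable f x ->
  'D_(c *: v) f x = c *: 'D_v f x.
Proof. by move=> df; rewrite !deriveE // linearZ. Qed.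

Lemma derive_coord n (f : 'rV[R]_n -> R) (x v : 'rV[R]_n) : differentiable f x ->
  'D_v f x = \sum_j v 0 j * 'D_(delta_mx 0 j) f x.
Proof.
move=> df; rewrite {1}(row_sum_delta v) deriveE // linear_sum.
by apply: eq_bigr => j _; rewrite linearZ deriveE.
Qed.

End Chain.

Section Smooth.
Context {R : realType}.
Implicit Types (E W : normedModType R).

Lemma near_eq_continuous (T U : topologicalType) (f g : T -> U) (x : T) :
  (\forall y \near x, f y = g y) -> {for x, continuous f} ->
  {for x, continuous g}.
Proof.
rewrite /prop_for /continuous_at => fg; rewrite (nbhs_singleton fg) => cf.
by apply: cvg_trans cf; apply: near_eq_cvg.
Qed.

Lemma smooth_continuous E (U : set E) f x :
  smooth_on U f -> U x -> {for x, continuous f}.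
Proof. by move=> sf Ux; have [] := sf [::] x Ux. Qed.

Lemma smooth_derivable E (U : set E) f x v :
  smooth_on U f -> U x -> derivable f x v.
Proof. by move=> sf Ux; have [_ /(_ v)] := sf [::] x Ux. Qed.

Lemma iterD_rcons E (s : seq E) v f : iterD s ('D_v f) = iterD (rcons s v) f.
Proof. by elim: s => //= w s ->. Qed.

Lemma smooth_derive E (U : set E) f v : smooth_on U f -> smooth_on U ('D_v f).
Proof. by move=> sf s x Ux; rewrite iterD_rcons; exact: sf. Qed.

Lemma smooth_subset E (U V : set E) f : V `<=` U -> smooth_on U f -> smooth_on V f.
Proof. by move=> VU sf s x /VU; exact: sf. Qed.

Lemma smooth_local E (U : set E) f :
  (forall x, U x -> exists2 V, V x & smooth_on V f) -> smooth_on U f.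
Proof. by move=> sf s x /sf [V Vx]; exact. Qed.

(** A coinduction principle: a class closed under directional derivatives contains all iterated
    ones, so first-order regularity of its members is enough. Closure is needed only up to equality
    on [U], which passes to derivatives because [U] is open. *)
Lemma smooth_coind E (U : set E) (C : (E -> R^o) -> Prop) : open U ->
  (forall f, C f -> forall x, U x ->
    {for x, continuous f} /\ forall v, derivable f x v) ->
  (forall f v, C f -> exists2 g, C g & forall x, U x -> 'D_v f x = g x) ->
  forall f, C f -> smooth_on U f.
Proof.
move=> oU C0 C1 f Cf s.
have nU x : U x -> \forall y \near x, U y by move=> Ux; exact: open_nbhs_nbhs.
have [g Cg fg] : exists2 g, C g & forall x, U x -> iterD s f x = g x.
  elim: s => [|v s [g Cg sg]] /=; first by exists f.
  have [h Ch gh] := C1 g v Cg; exists h => // x Ux; rewrite -gh //.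
  by apply: near_eq_derive; apply: filterS (nU x Ux).
move=> x Ux; have [cg dg] := C0 g Cg x Ux.
have gf : \forall y \near x, g y = iterD s f y.
  by apply: filterS (nU x Ux) => y /fg.
split; last by move=> v; exact: near_eq_derivable (dg v).
exact: near_eq_continuous gf cg.
Qed.

Lemma smooth_eq E (U : set E) (f g : E -> R^o) : open U ->
  (forall x, U x -> f x = g x) -> smooth_on U f -> smooth_on U g.
Proof.
move=> oU fg sf.
apply: (@smooth_coind _ U (fun h : E -> R^o => exists s, forall x, U x -> h x = iterD s f x)) => //.
- move=> h [s hs] x Ux; have [cf df] := sf s x Ux.
  have nh : \forall y \near x, iterD s f y = h y.
    by apply: filterS (open_nbhs_nbhs (conj oU Ux)) => y /hs.
  split; last by move=> v; exact: near_eq_derivable (df v).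
  exact: near_eq_continuous nh cf.
- move=> h v [s hs]; exists (iterD (v :: s) f); first by exists (v :: s).
  move=> x Ux; apply: near_eq_derive.
  by apply: filterS (open_nbhs_nbhs (conj oU Ux)) => y /hs.
- by exists [::] => x Ux /=; rewrite fg.
Qed.

Lemma smooth_differentiable_row n (U : set 'rV[R]_n) f x : open U ->
  smooth_on U f -> U x -> differentiable f x.
Proof.
move=> oU sf Ux; apply: C1_differentiable.
  apply: filterS (open_nbhs_nbhs (conj oU Ux)) => y Uy v.
  exact: smooth_derivable sf Uy.
by move=> v; have [] := sf [:: v] x Ux.
Qed.

Lemma smooth_differentiable1 (U : set R^o) f x :
  smooth_on U f -> U x -> differentiable (f : R -> R) x.
Proof.
by move=> sf Ux; apply/derivable1_diffP; exact: smooth_derivable sf Ux.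
Qed.

(* This class is stable under directional derivatives, so smooth_coind applies
   to it: sums, products, inverses and compositions are handled at once. *)
Inductive generated E (U : set E) : (E -> R^o) -> Prop :=
| gen_base f : smooth_on U f -> generated U f
| gen_comp n (F : 'rV[R]_n -> R^o) V (tau : E -> 'rV[R]_n) : open V ->
    smooth_on V F -> (forall x, U x -> V (tau x)) ->
    (forall j, smooth_on U (fun x => tau x 0 j)) -> generated U (F \o tau)
| gen_comp1 (F : R^o -> R^o) V (t : E -> R^o) : open V ->
    smooth_on V F -> (forall x, U x -> V (t x)) ->
    smooth_on U t -> generated U (F \o t)
| gen_inv f : smooth_on U f -> (forall x, U x -> f x != 0) ->
    generated U (fun x => (f x)^-1)
| gen_add f g : generated U f -> generated U g -> generated U (f + g)
| gen_mul f g : generated U f -> generated U g -> generated U (f * g).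

Lemma smooth_cst E (U : set E) (c : R) : smooth_on U (cst c : E -> R^o).
Proof.
move=> s; have [d ->] : exists d : R, iterD s (cst c : E -> R^o) = cst d.
  elim: s => [|v s [d IH]] /=; first by exists c.
  by exists 0; rewrite IH; apply/funext => x; rewrite derive_cst.
move=> x _; split; first exact: cst_continuous.
by move=> v; exact: derivable_cst.
Qed.

Lemma generated_sum E (U : set E) n (F : 'I_n -> E -> R^o) :
  (forall j, generated U (F j)) -> generated U (\sum_j F j).
Proof.
move=> gF; elim/big_ind : _ => //; last by move=> f g; exact: gen_add.
exact/gen_base/smooth_cst.
Qed.

Lemma generated_C1 E (U : set E) f : open U -> generated U f ->
  forall x, U x -> {for x, continuous f} /\ forall v, derivable f x v.
Proof.
move=> oU; elim=> {f}.
- by move=> f sf x Ux; have := sf [::] x Ux.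
- move=> n F V tau oV sF UV st x Ux.
  have dF := smooth_differentiable_row oV sF (UV _ Ux).
  split.
    apply: continuous_comp; last exact: differentiable_continuous.
    by apply: continuous_row => j; exact: smooth_continuous (st j) Ux.
  move=> v; apply: ex_derive; apply: is_derive_comp => //.
  by apply: derivable_row => j; exact: smooth_derivable (st j) Ux.
- move=> F V t oV sF UV st x Ux.
  have dF := smooth_differentiable1 sF (UV _ Ux).
  split.
    apply: continuous_comp; last exact: differentiable_continuous.
    exact: smooth_continuous st Ux.
  move=> v; apply: ex_derive; apply: is_derive_comp => //.
  exact: smooth_derivable st Ux.
- move=> f sf f0 x Ux; split.
    by apply: cvgV; [exact: f0|exact: smooth_continuous sf Ux].
  by move=> v; apply: derivableV; [exact: f0|exact: smooth_derivable sf Ux].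
- move=> f g _ fx _ gx x Ux; have [cf df] := fx x Ux; have [cg dg] := gx x Ux.
  by split=> [|v]; [exact: continuousD|exact: derivableD].
- move=> f g _ fx _ gx x Ux; have [cf df] := fx x Ux; have [cg dg] := gx x Ux.
  by split=> [|v]; [exact: continuousM|exact: derivableM].
Qed.

Lemma generated_derive E (U : set E) f v : open U -> generated U f ->
  exists2 g, generated U g & forall x, U x -> 'D_v f x = g x.
Proof.
move=> oU; elim=> {f}.
- by move=> f sf; exists ('D_v f) => //; apply: gen_base; exact: smooth_derive.
- move=> n F V tau oV sF UV st.
  exists (\sum_j ((fun x => 'D_v (fun y => tau y 0 j : R) x) *
     (('D_(delta_mx 0 j) F) \o tau))).
    apply: generated_sum => j; apply: gen_mul.
      by apply: gen_base; apply: smooth_derive; exact: st.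
    by apply: gen_comp oV _ UV st; exact: smooth_derive.
  move=> x Ux.
  have dF := smooth_differentiable_row oV sF (UV _ Ux).
  have dt : derivable tau x v.
    by apply: derivable_row => j; exact: smooth_derivable (st j) Ux.
  have [_ ->] := is_derive_comp dt dF.
  rewrite derive_coord // fct_sumE; apply: eq_bigr => j _.
  by rewrite derive_row.
- move=> F V t oV sF UV st.
  exists ('D_v t * ('D_1 F \o t)).
    apply: gen_mul; first by apply: gen_base; exact: smooth_derive.
    by apply: gen_comp1 oV _ UV st; exact: smooth_derive.
  move=> x Ux.
  have dF := smooth_differentiable1 sF (UV _ Ux).
  have dt : derivable t x v by exact: smooth_derivable st Ux.
  have [_ ->] := is_derive_comp dt dF.
  have -> : 'D_v t x = 'D_v t x *: (1 : R^o) by rewrite [RHS]mulr1.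
  by rewrite (deriveZv _ _ dF).
- move=> f sf f0.
  exists (cst (-1) * ('D_v f * ((fun x => (f x)^-1) * (fun x => (f x)^-1)))).
    apply: gen_mul; first exact/gen_base/smooth_cst.
    apply: gen_mul; first by apply: gen_base; exact: smooth_derive.
    by apply: gen_mul; exact: gen_inv.
  move=> x Ux; rewrite deriveV //; last exact: smooth_derivable sf Ux.
    by rewrite !fctE /= /GRing.scale /=; have := f0 x Ux; move: (f x) => a a0; field.
  exact: f0.
- move=> f g gf [f' gf' ff'] gg [g' gg' gg'E]; exists (f' + g'); first exact: gen_add.
  move=> x Ux; rewrite deriveD ?ff' ?gg'E //.
  + exact: (generated_C1 oU gf Ux).2.
  + exact: (generated_C1 oU gg Ux).2.
- move=> f g gf [f' gf' ff'] gg [g' gg' gg'E].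
  exists (f * g' + g * f'); first by apply: gen_add; exact: gen_mul.
  move=> x Ux; rewrite deriveM ?ff' ?gg'E //.
  + exact: (generated_C1 oU gf Ux).2.
  + exact: (generated_C1 oU gg Ux).2.
Qed.

Lemma generated_smooth E (U : set E) f : open U -> generated U f -> smooth_on U f.
Proof.
move=> oU; apply: smooth_coind => // {}f.
  by move=> gf x Ux; exact: generated_C1 gf x Ux.
by move=> v gf; exact: generated_derive.
Qed.

Lemma smooth_add E (U : set E) (f g : E -> R^o) : open U ->
  smooth_on U f -> smooth_on U g -> smooth_on U (fun x => f x + g x).
Proof.
by move=> oU sf sg; apply: (generated_smooth oU); apply: gen_add; exact: gen_base.
Qed.

Lemma smooth_mul E (U : set E) (f g : E -> R^o) : open U ->
  smooth_on U f -> smooth_on U g -> smooth_on U (fun x => f x * g x).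
Proof.
by move=> oU sf sg; apply: (generated_smooth oU); apply: gen_mul; exact: gen_base.
Qed.

Lemma smooth_inv E (U : set E) (f : E -> R^o) : open U ->
  smooth_on U f -> (forall x, U x -> f x != 0) -> smooth_on U (fun x => (f x)^-1).
Proof. by move=> oU sf f0; apply: (generated_smooth oU); exact: gen_inv. Qed.

Lemma smooth_comp E (U : set E) n (V : set 'rV[R]_n) F (tau : E -> 'rV[R]_n) :
  open U -> open V -> smooth_on V F -> (forall x, U x -> V (tau x)) ->
  (forall j, smooth_on U (fun x => tau x 0 j)) -> smooth_on U (fun x => F (tau x)).
Proof.
by move=> oU oV sF UV st; apply: (generated_smooth oU); exact: gen_comp oV sF UV st.
Qed.

Lemma smooth_comp1 E (U : set E) (V : set R^o) F (t : E -> R^o) :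
  open U -> open V -> smooth_on V F -> (forall x, U x -> V (t x)) ->
  smooth_on U t -> smooth_on U (fun x => F (t x)).
Proof.
by move=> oU oV sF UV st; apply: (generated_smooth oU); exact: gen_comp1 oV sF UV st.
Qed.

Lemma smooth_linear E (U : set E) (f : E -> R^o) :
  (forall x, {for x, continuous f}) -> (forall x v, derivable f x v) ->
  (forall v, exists c, forall x, 'D_v f x = c) -> smooth_on U f.
Proof.
move=> cf df Df [|v s] x Ux; first by split => // v.
(* The last direction of the list is the innermost derivative, and it already produces a
   constant. *)
have [c Dc] := Df (last v s).
have -> : iterD (v :: s) f = iterD (belast v s) (cst c).
  rewrite lastI -iterD_rcons; congr (iterD _ _); exact/funext.
exact: (@smooth_cst E setT c).
Qed.

Lemma is_derive_coordinate n (j : 'I_n) (x v : 'rV[R]_n) :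
  is_derive x v (fun x : 'rV[R]_n => x 0 j : R) (v 0 j).
Proof.
have d : derivable (fun x : 'rV[R]_n => x 0 j : R) x v.
  by apply: diff_derivable; exact: differentiable_coord.
apply: DeriveDef => //.
by have := @derive_row R 'rV[R]_n n id x v j (@derivable_id _ _ x v); rewrite derive_id.
Qed.

Lemma smooth_coord n (U : set 'rV[R]_n) (j : 'I_n) :
  smooth_on U (fun x : 'rV[R]_n => x 0 j : R^o).
Proof.
apply: smooth_linear => [x|x v|v].
- by apply: differentiable_continuous; exact: differentiable_coord.
- by have d := is_derive_coordinate j x v; exact: ex_derive.
- by exists (v 0 j) => x; have [_ ->] := is_derive_coordinate j x v.
Qed.

Lemma smooth_id (U : set R^o) : smooth_on U (fun x : R^o => x : R^o).
Proof.
apply: smooth_linear => [x|x v|v]; first exact: cvg_id.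
  exact: derivable_id.
by exists v => x; rewrite derive_id.
Qed.

End Smooth.

(** * Symmetry of second derivatives and d d = 0 *)

Section Schwarz.
Context {R : realType}.
Implicit Types (E : normedModType R).

Lemma is_derive_translate E (f : E -> R) (y u v : E) : derivable f (y + v) u ->
  is_derive y u (fun z => f (z + v)) ('D_u f (y + v)).
Proof.
move=> df; apply: line_is_derive; have := is_derive_line0 df.
rewrite (_ : (fun s : R => f (y + v + s *: u)) = (fun s : R => f (y + s *: u + v))) //.
by apply/funext => s; rewrite addrAC.
Qed.

Lemma smooth_deriveZv E (U : set E) (f : E -> R^o) (x v : E) (c : R) :
  smooth_on U f -> U x -> 'D_(c *: v) f x = c * 'D_v f x.
Proof.
move=> sf Ux; have dd := derivableP (smooth_derivable sf Ux : derivable f x v).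
by have [_ ->] := is_deriveZv c dd.
Qed.

(** The mean value theorem is applied twice: along [u] to z |-> f (z + v) - f z, then along [v] to
    the derivative of [f] in the direction [u]. *)
Lemma second_difference E (U : set E) (f : E -> R^o) (x u v : E) :
  smooth_on U f ->
  (forall s t : R, 0 <= s <= 1 -> 0 <= t <= 1 -> U (x + s *: u + t *: v)) ->
  exists s t : R, [/\ 0 <= s <= 1, 0 <= t <= 1 &
    f (x + u + v) - f (x + u) - (f (x + v) - f x)
      = 'D_v ('D_u f) (x + s *: u + t *: v)].
Proof.
move=> sf Ux.
have i0 : 0 <= (0 : R) <= 1 by rewrite lexx ler01.
have i1 : 0 <= (1 : R) <= 1 by rewrite lexx ler01.
pose g z : R := f (z + v) - f z.
have dg s : 0 <= s <= 1 ->
    is_derive (x + s *: u) u g ('D_u f (x + s *: u + v) - 'D_u f (x + s *: u)).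
  move=> s01; apply: is_deriveB.
    apply: is_derive_translate; apply: smooth_derivable sf _.
    by have := Ux s 1 s01 i1; rewrite scale1r.
  apply: derivableP; apply: smooth_derivable sf _.
  by have := Ux s 0 s01 i0; rewrite scale0r addr0.
have [s s01 | s /andP[/ltW s0 /ltW s1]] := @segment_MVT R E g x u.
  by have dgs := dg s s01; exact: ex_derive.
have s01 : 0 <= s <= 1 by rewrite s0.
have [_ ->] := dg s s01 => gE.
have [t t01|t /andP[/ltW t0 /ltW t1] tE] :=
    @segment_MVT R E ('D_u f : E -> R) (x + s *: u) v.
  by apply: smooth_derivable (smooth_derive _ sf) _; exact: Ux.
exists s, t; split => //; first by rewrite t0.
by rewrite -tE -gE.
Qed.

(** Here [a] and [b] are the two mixed derivatives at the point, [A] and [B] nearby values of them,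
    and [L1], [L2] the same second difference computed in the two orders. *)
Lemma common_multiple_close (a b A B h L1 L2 : R) : h != 0 ->
  L1 = h * (h * A) -> L2 = h * (h * B) -> L1 = L2 ->
  `|a - A| < `|a - b| / 2 -> `|b - B| < `|a - b| / 2 -> False.
Proof.
move=> h0 -> -> /(mulfI h0)/(mulfI h0) ->; rewrite (distrC b) => aB Bb.
have : `|a - b| < `|a - b| / 2 + `|a - b| / 2.
  by rewrite (le_lt_trans (ler_distD B _ _)) // ltrD.
by rewrite -splitr ltxx.
Qed.

(** The second difference over the parallelogram spanned by [h *: u] and [h *: v] is symmetric in
    [u] and [v], and equals h^2 times either mixed derivative at some point of the parallelogram. *)
Lemma smooth_schwarz E (U : set E) (f : E -> R^o) (x u v : E) :
  open U -> smooth_on U f -> U x -> 'D_v ('D_u f) x = 'D_u ('D_v f) x.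
Proof.
move=> oU sf Ux; apply/eqP; rewrite -subr_eq0; apply/negPn/negP => ne.
set a := 'D_v ('D_u f) x; set b := 'D_u ('D_v f) x.
have e0 : 0 < `|a - b| / 2 by rewrite divr_gt0 ?normr_gt0.
have na : \forall y \near x, [/\ U y, `|a - 'D_v ('D_u f) y| < `|a - b| / 2
    & `|b - 'D_u ('D_v f) y| < `|a - b| / 2].
  have ca := smooth_continuous (smooth_derive v (smooth_derive u sf)) Ux.
  have cb := smooth_continuous (smooth_derive u (smooth_derive v sf)) Ux.
  have nU := open_nbhs_nbhs (conj oU Ux).
  move/cvgrPdist_lt/(_ _ e0) : ca => ca.
  move/cvgrPdist_lt/(_ _ e0) : cb => cb.
  apply: filterS (filterI nU (filterI ca cb)) => y [Uy [ya yb]].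
  exact: And3 Uy ya yb.
have /nbhs_ballP[r /= r0 xr] := na.
have uv1 : 0 < `|u| + `|v| + 1 by rewrite ltr_wpDl // addr_ge0.
(* The whole parallelogram has to stay in the ball where both mixed derivatives are nearly
   constant. *)
have [h h0 hr] : exists2 h : R, 0 < h & h * (`|u| + `|v|) < r.
  exists (r / (`|u| + `|v| + 1)); first by rewrite divr_gt0.
  by rewrite mulrAC ltr_pdivrMr // ltr_pM2l // ltrDl.
have hb (s t : R) (p q : E) : 0 <= s <= 1 -> 0 <= t <= 1 ->
    `|p| + `|q| <= `|u| + `|v| -> ball x r (x + s *: (h *: p) + t *: (h *: q)).
  move=> /andP[s0 s1] /andP[t0 t1] pq.
  rewrite -ball_normE /= opprD addrA opprD addNKr.
  rewrite (le_lt_trans (ler_normD _ _)) // !normrN !normrZ.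
  rewrite (gtr0_norm h0) (ger0_norm s0) (ger0_norm t0).
  apply: le_lt_trans hr; rewrite (@le_trans _ _ (h * `|p| + h * `|q|)) //.
    by rewrite lerD // ler_piMl // mulr_ge0 // ltW.
  by rewrite -mulrDr ler_wpM2l // ltW.
have sU : smooth_on (ball x r) f by apply: smooth_subset sf => y /xr[].
have [s [t [s01 t01 E1]]] := @second_difference E _ f x (h *: u) (h *: v) sU
  (fun s t s01 t01 => hb s t u v s01 t01 (lexx _)).
have vu : `|v| + `|u| <= `|u| + `|v| by rewrite addrC.
have [s' [t' [s01' t01' E2]]] := @second_difference E _ f x (h *: v) (h *: u) sU
  (fun s t s01 t01 => hb s t v u s01 t01 vu).
have D2 p q y : U y -> 'D_(h *: q) ('D_(h *: p) f) y = h * (h * 'D_q ('D_p f) y).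
  move=> Uy; rewrite (smooth_deriveZv _ _ (smooth_derive _ sf) Uy); congr (_ * _).
  rewrite (_ : 'D_q ('D_(h *: p) f) y = 'D_q (h *: 'D_p f) y).
    rewrite deriveZ //; exact: smooth_derivable (smooth_derive _ sf) Uy.
  apply: near_eq_derive; apply: filterS (open_nbhs_nbhs (conj oU Uy)) => z Uz.
  exact: smooth_deriveZv sf Uz.
have [Uy ya _] := xr _ (hb s t u v s01 t01 (lexx _)).
have [Uz _ zb] := xr _ (hb s' t' v u s01' t01' vu).
have E1' := etrans E1 (D2 u v _ Uy).
have E2' := etrans E2 (D2 v u _ Uz).
apply: (common_multiple_close (lt0r_neq0 h0) E1' E2' _ ya zb).
by rewrite -[x + h *: v + h *: u]addrAC; ring.
Qed.

Definition gradient n (phi : 'rV[R]_n -> R^o) (x : 'rV[R]_n) : 'rV[R]_n :=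
  \row_i 'D_(delta_mx 0 i) phi x.

Lemma smooth_gradient n (U : set 'rV[R]_n) (phi : 'rV[R]_n -> R^o) i :
  smooth_on U phi -> smooth_on U (fun x => gradient phi x 0 i).
Proof.
move=> sp; rewrite (_ : (fun _ => _) = 'D_(delta_mx 0 i) phi).
  exact: smooth_derive.
by apply/funext => x; rewrite mxE.
Qed.

Lemma dform_gradient (U : set 'rV[R]_3) (phi : 'rV[R]_3 -> R^o) x u v :
  open U -> smooth_on U phi -> U x -> dform (gradient phi) x u v = 0.
Proof.
move=> oU sp Ux; rewrite /dform.
have D (w w' : 'rV[R]_3) : \sum_i 'D_w (fun y => gradient phi y 0 i : R^o) x * w' 0 i =
    'D_w' ('D_w phi) x.
  rewrite derive_coord; last first.
    exact: smooth_differentiable_row oU (smooth_derive _ sp) Ux.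
  apply: eq_bigr => i _; rewrite mulrC; congr (_ * _).
  rewrite (_ : (fun _ => _) = 'D_(delta_mx 0 i) phi).
    exact: smooth_schwarz oU sp Ux.
  by apply/funext => y; rewrite mxE.
by rewrite sumrB !D (smooth_schwarz u v oU sp Ux) subrr.
Qed.

End Schwarz.

(** * Cutoff functions *)

Section Cutoff.
Context {R : realType}.

(* The wings of a triple line provide the flat function from which cutoffs are
   built, so exp (- 1 / x) is not needed. *)
Lemma wing_flat (i : 'I_2) (e : R) f : wing i e f ->
  exists psi : R^o -> R^o, [/\ smooth_on setT psi,
    forall x, x <= 0 -> psi x = 0 & forall x, 0 < x -> 0 < psi x].
Proof.
move=> [sf f0 f1]; exists (fun x => e * f (const_mx (- x))); split.
- apply: (@smooth_mul _ _ setT (cst e)); [exact: openT|exact: smooth_cst|].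
  apply: (@smooth_comp _ _ setT 2 setT f (fun x : R^o => const_mx (- x))) => //;
    [exact: openT|exact: openT|move=> j].
  rewrite (_ : (fun _ => _) = (fun x : R^o => cst (-1) x * x)).
    by apply: smooth_mul; [exact: openT|exact: smooth_cst|exact: smooth_id].
  by apply/funext => x; rewrite mxE mulN1r.
- by move=> x x0; rewrite f0 ?mulr0 // mxE oppr_ge0.
- by move=> x x0; apply: f1; rewrite mxE oppr_lt0.
Qed.

(** The quotient psi(x) / (psi(x) + psi(1 - x)) is a smooth step from 0 to 1 on [0, 1]; multiplying
    two reflected copies gives the plateau. The plateau reaches 2 so that, after rescaling by [r],
    the cutoff is still 1 on a neighbourhood of the ball of radius [r]. *)
Lemma exists_cutoff (psi : R^o -> R^o) : smooth_on setT psi ->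
  (forall x, x <= 0 -> psi x = 0) -> (forall x, 0 < x -> 0 < psi x) ->
  exists rho : R^o -> R^o, [/\ smooth_on setT rho,
    forall x : R, `|x| <= 2 -> rho x = 1 & forall x : R, 3 <= `|x| -> rho x = 0].
Proof.
move=> sp p0 p1.
have pge x : 0 <= psi x by have [/p0->//|/p1/ltW] := leP x 0.
pose D (x : R^o) : R^o := psi x + psi (1 + (-1) * x).
have D0 x : 0 < D x.
  rewrite /D; have [x0|/p1 x0] := leP x 0; last by rewrite ltr_wpDr.
  by rewrite ltr_wpDl // p1 //; lra.
pose S (x : R^o) : R^o := psi x * (D x)^-1.
have affine (a b : R) : smooth_on setT (fun x : R^o => a + b * x : R^o).
  apply: smooth_add; [exact: openT|exact: smooth_cst|].
  by apply: smooth_mul; [exact: openT|exact: smooth_cst|exact: smooth_id].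
have sS : smooth_on setT S.
  apply: smooth_mul; [exact: openT|exact: sp|].
  apply: smooth_inv; [exact: openT| |by move=> x _; rewrite gt_eqF].
  apply: smooth_add; [exact: openT|exact: sp|].
  exact: (smooth_comp1 openT openT sp (fun _ _ => I) (affine 1 (-1))).
have S0 x : x <= 0 -> S x = 0 by move=> x0; rewrite /S p0 // mul0r.
have S1 x : 1 <= x -> S x = 1.
  move=> x1; have := D0 x; rewrite /S /D (p0 (1 + (-1) * x)); last by lra.
  by rewrite addr0 => x0; rewrite divff // gt_eqF.
exists (fun x => S (3 + (-1) * x) * S (3 + 1 * x)); split.
- apply: smooth_mul; first exact: openT.
    exact: (smooth_comp1 openT openT sS (fun _ _ => I) (affine 3 (-1))).
  exact: (smooth_comp1 openT openT sS (fun _ _ => I) (affine 3 1)).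
- by move=> x; rewrite ler_norml => /andP[x0 x1]; rewrite !S1 ?mulr1 //; lra.
- move=> x; have [x0|x0] := leP 0 x.
    by rewrite ger0_norm // => x3; rewrite S0 ?mul0r //; lra.
  by rewrite ltr0_norm // => x3; rewrite [X in _ * X]S0 ?mulr0 //; lra.
Qed.

End Cutoff.

(** * Zeros of functions of one variable *)

Section OneVariable.
Context {R : realType}.
Implicit Types (b g : R^o -> R^o).

(** The bounds on [c] allow a second application of the mean value theorem, between [c] and [u],
    with control of the length. *)
Lemma segment_mvt b (r s t u : R) : r < s -> smooth_on (ball (0 : R^o) s) b ->
  `|t| <= r -> `|u| <= r ->
  exists c : R, [/\ `|c| <= r, `|c - u| <= `|t - u|
    & b t - b u = (t - u) * 'D_1 b c].
Proof.
move=> rs sb tr ur.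
have inr (h : R) : 0 <= h <= 1 -> `|u + h * (t - u)| <= r.
  move=> /andP[h0 h1].
  have -> : u + h * (t - u) = h * t + (1 - h) * u by ring.
  rewrite (le_trans (ler_normD _ _)) // !normrM (ger0_norm h0) [`|1 - h|]ger0_norm ?subr_ge0 //.
  have : h * `|t| + (1 - h) * `|u| <= h * r + (1 - h) * r.
    by rewrite lerD // ler_wpM2l // subr_ge0.
  by rewrite -mulrDl [h + _]addrC subrK mul1r.
have inb (h : R) : `|h| <= r -> ball (0 : R^o) s h.
  by move=> hr; rewrite -ball_normE /= sub0r normrN (le_lt_trans hr).
have [h h01|h /andP[h0 h1] hE] := @segment_MVT R R^o b u (t - u).
  by apply: smooth_derivable sb _; exact/inb/inr.
have h01 : 0 <= h <= 1 by rewrite !ltW.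
exists (u + h * (t - u)); split; first exact: inr.
  by rewrite addrC addKr normrM (gtr0_norm h0) ler_piMl // ltW.
have E : u + (t - u) = t by rewrite addrC subrK.
rewrite E in hE; rewrite hE.
have := @smooth_deriveZv R R^o _ b (u + h * (t - u)) (1 : R) (t - u) sb (inb _ (inr _ h01)).
by rewrite [(t - u) *: (1 : R)]mulr1.
Qed.

Lemma smooth_within b (r s : R) : r < s -> smooth_on (ball (0 : R^o) s) b ->
  {within `[- r, r], continuous (b : R -> R)}.
Proof.
move=> rs sb; apply: continuous_in_subspaceT => t; rewrite inE /= in_itv /= -ler_norml => tr.
apply: smooth_continuous sb _.
by rewrite -ball_normE /= sub0r normrN (le_lt_trans tr).
Qed.

Lemma smooth_bounded b (r s : R) : 0 < r -> r < s ->
  smooth_on (ball (0 : R^o) s) b ->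
  exists2 L : R, 0 < L & forall t, `|t| <= r -> `|b t| <= L.
Proof.
move=> r0 rs sb.
have rr : - r <= r by lra.
have cb : {within `[- r, r], continuous (fun t : R => `|b t|)}.
  by move=> x; apply: cvg_norm; exact: (smooth_within rs sb).
have [c _ cmax] := EVT_max rr cb.
exists (`|b c| + 1); first by rewrite ltr_wpDl.
move=> t tr; have := cmax t; rewrite in_itv /= -ler_norml => /(_ tr) tc.
by rewrite (le_trans tc) // lerDl.
Qed.

(** The function [b] will be the form restricted to an axis of a flow box. Its centre may be a
    vertex, where both axes must be transverse; hence the condition at 0. *)
Definition regular_zeros b (r : R) : Prop :=
  b 0 != 0 /\ forall t : R, `|t| <= r -> b t = 0 -> 'D_1 b t != 0.

(** Simplicity of the zeros says that |b| + |b'| is positive on a compact interval; its minimum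
    turns this into a quantitative condition. *)
Lemma regular_zeros_bound b (r s : R) : 0 < r -> r < s ->
  smooth_on (ball (0 : R^o) s) b -> regular_zeros b r ->
  exists2 m : R, 0 < m & forall t, `|t| <= r -> m <= `|b t| + `|'D_1 b t|.
Proof.
move=> r0 rs sb [_ nb].
have rr : - r <= r by lra.
have cb : {within `[- r, r], continuous (fun t : R => `|b t| + `|'D_1 b t|)}.
  move=> x; apply: cvgD; apply: cvg_norm; first exact: (smooth_within rs sb).
  exact: (smooth_within rs (smooth_derive _ sb)).
have [c + cmin] := EVT_min rr cb; rewrite in_itv /= -ler_norml => cr.
exists (`|b c| + `|'D_1 b c|).
  have [bc|bc] := eqVneq (b c) 0; last by rewrite ltr_wpDr // normr_gt0.
  by rewrite ltr_wpDl // normr_gt0 nb.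
by move=> t tr; apply: cmin; rewrite in_itv /= -ler_norml.
Qed.

Lemma derive_perturb b g (r s t e : R) : r < s ->
  smooth_on (ball (0 : R^o) s) b -> smooth_on (ball (0 : R^o) s) g -> `|t| <= r ->
  'D_1 (fun x : R^o => b x + e * g x : R^o) t = 'D_1 b t + e * 'D_1 g t.
Proof.
move=> rs sb sg tr.
have ts : ball (0 : R^o) s t.
  by rewrite -ball_normE /= sub0r normrN (le_lt_trans tr).
have db : derivable b t (1 : R) by exact: smooth_derivable sb ts.
have dg : derivable g t (1 : R) by exact: smooth_derivable sg ts.
rewrite (_ : (fun _ => _) = b + (e *: g)) //.
by have [_] := is_deriveD (derivableP db) (is_deriveZ e (derivableP dg)).
Qed.

(** If [M] and [M'] bound |g| and |g'|, a perturbation with |e| (M + M') < m cannot cancel |b| +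
    |b'| >= m; the second term of the minimum protects the value at 0. *)
Lemma regular_zeros_open b g (r s : R) : 0 < r -> r < s ->
  smooth_on (ball (0 : R^o) s) b -> smooth_on (ball (0 : R^o) s) g ->
  regular_zeros b r ->
  exists2 d : R, 0 < d & forall e : R, `|e| < d ->
    regular_zeros (fun t => b t + e * g t) r.
Proof.
move=> r0 rs sb sg nb.
have [m m0 mb] := regular_zeros_bound r0 rs sb nb.
have [M M0 gM] := smooth_bounded r0 rs sg.
have [M' M'0 gM'] := smooth_bounded r0 rs (smooth_derive (1 : R) sg).
have [b0 _] := nb.
exists (Num.min (m / (M + M')) (`|b 0| / (M + M'))).
  by rewrite lt_min !divr_gt0 ?addr_gt0 // normr_gt0.
move=> e; rewrite lt_min !ltr_pdivlMr ?addr_gt0 // => /andP[em e0].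
have small t : `|t| <= r -> `|e * g t| + `|e * 'D_1 g t| < m.
  move=> tr; apply: le_lt_trans em; rewrite !normrM -mulrDr ler_wpM2l //.
  by rewrite lerD // ?gM ?gM'.
split.
  apply/negP => /eqP be; move: e0; have -> : b 0 = - (e * g 0) by lra.
  rewrite normrN normrM ltNge => /negP; apply; rewrite ler_wpM2l //.
  by rewrite (le_trans (gM 0 _)) ?normr0 ?(ltW r0) // lerDl ltW.
move=> t tr bt; apply/negP; rewrite (derive_perturb _ rs) // => /eqP dbt.
have := small t tr; have := mb t tr.
have -> : b t = - (e * g t) by lra.
have -> : 'D_1 b t = - (e * 'D_1 g t) by lra.
by rewrite !normrN => /le_lt_trans h /h; rewrite ltxx.
Qed.

Definition cell (r l t : R) : nat := Num.truncn ((t + r) / l).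

Lemma cell_close (r l t u : R) : 0 < l -> `|t| <= r -> `|u| <= r ->
  cell r l t = cell r l u -> `|t - u| <= l.
Proof.
move=> l0 tr ur E.
have ge0 v : `|v| <= r -> 0 <= (v + r) / l.
  rewrite ler_norml => /andP[vr _]; rewrite divr_ge0 ?(ltW l0) //.
  by rewrite -lerBlDr sub0r.
have := truncn_itv (ge0 t tr); have := truncn_itv (ge0 u ur).
rewrite -/(cell r l t) -/(cell r l u) E -natr1.
set n := (cell r l u)%:R; rewrite !ler_pdivlMr // !ltr_pdivrMr //.
by move=> /andP[u1 u2] /andP[t1 t2]; rewrite ler_norml; apply/andP; split; lra.
Qed.

Lemma cell_lt (r l t : R) n : 0 < l -> `|t| <= r -> 2 * r < n%:R * l ->
  (cell r l t < n)%N.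
Proof.
rewrite ler_norml => l0 /andP[t0 t1] rn.
rewrite truncn_lt_nat; last by rewrite divr_ge0 ?(ltW l0) //; lra.
by rewrite ltr_pdivrMr //; lra.
Qed.

(** Between two distinct zeros at distance at most [l] there would be a critical point [c], with |b
    c| <= l * L < m, against the lower bound [m] for |b| + |b'|. So every cell of length [l]
    contains at most one zero. *)
Lemma regular_zeros_finite b (r s : R) : 0 < r -> r < s ->
  smooth_on (ball (0 : R^o) s) b -> regular_zeros b r ->
  finite_set [set t : R | `|t| <= r /\ b t = 0].
Proof.
move=> r0 rs sb nb.
have [m m0 mb] := regular_zeros_bound r0 rs sb nb.
have [L L0 bL] := smooth_bounded r0 rs (smooth_derive (1 : R) sb).
have [L' L'0 bL'] := smooth_bounded r0 rs (smooth_derive (1 : R) (smooth_derive (1 : R) sb)).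
pose l := m / (2 * (L + L')).
have l0 : 0 < l by rewrite divr_gt0 // mulr_gt0 // addr_gt0.
have sep t u : `|t| <= r -> `|u| <= r -> b t = 0 -> b u = 0 ->
    `|t - u| <= l -> t = u.
  move=> tr ur bt bu tul; apply/eqP; rewrite -subr_eq0; apply/negPn/negP => tu.
  have [c [cr cu]] := segment_mvt rs sb tr ur.
  rewrite bt bu subrr => /esym/eqP; rewrite mulf_eq0 (negbTE tu) /= => /eqP dc.
  have [c1 [c1r _ E]] := segment_mvt rs sb cr ur.
  have := mb c cr; rewrite dc normr0 addr0 leNgt => /negP; apply.
  rewrite -[b c]subr0 -bu E normrM.
  apply: (@le_lt_trans _ _ (l * L)); first by rewrite ler_pM // ?bL // (le_trans cu).
  rewrite /l mulrAC ltr_pdivrMr ?mulr_gt0 ?addr_gt0 // ltr_pM2l //; lra.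
pose n := (Num.truncn (2 * r / l)).+1.
have nl : 2 * r < n%:R * l by rewrite -ltr_pdivrMr // truncnS_gt.
pose Z : set R := [set t : R | `|t| <= r /\ b t = 0].
(* The default 0 for cells without a zero is harmless: the image of [f] only has to contain all
   zeros. *)
pose f (i : 'I_n) : R := xget 0 [set t : R | Z t /\ cell r l t = i].
apply: (@sub_finite_set _ _ (f @` setT)); last exact: finite_image.
move=> t [tr bt]; exists (Ordinal (cell_lt l0 tr nl)) => //.
rewrite /f; case: xgetP => [u _ [[ur bu] /= E]|/(_ t)]; last by case.
by apply: (sep _ _ ur tr bu bt); exact: (cell_close l0 ur tr E).
Qed.

Lemma natr_dist (m k : nat) : m != k -> (1 : R) <= `|m%:R - k%:R|.
Proof.
wlog mk : m k / (m < k)%N => [H mk|_].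
  have [lt|lt|E] := ltngtP m k; [exact: H| |by rewrite E eqxx in mk].
  by rewrite distrC; apply: H; rewrite // eq_sym.
by rewrite distrC -natrB ?(ltnW mk) // normr_nat ler1n subn_gt0.
Qed.

(* Sard's theorem in dimension one, by counting: values of b at two critical
   points of the same cell of length l differ by at most l * l * L. *)
Lemma regular_zeros_dense b g (r s d : R) : 0 < r -> r < s -> 0 < d ->
  smooth_on (ball (0 : R^o) s) b -> smooth_on (ball (0 : R^o) s) g ->
  (forall t : R, `|t| <= r -> g t = 1 /\ 'D_1 g t = 0) ->
  exists2 e : R, `|e| < d & regular_zeros (fun t => b t + e * g t) r.
Proof.
move=> r0 rs d0 sb sg g1.
have [L L0 bL] := smooth_bounded r0 rs (smooth_derive (1 : R) (smooth_derive (1 : R) sb)).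
(* With l = 2 r / n, the variation l * l * L of the critical values in a cell must stay below the
   spacing d / (n + 3) of the candidates. As n + 3 <= 4 n, this follows from 16 L r^2 < n d. *)
pose n := (Num.truncn (16 * L * r ^+ 2 / d)).+1.
have dn : 16 * L * r ^+ 2 < n%:R * d by rewrite -ltr_pdivrMr // truncnS_gt.
have n0 : (0 : R) < n%:R by [].
pose l := 2 * r / n%:R.
have l0 : 0 < l by rewrite divr_gt0 // mulr_gt0.
have nl : 2 * r < n.+1%:R * l.
  by rewrite /l mulrCA ltr_pMr ?mulr_gt0 // ltr_pdivlMr // mul1r ltr_nat.
(* There are n + 3 candidates against n + 2 obstructions: the value - b 0, labelled [ord_max], and
   one critical value for each of n + 1 cells. Since n * l = 2 * r, the endpoint t = r needs a cell
   of its own. *)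
pose x (k : 'I_n.+3) : R := k%:R * (d / n.+3%:R).
have xd k : `|x k| < d.
  rewrite /x ger0_norm ?mulr_ge0 ?divr_ge0 ?(ltW d0) //.
  by rewrite mulrA ltr_pdivrMr // mulrC ltr_pM2l // ltr_nat.
apply: contrapT => bad.
have crit k : x k = - b 0 \/ exists t : R, [/\ `|t| <= r, b t = - x k & 'D_1 b t = 0].
  apply: contrapT => /not_orP[k0 kc]; apply: bad; exists (x k); [exact: xd|split].
    have z0 : `|0 : R| <= r by rewrite normr0 ltW.
    have [-> _] := g1 0 z0.
    by apply/eqP => E; apply: k0; lra.
  move=> t tr; have [gt dgt] := g1 t tr.
  rewrite gt (derive_perturb _ rs) // dgt => bt; apply/eqP => dbt.
  by apply: kc; exists t; split => //; lra.
pose good k (i : 'I_n.+2) := (x k = - b 0 /\ i = ord_max) \/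
  (exists t : R, [/\ `|t| <= r, b t = - x k, 'D_1 b t = 0 & i = cell r l t :> nat]
     /\ (i < n.+1)%N).
have gx k : exists i, good k i.
  have [k0|[t [tr bt dbt]]] := crit k; first by exists ord_max; left.
  have cl := cell_lt l0 tr nl.
  by exists (Ordinal (ltn_trans cl (ltnSn _))); right; exists t; split.
have [f fP] := boolp.choice gx.
have finj : injective f.
  move=> k k' ff; apply/eqP; apply: contrapT => /negP kk.
  have xx : d / n.+3%:R <= `|x k - x k'|.
    have dn3 : 0 < d / n.+3%:R by rewrite divr_gt0.
    rewrite /x -mulrBl normrM (gtr0_norm dn3) ler_peMl ?(ltW dn3) //.
    exact: natr_dist.
  have := fP k; have := fP k'; rewrite -ff /good => -[[k'0 fk']|[t' [[t'r bt' dbt' ft'] lt']]].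
    move=> [[k0 _]|[t [_]]]; last by rewrite fk' ltnn.
    by move: xx; rewrite k0 k'0 subrr normr0 leNgt divr_gt0.
  move=> [[_ fk]|[t [[tr bt dbt ft] _]]]; first by rewrite fk ltnn in lt'.
  have tt : `|t - t'| <= l by exact: (cell_close l0 tr t'r (etrans (esym ft) ft')).
  have [c [cr cu Ec]] := segment_mvt rs sb tr t'r.
  have [c1 [c1r _ Ec1]] := segment_mvt rs (smooth_derive (1 : R) sb) cr t'r.
  have : `|x k - x k'| <= l * (l * L).
    have -> : x k - x k' = - (b t - b t') by rewrite bt bt'; ring.
    rewrite normrN Ec normrM -['D_1 b c]subr0 -dbt' Ec1 normrM.
    by rewrite ler_pM // ?mulr_ge0 // ler_pM // ?bL // (le_trans cu).
  move=> /(le_trans xx); rewrite leNgt => /negP; apply.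
  rewrite ltr_pdivlMr // /l; have -> : 2 * r / n%:R * (2 * r / n%:R * L) * n.+3%:R =
     (16 * L * r ^+ 2) * (n.+3%:R / (4 * n%:R * n%:R)).
    by field; rewrite ?gt_eqF.
  have le : n.+3%:R <= 4 * n%:R :> R 
    by rewrite -natrM ler_nat /n mulnS (leq_add2l 4) leq_pmull.
  apply: (@le_lt_trans _ _ (16 * L * r ^+ 2 / n%:R)); last by rewrite ltr_pdivrMr // [d * _]mulrC.
  rewrite ler_wpM2l ?mulr_ge0 ?exprn_ge0 ?(ltW L0) ?(ltW r0) //.
  rewrite ler_pdivrMr ?mulr_gt0 //.
  have -> // : n%:R^-1 * (4 * n%:R * n%:R) = 4 * n%:R :> R by field; rewrite gt_eqF.
have := leq_card f finj; by rewrite !card_ord ltnn.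
Qed.

End OneVariable.

(** * Charts and exact perturbations *)

Section Charts.
Context {R : realType} {M : oriented_3manifold R}.
Implicit Types (c : chart R M) (p q : M).

Lemma nbhs_open (T : topologicalType) (A : set T) :
  (forall x, A x -> \forall y \near x, A y) -> open A.
Proof. by rewrite openE. Qed.

Lemma open_near (T : topologicalType) (A : set T) x :
  open A -> A x -> \forall y \near x, A y.
Proof. by move=> oA Ax; apply: open_nbhs_nbhs. Qed.

Lemma chart_invK c p : chart_axiom c -> dom c p -> chart_inv c (c p) = p.
Proof. by case=> _ _ + _ _; exact. Qed.

Lemma chart_image_open c (U : set M) : chart_axiom c -> open U ->
  U `<=` dom c -> open (c @` U).
Proof.
move=> [od oi cK cc ci] oU Ud; apply: nbhs_open => _ [p Up <-].
have ip : (c @` dom c) (c p) by exists p => //; exact: Ud.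
have n1 := open_near oi ip.
have := ci _ ip; rewrite /prop_for /continuous_at cK; last exact: Ud.
move=> /(_ U (open_near oU Up)) n2.
apply: filterS (filterI n1 n2) => _ [[q dq <-]] /=; rewrite cK // => Uq.
by exists q.
Qed.

Lemma chart_preimage_open c (W : set 'rV[R]_3) : chart_axiom c -> open W ->
  open (dom c `&` c @^-1` W).
Proof.
move=> [od oi cK cc ci] oW; apply: nbhs_open => p [dp Wp].
have n1 := open_near od dp.
have n2 := cc _ dp _ (open_near oW Wp).
exact: filterS (filterI n1 n2).
Qed.

Lemma overlap_open c c' : chart_axiom c -> chart_axiom c' -> open (overlap c c').
Proof.
move=> ac ac'; apply: (chart_image_open ac); last by move=> p [].
by apply: openI; [case: ac|case: ac'].
Qed.

Lemma overlap_point c c' p : dom c p -> dom c' p -> overlap c c' (c p).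
Proof. by move=> dp dp'; exists p. Qed.

Lemma transition_point c c' p : chart_axiom c -> dom c p ->
  transition c c' (c p) = c' p.
Proof. by move=> ac dp; rewrite /transition chart_invK. Qed.

(** By definition [c] and [c'] are compatible only with the charts of [atlas], so near each point
    the transition is factored through one of these. *)
Lemma smooth_transition c c' i : oriented_chart c -> oriented_chart c' ->
  smooth_on (overlap c c') (fun x => transition c c' x 0 i).
Proof.
move=> [ac cc] [ac' cc']; apply: smooth_local => _ [p [dp dp'] <-].
have [a aa da] := atlas_cover p; have xa := atlas_chart aa.
have [[sca _] _] := cc a aa; have [_ [sac' _]] := cc' a aa.
pose U := c @` (dom c `&` (dom a `&` dom c')).
have oU : open U.
  apply: (chart_image_open ac); last by move=> q [].
  by apply: openI; [case: ac|apply: openI; [case: xa|case: ac']].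
exists U; first by exists p.
apply: (@smooth_eq _ _ U (fun x => transition a c' (transition c a x) 0 i)) => //.
  move=> _ [q [dq [daq dq']] <-].
  by rewrite !(transition_point _ ac) // (transition_point _ xa).
apply: (smooth_comp oU (overlap_open xa ac') (sac' i)).
  by move=> _ [q [dq [daq dq']] <-]; rewrite (transition_point _ ac) //; exists q.
move=> j; apply: smooth_subset (sca j) => _ [q [dq [daq _]] <-].
by exists q.
Qed.

Lemma transition_derivable c c' x v : oriented_chart c -> oriented_chart c' ->
  overlap c c' x -> derivable (transition c c') x v.
Proof.
move=> oc oc' ox; apply: derivable_row => j.
exact: smooth_derivable (smooth_transition j oc oc') ox.
Qed.

Lemma derive_transitionK c c' p v : oriented_chart c -> oriented_chart c' ->
  dom c p -> dom c' p ->
  'D_('D_v (transition c c') (c p)) (transition c' c) (c' p) = v.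
Proof.
move=> oc oc' dp dp'; have [ac _] := oc; have [ac' _] := oc'.
have ox := overlap_point dp dp'; have ox' := overlap_point dp' dp.
apply/rowP => i; rewrite derive_row; last exact: transition_derivable.
have dF := smooth_differentiable_row (overlap_open ac' ac)
  (smooth_transition i oc' oc) ox'.
have dt : derivable (transition c c') (c p) v by exact: transition_derivable.
rewrite -(transition_point c' ac dp) in dF *.
have [_ <-] := is_derive_comp dt dF.
have -> : v 0 i = 'D_v (fun x : 'rV[R]_3 => x 0 i : R) (c p).
  by have [_ ->] := is_derive_coordinate i (c p) v.
apply: near_eq_derive; apply: filterS (open_near (overlap_open ac ac') ox).
by move=> _ [q [dq dq'] <-] /=; rewrite (transition_point _ ac) // (transition_point _ ac').
Qed.

Lemma derive_transition_neq0 c c' p v : oriented_chart c -> oriented_chart c' ->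
  dom c p -> dom c' p -> v != 0 -> 'D_v (transition c c') (c p) != 0.
Proof.
move=> oc oc' dp dp'; apply: contraNneq => D0.
by rewrite -(derive_transitionK v oc oc' dp dp') D0 derive0.
Qed.

Lemma transition_coord_differentiable c c' x i : oriented_chart c ->
  oriented_chart c' -> overlap c c' x ->
  differentiable (fun y => transition c c' y 0 i : R) x.
Proof.
move=> oc oc' ox; have [ac _] := oc; have [ac' _] := oc'.
exact: smooth_differentiable_row (overlap_open ac ac') (smooth_transition i oc oc') ox.
Qed.

Lemma derive_transition_coord c c' x v i : oriented_chart c ->
  oriented_chart c' -> overlap c c' x ->
  ('D_v (transition c c') x) 0 i = 'D_v (fun y => transition c c' y 0 i : R) x.
Proof. by move=> oc oc' ox; apply: derive_row; exact: transition_derivable. Qed.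

Lemma derive_transitionD c c' x u v : oriented_chart c -> oriented_chart c' ->
  overlap c c' x ->
  'D_(u + v) (transition c c') x =
    'D_u (transition c c') x + 'D_v (transition c c') x.
Proof.
move=> oc oc' ox; apply/rowP => i; rewrite [RHS]mxE.
have dF := transition_coord_differentiable i oc oc' ox.
apply: etrans (derive_transition_coord _ _ oc oc' ox) _.
apply: etrans (deriveDv u v dF) _.
by congr (_ + _); apply: esym; exact: derive_transition_coord.
Qed.

Lemma derive_transitionZ c c' x (a : R) v : oriented_chart c -> oriented_chart c' ->
  overlap c c' x ->
  'D_(a *: v) (transition c c') x = a *: 'D_v (transition c c') x.
Proof.
move=> oc oc' ox; apply/rowP => i; rewrite [RHS]mxE.
have dF := transition_coord_differentiable i oc oc' ox.
apply: etrans (derive_transition_coord _ _ oc oc' ox) _.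
apply: etrans (deriveZv v a dF) _.
by congr (_ * _); apply: esym; exact: derive_transition_coord.
Qed.

Lemma is_derive_transition_curve c c' (g : R^o -> 'rV[R]_3) (t : R^o) (w : 'rV[R]_3) :
  oriented_chart c -> oriented_chart c' -> overlap c c' (g t) ->
  is_derive t (1 : R^o) g w ->
  is_derive t (1 : R^o) (transition c c' \o g) ('D_w (transition c c') (g t)).
Proof.
move=> oc oc' ox [dg1 dgv].
have dc i : is_derive t (1 : R^o) (fun t => (transition c c' \o g) t 0 i : R)
    ('D_w (fun y => transition c c' y 0 i : R) (g t)).
  have dF := transition_coord_differentiable i oc oc' ox.
  by have := is_derive_comp dg1 dF; rewrite dgv.
have dd : derivable (transition c c' \o g) t (1 : R^o).
  by apply: derivable_row => i; have [] := dc i.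
apply: DeriveDef; first exact: dd.
apply/rowP => i; apply: etrans (derive_row i dd) _.
by have [_ ->] := dc i; apply: esym; exact: derive_transition_coord.
Qed.

Definition smooth_fun (h : M -> R) : Prop := forall c, oriented_chart c ->
  smooth_on (c @` dom c) (fun x => h (chart_inv c x) : R^o).

Definition diff_form (h : M -> R) : form_on M :=
  fun c p v => 'D_v (fun x => h (chart_inv c x) : R^o) (c p).

Definition add_diff (beta : form_on M) (h : M -> R) : form_on M :=
  fun c p v => beta c p v + diff_form h c p v.

Lemma diff_form_transition h c c' p v : smooth_fun h -> oriented_chart c ->
  oriented_chart c' -> dom c p -> dom c' p ->
  diff_form h c' p ('D_v (transition c c') (c p)) = diff_form h c p v.
Proof.
move=> sh oc oc' dp dp'; have [ac _] := oc; have [ac' _] := oc'.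
have ox := overlap_point dp dp'; rewrite /diff_form.
have ip' : (c' @` dom c') (c' p) by exists p.
have [_ oi' _ _ _] := ac'.
have dF := smooth_differentiable_row oi' (sh c' oc') ip'.
have dt : derivable (transition c c') (c p) v by exact: transition_derivable.
rewrite -(transition_point c' ac dp) in dF *.
have [_ <-] := is_derive_comp dt dF.
apply: near_eq_derive; apply: filterS (open_near (overlap_open ac ac') ox).
by move=> _ [q [dq dq'] <-] /=; rewrite (transition_point _ ac) // !chart_invK.
Qed.

Lemma add_diff_restricts (P : set M) a c W beta h : smooth_fun h ->
  oriented_chart c -> restricts_to P a c W beta ->
  restricts_to P (fun x => a x + gradient (fun y => h (chart_inv c y) : R^o) x)
    c W (add_diff beta h).
Proof.
move=> sh oc [oW Wc sa ab]; have sg := smooth_subset Wc (sh c oc).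
split; [exact: oW|exact: Wc| |].
  move=> i; apply: (smooth_eq oW _ (smooth_add oW (sa i) (smooth_gradient i sg))).
  by move=> x _; rewrite [RHS]mxE.
move=> q v dq Pq Wq tv; rewrite /add_diff ab // /diff_form derive_coord; last first.
  exact: smooth_differentiable_row oW sg Wq.
rewrite -big_split /=; apply: eq_bigr => i _.
by rewrite !mxE mulrDl [v 0 i * _]mulrC.
Qed.

Lemma add_diff_one_form (P : set M) beta h : smooth_fun h ->
  one_form P beta -> one_form P (add_diff beta h).
Proof.
move=> sh [bt bl]; split.
  move=> c c' oc oc' p v Pp dp dp' tv.
  by rewrite /add_diff bt // diff_form_transition.
move=> c oc p Pp dp; have [a [W [Wp rW]]] := bl c oc p Pp dp.
by eexists; exists W; split=> //; exact: add_diff_restricts rW.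
Qed.

Lemma add_diff_d_positive (P : branched_simple_polyhedron M) beta h :
  smooth_fun h -> d_positive P beta -> d_positive P (add_diff beta h).
Proof.
move=> sh bp c oc p Pp dp; have [a [W [Wp rW ap]]] := bp c oc p Pp dp.
eexists; exists W; split=> //; first exact: add_diff_restricts rW.
move=> u v /ap; have [oW Wc sa _] := rW.
have sg := smooth_subset Wc (sh c oc).
set g := gradient _.
suff -> : dform (fun x => a x + g x) (c p) u v = dform a (c p) u v + dform g (c p) u v.
  by rewrite (dform_gradient _ _ oW sg) // addr0.
have D w i : 'D_w (fun y => (a y + g y) 0 i : R^o) (c p) =
    'D_w (fun y => a y 0 i : R^o) (c p) + 'D_w (fun y => g y 0 i : R^o) (c p).
  rewrite (_ : (fun _ => _) = (fun y => a y 0 i : R^o) + (fun y => g y 0 i : R^o)).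
    have d1 : derivable (fun y => a y 0 i : R^o) (c p) w.
      exact: smooth_derivable (sa i) Wp.
    have d2 : derivable (fun y => g y 0 i : R^o) (c p) w.
      exact: smooth_derivable (smooth_gradient i sg) Wp.
    by have [_] := is_deriveD (derivableP d1) (derivableP d2).
  by apply/funext => y; rewrite mxE.
have ringE (x1 x2 y z1 z2 w : R) :
    (x1 + x2) * y - (z1 + z2) * w = (x1 * y - z1 * w) + (x2 * y - z2 * w) by ring.
rewrite /dform -big_split /=; apply: eq_bigr => i _.
rewrite [X in X * _ - _](D u i).
rewrite [X in _ - X * _](D v i).
exact: ringE.
Qed.

End Charts.

(** * Extension by zero and a description of S(P) without flow boxes *)

Section Singular.
Context {R : realType} {M : oriented_3manifold R}.
Implicit Types (c : chart R M) (p q : M) (P : set M).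

Lemma compact_norm_ball (r : R) : 0 < r -> compact [set x : 'rV[R]_3 | `|x| <= r].
Proof.
move=> r0.
have -> : [set x : 'rV[R]_3 | `|x| <= r] = closed_ball (0 : 'rV[R]_3) r.
  rewrite closed_ballE //; apply/seteqP; split=> x /=;
  by rewrite /closed_ball_ /= sub0r normrN.
apply: bounded_closed_compact; last exact: closed_ball_closed.
exists r; split; first exact: num_real.
move=> m rm x; rewrite closed_ballE // /closed_ball_ /= sub0r normrN => xr.
exact: le_trans xr (ltW rm).
Qed.

Definition chart_box c (r : R) : set M := dom c `&` [set q | `|c q| <= r].

(** The box is closed in [M], and not merely in the domain of [c], as a compact subset of a
    Hausdorff space. This is what makes extension by zero smooth at points outside the chart. *)
Lemma chart_box_closed c (r : R) : chart_axiom c -> 0 < r ->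
  (forall x : 'rV[R]_3, `|x| <= r -> (c @` dom c) x) -> closed (chart_box c r).
Proof.
move=> ac r0 Br; apply: compact_closed; first exact: manifold_hausdorff.
have [_ _ _ _ ci] := ac.
have -> : chart_box c r = chart_inv c @` [set x : 'rV[R]_3 | `|x| <= r].
  apply/seteqP; split=> [q [dq qr]|_ [x /= xr <-]].
    by exists (c q) => //; exact: chart_invK.
  by have [q dq qx] := Br x xr; rewrite -qx chart_invK //; split=> //=; rewrite qx.
apply: continuous_compact; last exact: compact_norm_ball.
by apply: continuous_in_subspaceT => x; rewrite inE => xr; apply: ci; exact: Br.
Qed.

Lemma extend_smooth c (phi : 'rV[R]_3 -> R^o) (r : R) : oriented_chart c ->
  0 < r -> (forall x : 'rV[R]_3, `|x| <= r -> (c @` dom c) x) ->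
  smooth_on setT phi -> (forall x : 'rV[R]_3, r < `|x| -> phi x = 0) ->
  exists h : M -> R, [/\ smooth_fun h,
    forall q, dom c q -> h q = phi (c q)
    & forall q, ~ chart_box c r q -> h q = 0].
Proof.
move=> oc r0 Br sphi phi0; have [ac _] := oc.
pose h q : R := if `[< dom c q >] then phi (c q) else 0.
have h1 q : dom c q -> h q = phi (c q) by move=> dq; rewrite /h asboolT.
have h0 q : ~ chart_box c r q -> h q = 0.
  move=> nb; rewrite /h; case: asboolP => // dq; apply: phi0.
  by rewrite ltNge; apply/negP => qr; apply: nb.
exists h; split => // c' oc'; have [ac' _] := oc'.
have cB := chart_box_closed ac r0 Br.
apply: smooth_local => _ [q dq' <-].
have [dq|ndq] := pselect (dom c q).
  exists (overlap c' c); first exact: overlap_point.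
  apply: (smooth_eq (overlap_open ac' ac) (f := fun x => phi (transition c' c x))).
    move=> _ [q1 [dq1' dq1] <-].
    by rewrite (transition_point _ ac') // (chart_invK ac') // h1.
  apply: (smooth_comp (overlap_open ac' ac) openT sphi) => // j.
  exact: smooth_transition.
have oU : open (dom c' `&` ~` chart_box c r).
  by apply: openI; [case: ac'|rewrite openC].
exists (c' @` (dom c' `&` ~` chart_box c r)).
  by exists q => //; split=> // -[].
apply: (@smooth_eq _ _ _ (cst 0)); last exact: smooth_cst.
  by apply: (chart_image_open ac') => // q1 [].
by move=> _ [q1 [dq1 nb] <-]; rewrite (chart_invK ac') // h0.
Qed.

Lemma diff_form_local h (g : M -> R) (U : set M) c p v : oriented_chart c ->
  open U -> U p -> dom c p -> (forall q, U q -> h q = g q) ->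
  diff_form h c p v = diff_form g c p v.
Proof.
move=> [ac _] oU Up dp hg; apply: near_eq_derive.
have o : open (c @` (U `&` dom c)).
  by apply: (chart_image_open ac) => [|q []//]; apply: openI => //; case: ac.
apply: filterS (open_near o _); last by exists p.
by move=> _ [q [Uq dq] <-]; rewrite (chart_invK ac) // hg.
Qed.

Lemma diff_form0 h (U : set M) c p v : oriented_chart c ->
  open U -> U p -> dom c p -> (forall q, U q -> h q = 0) ->
  diff_form h c p v = 0.
Proof.
move=> oc oU Up dp h0; rewrite (@diff_form_local h (cst 0) U) //.
exact: derive_cst.
Qed.

(** Near [p] the set [P] lies in a smooth surface F = 0. Tangent planes could not serve here, since
    [P] has one at singular points too. *)
Definition regular_at P c p : Prop :=
  exists (W : set 'rV[R]_3) (F : 'rV[R]_3 -> R^o),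
  [/\ open W, W (c p), smooth_on W F,
      forall q, dom c q -> P q -> W (c q) -> F (c q) = 0
    & exists v, 'D_v F (c p) != 0].

Lemma regular_at_transition P c c' p : oriented_chart c -> oriented_chart c' ->
  dom c p -> dom c' p -> regular_at P c p -> regular_at P c' p.
Proof.
move=> oc oc' dp dp' [W [F [oW Wp sF F0 [v Fv]]]].
have [ac _] := oc; have [ac' _] := oc'.
pose U := c' @` ((dom c `&` c @^-1` W) `&` dom c').
have oU : open U.
  apply: (chart_image_open ac') => [|q []//].
  by apply: openI; [exact: chart_preimage_open|case: ac'].
have Up : U (c' p) by exists p.
have UW x : U x -> W (transition c' c x).
  by move=> [q [[dq Wq] dq'] <-]; rewrite (transition_point _ ac').
exists U, (fun x => F (transition c' c x)); split => //.
- apply: (smooth_comp oU oW sF UW) => j.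
  apply: smooth_subset (smooth_transition j oc' oc) => _ [q [[dq _] dq'] <-].
  by exists q.
- move=> q dq' Pq [q1 [[dq1 Wq1] dq1']].
  move=> /(congr1 (chart_inv c')); rewrite !(chart_invK ac') // => E.
  by rewrite -E (transition_point _ ac') // F0 // E.
exists ('D_v (transition c c') (c p)).
have ox' := overlap_point dp' dp.
have dt : derivable (transition c' c) (c' p) ('D_v (transition c c') (c p)).
  exact: transition_derivable.
have dF : differentiable F (transition c' c (c' p)).
  by rewrite (transition_point _ ac') //; exact: smooth_differentiable_row oW sF Wp.
have [_ E] := is_derive_comp dt dF.
by move: E; rewrite derive_transitionK // (transition_point _ ac') // => ->.
Qed.

(* Since this does not refer to a flow box, it is invariant under changes of
   charts; it agrees with singular_set P. *)
Definition singular P : set M := [set p | P p /\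
  forall c, oriented_chart c -> dom c p -> ~ regular_at P c p].

Lemma singular_chart P c p : oriented_chart c -> dom c p -> P p ->
  ~ regular_at P c p -> singular P p.
Proof.
move=> oc dp Pp nr; split=> // c' oc' dp' r'; apply: nr.
exact: regular_at_transition r'.
Qed.

(* At a vertex these are the vectors of the two branches of S(P). *)
Definition sing_velocity P c p (v : 'rV[R]_3) : Prop :=
  exists gamma : R^o -> 'rV[R]_3, [/\ gamma 0 = c p,
    \forall t \near (0 : R^o), (c @` (dom c `&` singular P)) (gamma t)
    & is_derive (0 : R^o) (1 : R^o) gamma v].

Lemma sing_velocity_tangent P c p v : sing_velocity P c p v -> tangent P c p v.
Proof.
move=> [gamma [g0 gS dg]]; exists gamma; split=> //.
by apply: filterS gS => t [q [dq [Pq _]] <-]; exists q.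
Qed.

Lemma curve_continuous (gamma : R^o -> 'rV[R]_3) (v : 'rV[R]_3) :
  is_derive (0 : R^o) (1 : R^o) gamma v -> {for (0 : R^o), continuous gamma}.
Proof.
move=> [dg _]; apply: differentiable_continuous.
exact/derivable1_diffP.
Qed.

Lemma sing_velocity_transition P c c' p v : oriented_chart c ->
  oriented_chart c' -> dom c p -> dom c' p -> sing_velocity P c p v ->
  sing_velocity P c' p ('D_v (transition c c') (c p)).
Proof.
move=> oc oc' dp dp' [gamma [g0 gS dg]].
have [ac _] := oc; have [ac' _] := oc'.
have ox := overlap_point dp dp'.
exists (transition c c' \o gamma); split.
- by rewrite /= g0 transition_point.
- have cg := curve_continuous dg.
  have n1 : \forall t \near (0 : R^o), overlap c c' (gamma t).
    by apply: cg; rewrite g0; exact: open_near (overlap_open ac ac') ox.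
  apply: filterS (filterI gS n1) => t [[q [dq Sq] gq] [q1 [dq1 dq1']]].
  rewrite -gq; move=> /(congr1 (chart_inv c)); rewrite !(chart_invK ac) // => E.
  exists q; first by split=> //; rewrite -E.
  by rewrite /= -gq transition_point.
have ox0 : overlap c c' (gamma 0) by rewrite g0.
by have := is_derive_transition_curve oc oc' ox0 dg; rewrite g0.
Qed.

Definition transverse_at P (beta : form_on M) p : Prop :=
  forall c v, oriented_chart c -> dom c p -> sing_velocity P c p v -> v != 0 ->
    beta c p v != 0.

Lemma transverse_chart P beta c p : one_form P beta -> P p -> oriented_chart c ->
  dom c p -> (forall v, sing_velocity P c p v -> v != 0 -> beta c p v != 0) ->
  transverse_at P beta p.
Proof.
move=> [bt _] Pp oc dp tr c' v oc' dp' Sv v0.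
have Sv' := sing_velocity_transition oc' oc dp' dp Sv.
have tv := sing_velocity_tangent Sv.
rewrite -(bt c' c oc' oc p v Pp dp' dp tv).
by apply: tr => //; exact: derive_transition_neq0.
Qed.

Lemma transverse_local P beta beta' p :
  (forall c v, oriented_chart c -> dom c p -> beta c p v = beta' c p v) ->
  transverse_at P beta p -> transverse_at P beta' p.
Proof. by move=> E tr c v oc dp Sv v0; rewrite -E //; exact: tr. Qed.

End Singular.

(** * The singular set in flow boxes *)

Section Models.
Context {R : realType}.

Definition e_z : 'rV[R]_3 := delta_mx 0 2.
Definition plane_axis (i : 'I_2) : 'I_3 := widen_ord (leqnSn 2) i.

Lemma xyE (v : 'rV[R]_3) (i : 'I_2) : xy v 0 i = v 0 (plane_axis i).
Proof.
rewrite mxE; case: eqP => [->|/eqP i0]; congr (v 0 _); apply: val_inj => //=.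
by case: i i0 => -[|[]].
Qed.

Lemma row3_eq (u v : 'rV[R]_3) :
  u 0 0 = v 0 0 -> u 0 1 = v 0 1 -> u 0 2 = v 0 2 -> u = v.
Proof.
move=> uv0 uv1 uv2; apply/rowP => -[[|[|[|//]]] hj].
- by rewrite (_ : Ordinal hj = 0) //; exact: val_inj.
- by rewrite (_ : Ordinal hj = 1) //; exact: val_inj.
- by rewrite (_ : Ordinal hj = 2) //; exact: val_inj.
Qed.

Lemma smooth_height : smooth_on setT (fun x : 'rV[R]_3 => x 0 2 : R^o).
Proof. exact: smooth_coord. Qed.

Lemma smooth_xy (f : 'rV[R]_2 -> R^o) : smooth_on setT f ->
  smooth_on setT (fun x : 'rV[R]_3 => f (xy x) : R^o).
Proof.
move=> sf; apply: (smooth_comp openT openT sf) => // j.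
apply: (@smooth_eq _ _ _ (fun x : 'rV[R]_3 => x 0 (plane_axis j))) openT _ _.
  by move=> x _; rewrite xyE.
exact: smooth_coord.
Qed.

Lemma open_positive (E : normedModType R) (f : E -> R^o) : smooth_on setT f ->
  open [set x | 0 < f x].
Proof.
move=> sf; apply: nbhs_open => x fx.
have cf := smooth_continuous sf (I : setT x).
exact: (cvgr_gt (f x) cf 0 fx).
Qed.

Lemma smooth_sub (E : normedModType R) (f g : E -> R^o) : smooth_on setT f -> smooth_on setT g ->
  smooth_on setT (fun x : E => f x - g x : R^o).
Proof.
move=> sf sg; have s1 := smooth_mul openT (smooth_cst (-1 : R)) sg.
apply: (smooth_eq openT _ (smooth_add openT sf s1)) => x _.
by rewrite /= mulN1r.
Qed.

Lemma derive_graph (f : 'rV[R]_2 -> R^o) (x : 'rV[R]_3) :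
  'D_e_z (fun y : 'rV[R]_3 => y 0 2 - f (xy y) : R^o) x = 1.
Proof.
pose G := (fun y : 'rV[R]_3 => y 0 2 - f (xy y) : R^o).
suff : is_derive x e_z G (1 : R^o) by case.
apply: line_is_derive.
have -> : (fun s : R => G (x + s *: e_z)) = (fun s : R => G x + s : R^o).
  apply/funext => s; rewrite /G /e_z.
  have -> : xy (x + s *: delta_mx 0 2) = xy x.
    by apply/rowP => i; rewrite !xyE !mxE /=; case: i => -[|[]] // hi; rewrite mulr0 addr0.
  by rewrite !mxE /= mulr1 addrAC.
have [h1 h2] := is_deriveD (is_derive_cst (G x) (0 : R) (1 : R)) (is_derive_id (0 : R) (1 : R)).
by apply: DeriveDef; [exact: h1|rewrite -[RHS]add0r; exact: h2].
Qed.

Lemma xy_vertical (x : 'rV[R]_3) (t : R) : xy (x + t *: e_z) = xy x.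
Proof.
apply/rowP => j; rewrite !xyE [LHS]mxE [X in _ + X]mxE [e_z _ _]mxE /=.
by case: j => -[|[]] // hj; rewrite mulr0 addr0.
Qed.

(** On the negative side of the attaching line the wing has already left z = 0, so a small
    neighbourhood of [x] misses it; on the positive side it coincides with z = 0. *)
Lemma wing_near_plane i (e : R) f (x : 'rV[R]_3) : wing i e f ->
  x 0 2 = 0 -> x 0 (plane_axis i) != 0 ->
  exists W : set 'rV[R]_3, [/\ open W, W x &
    forall y, W y -> y 0 2 = f (xy y) -> y 0 2 = 0].
Proof.
move=> [sf f0 f1] x2; rewrite -xyE neq_lt => /orP[xi|xi].
  exists [set y : 'rV[R]_3 | 0 < e * (f (xy y) - y 0 2)]; split.
  - apply: open_positive; apply: (smooth_mul openT (smooth_cst e)).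
    exact: smooth_sub (smooth_xy sf) smooth_height.
  - by rewrite /= x2 subr0; exact: f1.
  - by move=> y /= + yf; rewrite -yf subrr mulr0 ltxx.
exists [set y : 'rV[R]_3 | 0 < y 0 (plane_axis i)]; split.
- by apply: open_positive; exact: smooth_coord.
- by rewrite /= -xyE.
- by move=> y /=; rewrite -xyE => yi ->; rewrite f0 // ltW.
Qed.

(* Rolle's theorem on the short vertical segments between z = 0 and z = f. *)
Lemma wing_rolle i (e : R) f (W : set 'rV[R]_3) (F : 'rV[R]_3 -> R^o) (x : 'rV[R]_3) :
  wing i e f -> open W -> W x -> smooth_on W F -> x 0 2 = 0 ->
  x 0 (plane_axis i) = 0 ->
  (forall m t : R, 0 < m -> W (x - m *: delta_mx 0 (plane_axis i) + t *: e_z) ->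
     t = 0 \/ t = f (xy (x - m *: delta_mx 0 (plane_axis i))) ->
     F (x - m *: delta_mx 0 (plane_axis i) + t *: e_z) = 0) ->
  'D_e_z F x = 0.
Proof.
move=> [sf f0 f1] oW Wx sF x2 xi FK.
apply/eqP/negPn/negP => dne.
have sdF := smooth_derive e_z sF.
have cd := smooth_continuous sdF Wx.
have nd : \forall y \near x, W y /\ 'D_e_z F y != 0.
  apply: filterI; first exact: (open_near oW Wx).
  have d0 : 0 < `|'D_e_z F x| by rewrite normr_gt0.
  have /cvgrPdist_lt/(_ _ d0) := cd.
  by apply: filterS => y yd; apply/eqP => y0; move: yd; rewrite y0 subr0 ltxx.
have /nbhs_ballP[r /= r0 xr] := nd.
have fx : f (xy x) = 0 by rewrite f0 // xyE xi.
have cf := smooth_continuous (smooth_xy sf) (I : setT x).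
have /cvgrPdist_lt/(_ _ r0)/nbhs_ballP[r' /= r'0 xr'] := cf.
(* The segment stands over the point at distance [m] on the negative side, where the wing has
   nonzero height. The bound m < r' keeps this height below [r], so the segment stays in the
   ball. *)
pose m := Num.min r r' / 2.
have m0 : 0 < m by rewrite divr_gt0 // lt_min r0.
have mr : m < r by rewrite /m ltr_pdivrMr // (@le_lt_trans _ _ r) ?ge_min ?lexx // ltr_pMr // ltr1n.
have mr' : m < r' by rewrite /m ltr_pdivrMr // (@le_lt_trans _ _ r') ?ge_min ?lexx ?orbT // ltr_pMr // ltr1n.
pose k := plane_axis i; pose y := x - m *: delta_mx 0 k.
have k2 : (k == 2) = false by rewrite /k; case: (i) => -[|[]].
have yk : y 0 k = - m by rewrite !mxE xi /= eqxx mulr1 add0r.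
have y2 : y 0 2 = 0 by rewrite !mxE x2 /= [_ == k]eq_sym k2 mulr0 subr0.
have yr' : ball x r' y.
  rewrite -ball_normE /= opprB addrC subrK normrZ (gtr0_norm m0).
  rewrite (le_lt_trans _ mr') // ler_piMr ?(ltW m0) //.
  by apply: norm_le_coord => // j; rewrite mxE /=; case: (_ == _); rewrite /= ?normr1 ?normr0.
have := xr' y yr'; rewrite /= fx sub0r normrN => fyr.
set w := f (xy y) in fyr.
have w0 : w != 0.
  apply/eqP => w0; have := f1 (xy y); rewrite -/w w0 mulr0 ltxx xyE yk oppr_lt0.
  by move=> /(_ m0).
have inb (t : R) : 0 <= t <= 1 -> ball x r (y + t *: (w *: e_z)).
  move=> /andP[t0 t1]; rewrite -ball_normE /= /y opprD opprB addrA [x + _]addrC subrK.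
  have E : `|m *: delta_mx 0 k - t *: (w *: e_z)| <= Num.max m `|w|.
    apply: norm_le_coord => [|j]; first by rewrite le_max (ltW m0).
    rewrite !mxE /=; have [->|jk] := eqVneq j k.
      by rewrite k2 !mulr0 subr0 mulr1 (gtr0_norm m0) le_max lexx.
    rewrite mulr0 sub0r normrN !normrM (ger0_norm t0) le_max; apply/orP; right.
    by case: (_ == _); rewrite /= ?normr1 ?normr0 ?mulr1 ?mulr0 // ler_piMl.
  by apply: le_lt_trans E _; rewrite gt_max mr.
have [t t01|t /andP[t0 t1]] := @segment_MVT R _ F y (w *: e_z).
  by apply: smooth_derivable sF _; exact: (xr _ (inb t t01)).1.
have t01 : 0 <= t <= 1 by rewrite !ltW.
have [Wt Dt] := xr _ (inb t t01).
have i0 : 0 <= (0 : R) <= 1 by rewrite lexx ler01.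
have i1 : 0 <= (1 : R) <= 1 by rewrite lexx ler01.
have Fy : F y = 0.
  have := inb 0 i0; have := FK m 0 m0.
  rewrite !scale0r !addr0 => F0 /xr[Wy _].
  by apply: F0; [exact: Wy|left].
have Fy' : F (y + w *: e_z) = 0.
  have := inb 1 i1; rewrite scale1r => /xr[Wy _].
  by apply: FK => //; right.
rewrite Fy Fy' subrr (smooth_deriveZv _ _ sF Wt) => /esym/eqP.
by rewrite mulf_eq0 (negbTE w0) (negbTE Dt).
Qed.

Lemma derive_near0 (E : normedModType R) (F : E -> R^o) (x v : E) :
  derivable F x v -> (\forall t \near (0 : R), F (x + t *: v) = 0) -> 'D_v F x = 0.
Proof.
move=> dF F0; have [_ <-] := is_derive_line0 dF.
rewrite -[RHS](@derive_cst _ R^o R^o 0 (0 : R) (1 : R)).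
exact: near_eq_derive.
Qed.

Lemma line_near (E : normedModType R) (W : set E) (x v : E) : open W -> W x ->
  \forall t \near (0 : R), W (x + t *: v).
Proof.
move=> oW Wx; have c : {for (0 : R), continuous (fun t : R => x + t *: v)}.
  apply: cvgD; first exact: cvg_cst.
  by apply: cvgZr_tmp; exact: cvg_id.
by apply: c; rewrite scale0r addr0; exact: (open_near oW Wx).
Qed.

(** The vertical derivative vanishes by Rolle's theorem between the two sheets, the horizontal ones
    because [F] vanishes on the plane z = 0. Hence the points of an attaching line are singular. *)
Lemma wing_critical i (e : R) f (W : set 'rV[R]_3) (F : 'rV[R]_3 -> R^o) (x v : 'rV[R]_3) :
  wing i e f -> open W -> W x -> smooth_on W F -> x 0 2 = 0 ->
  x 0 (plane_axis i) = 0 ->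
  (forall y, W y -> y 0 2 = 0 \/ y 0 2 = f (xy y) -> F y = 0) ->
  'D_v F x = 0.
Proof.
move=> wf oW Wx sF x2 xi FK.
have dF := smooth_differentiable_row oW sF Wx.
rewrite derive_coord // big1 // => j _.
have [->|j2] := eqVneq j 2.
  rewrite (wing_rolle wf oW Wx sF x2 xi) ?mulr0 // => m t _ Wy tf; apply: FK => //.
  rewrite xy_vertical; have -> : (x - m *: delta_mx 0 (plane_axis i) + t *: e_z) 0 2 = t.
    by rewrite !mxE x2 /= [_ == plane_axis i]eq_sym; case: (i) => -[|[|//]] hi /=; rewrite mulr0 subr0 add0r mulr1.
  exact: tf.
rewrite derive_near0 ?mulr0 //; first exact: smooth_derivable sF Wx.
apply: filterS (line_near (delta_mx 0 j) oW Wx) => t Wt; apply: FK => //.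
by left; rewrite !mxE x2 add0r /= eq_sym (negbTE j2) mulr0.
Qed.

End Models.

Section Boxes.
Context {R : realType} {M : oriented_3manifold R}.
Implicit Types (c : chart R M) (p q : M) (P : set M) (K : set 'rV[R]_3).

Definition box_model K : Prop :=
  [\/ plane_model K, triple_model K | vertex_model K].

(** This is [model_chart] without a centre, so that it can be used at every point of the chart. *)
Definition boxed P K c : Prop :=
  oriented_chart c /\ forall q, dom c q -> (P q <-> K (c q)).

Definition graph_near K (x : 'rV[R]_3) : Prop :=
  exists W f, [/\ open W, W x, smooth_on setT f
    & forall y, W y -> K y -> y 0 2 = f (xy y)].

Lemma graph_near_regular P K c q : boxed P K c -> dom c q ->
  graph_near K (c q) -> regular_at P c q.
Proof.
move=> [_ PK] dq [W [f [oW Wq sf Wf]]].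
exists W, (fun y : 'rV[R]_3 => y 0 2 - f (xy y) : R^o); split => //.
- apply: smooth_subset (smooth_sub smooth_height (smooth_xy sf)).
  by move=> y _.
- by move=> q' dq' Pq' Wq'; rewrite Wf ?subrr //; apply/PK.
- by exists e_z; rewrite derive_graph oner_neq0.
Qed.

Lemma smooth_zero : smooth_on setT (cst 0 : 'rV[R]_2 -> R^o).
Proof. exact: smooth_cst. Qed.

Lemma open_lt_wing (e : R) : open [set y : 'rV[R]_3 | 0 < e * y 0 2].
Proof.
apply: open_positive.
exact: (smooth_mul openT (smooth_cst e) smooth_height).
Qed.

Lemma wing_le i (e : R) f (u : 'rV[R]_2) : wing i e f -> 0 <= e * f u.
Proof.
move=> [_ f0 f1]; have [ui|ui] := leP 0 (u 0 i); first by rewrite f0 ?mulr0.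
exact: ltW (f1 u ui).
Qed.

Lemma wing_neq0 i (e : R) f (u : 'rV[R]_2) : wing i e f -> f u != 0 -> 0 < e * f u.
Proof.
move=> [_ f0 f1]; have [ui|ui] := leP 0 (u 0 i); first by rewrite f0 ?eqxx.
by move=> _; exact: f1.
Qed.

Lemma triple_graph_near K (x : 'rV[R]_3) : triple_model K -> K x ->
  ~ (x 0 2 = 0 /\ x 0 0 = 0) -> graph_near K x.
Proof.
move=> [f wf ->] Kx nx; have [sf f0 f1] := wf.
have [x2|x2] := eqVneq (x 0 2) 0.
  have [|W [oW Wx WK]] := wing_near_plane wf x2.
    rewrite (_ : plane_axis 0 = 0); last exact: val_inj.
    by apply/eqP => x0; apply: nx.
  exists W, (cst 0); split; [exact: oW|exact: Wx|exact: smooth_zero|].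
  by move=> y Wy /= [//|]; exact: WK.
exists [set y : 'rV[R]_3 | 0 < 1 * y 0 2], f; split => //.
- exact: open_lt_wing.
- case: Kx x2 => /= [->|->]; first by rewrite eqxx.
  exact: (wing_neq0 wf).
- by move=> y /= + [y2|//]; rewrite y2 mulr0 ltxx.
Qed.

(** Off the plane z = 0 the sign of [e * x 0 2] decides which wing contains [x], because the wings
    lie on opposite sides of the plane. *)
Lemma vertex_graph_near K (x : 'rV[R]_3) : vertex_model K -> K x ->
  ~ (x 0 2 = 0 /\ (x 0 0 = 0 \/ x 0 1 = 0)) -> graph_near K x.
Proof.
move=> [e [f [g [e0 wf wg ->]]]] Kx nx; have [sf f0 f1] := wf; have [sg g0 g1] := wg.
have [x2|x2] := eqVneq (x 0 2) 0.
  have [|W [oW Wx WK]] := wing_near_plane wf x2.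
    rewrite (_ : plane_axis 0 = 0); last exact: val_inj.
    by apply/eqP => x0; apply: nx; split=> //; left.
  have [|W' [oW' Wx' WK']] := wing_near_plane wg x2.
    rewrite (_ : plane_axis 1 = 1); last exact: val_inj.
    by apply/eqP => x0; apply: nx; split=> //; right.
  exists (W `&` W'), (cst 0); split; [exact: openI|by split|exact: smooth_zero|].
  by move=> y [Wy Wy'] /= [//| |]; [exact: WK|exact: WK'].
have [ex|ex] := ltP 0 (e * x 0 2).
  exists [set y : 'rV[R]_3 | 0 < e * y 0 2], f; split => //.
    exact: open_lt_wing.
  move=> y /= + [y2|//|yg]; first by rewrite y2 mulr0 ltxx.
  by have := wing_le (xy y) wg; rewrite -yg mulNr oppr_ge0 leNgt => /negbTE ->.
exists [set y : 'rV[R]_3 | 0 < (- e) * y 0 2], g; split => //.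
- exact: open_lt_wing.
- by rewrite /= mulNr oppr_gt0 lt_neqAle ex mulf_neq0.
- move=> y /= + [y2|yf|//]; first by rewrite y2 mulr0 ltxx.
  by have := wing_le (xy y) wf; rewrite -yf mulNr oppr_gt0 leNgt => /negbTE ->.
Qed.

Lemma singular_axes P K c q : boxed P K c -> box_model K -> dom c q ->
  singular P q -> c q 0 2 = 0 /\ (c q 0 0 = 0 \/ c q 0 1 = 0).
Proof.
move=> bc mK dq [Pq /(_ c bc.1 dq) nr].
have Kq : K (c q) by apply/bc.2.
apply: contrapT => na; apply/nr/(graph_near_regular bc dq).
case: mK => [pK|tK|vK].
- exists setT, (cst 0); split; [exact: openT|by []|exact: smooth_zero|].
  by move=> y _; rewrite pK.
- by apply: triple_graph_near tK Kq _ => -[x2 x0]; apply: na; split=> //; left.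
- exact: vertex_graph_near vK Kq na.
Qed.

Lemma singular_triple P K c q : boxed P K c -> triple_model K -> dom c q ->
  singular P q -> c q 0 2 = 0 /\ c q 0 0 = 0.
Proof.
move=> bc tK dq [Pq /(_ c bc.1 dq) nr].
have Kq : K (c q) by apply/bc.2.
apply: contrapT => na; apply/nr/(graph_near_regular bc dq).
exact: triple_graph_near tK Kq na.
Qed.

Lemma box_plane K (x : 'rV[R]_3) : box_model K -> x 0 2 = 0 -> K x.
Proof.
by case=> [->|[f _ ->]|[e [f [g [_ _ _ ->]]]]] x2 //; [left|constructor 1].
Qed.

Lemma wing_singular P K c q i (e : R) f : boxed P K c -> wing i e f ->
  (forall y : 'rV[R]_3, y 0 2 = 0 \/ y 0 2 = f (xy y) -> K y) ->
  dom c q -> c q 0 2 = 0 -> c q 0 (plane_axis i) = 0 -> singular P q.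
Proof.
move=> [oc PK] wf fK dq q2 qi; have [ac _] := oc.
apply: (singular_chart oc dq); first by apply/PK => //; apply: fK; left.
move=> [W [F [oW Wq sF F0 [v /eqP]]]]; apply.
have [_ od _ _ _] := ac.
have oU : open (W `&` c @` dom c) by exact: openI.
have Uq : (W `&` c @` dom c) (c q) by split=> //; exists q.
have sU : smooth_on (W `&` c @` dom c) F by apply: smooth_subset sF => y [].
apply: (wing_critical v wf oU Uq sU q2 qi).
by move=> y [Wy [q' dq' q'y]] /fK; rewrite -q'y in Wy * => Ky; apply: F0 => //; apply/PK.
Qed.

Lemma triple_singular P K c q : boxed P K c -> triple_model K -> dom c q ->
  c q 0 2 = 0 -> c q 0 0 = 0 -> singular P q.
Proof.
move=> bc [f wf KE] dq q2 q0; apply: (wing_singular bc wf) => //.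
  by rewrite KE.
by rewrite (_ : plane_axis 0 = 0) //; exact: val_inj.
Qed.

Lemma vertex_singular P K c q : boxed P K c -> vertex_model K -> dom c q ->
  c q 0 2 = 0 -> c q 0 0 = 0 \/ c q 0 1 = 0 -> singular P q.
Proof.
move=> bc [e [f [g [_ wf wg KE]]]] dq q2 [q0|q1].
  apply: (wing_singular bc wf) => //.
    by move=> y; rewrite KE /= => -[y2|yf]; [constructor 1|constructor 2].
  by rewrite (_ : plane_axis 0 = 0) //; exact: val_inj.
apply: (wing_singular bc wg) => //.
  by move=> y; rewrite KE /= => -[y2|yf]; [constructor 1|constructor 3].
by rewrite (_ : plane_axis 1 = 1) //; exact: val_inj.
Qed.

End Boxes.

Section Velocities.
Context {R : realType} {M : oriented_3manifold R}.
Implicit Types (c : chart R M) (p q : M) (P : set M) (K : set 'rV[R]_3).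

Lemma curve_coord (gamma : R^o -> 'rV[R]_3) (v : 'rV[R]_3) j :
  is_derive (0 : R^o) (1 : R^o) gamma v ->
  is_derive (0 : R) (1 : R) (fun t => gamma t 0 j : R) (v 0 j).
Proof.
move=> [dg <-]; have dj : derivable (fun t : R^o => gamma t 0 j : R) 0 1.
  by move: dg => /derivable_mxP /(_ 0 j).
by apply: DeriveDef => //; rewrite derive_row.
Qed.

Lemma velocity_coord0 (gamma : R^o -> 'rV[R]_3) (v : 'rV[R]_3) j :
  is_derive (0 : R^o) (1 : R^o) gamma v ->
  (\forall t \near (0 : R^o), gamma t 0 j = 0) -> v 0 j = 0.
Proof.
move=> /(curve_coord j) [_ <-] g0.
rewrite -[RHS](@derive_cst _ R^o R^o 0 (0 : R) (1 : R)).
exact: near_eq_derive.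
Qed.

Lemma difference_quotient (f : R -> R) d : is_derive (0 : R) (1 : R) f d ->
  f 0 = 0 -> (fun t : R => f t / t) @ (0 : R)^' --> d.
Proof.
move=> [df <-] f0; have := df; rewrite /derivable => /cvg_lim.
have E : (fun h : R => h^-1 *: ((f \o shift 0) (h *: (1 : R)) - f 0)) = (fun t : R => f t / t).
  apply/funext => h /=; rewrite f0 subr0 addr0 [h *: 1]mulr1.
  by rewrite /GRing.scale /= mulrC.
by rewrite /derive -E.
Qed.

(** A curve through a vertex may switch between the two branches infinitely often near t = 0. The
    product of the two difference quotients vanishes all the same, hence so does its limit. *)
Lemma velocity_product0 (gamma : R^o -> 'rV[R]_3) (v : 'rV[R]_3) i j :
  is_derive (0 : R^o) (1 : R^o) gamma v -> gamma 0 0 i = 0 -> gamma 0 0 j = 0 ->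
  (\forall t \near (0 : R^o), gamma t 0 i = 0 \/ gamma t 0 j = 0) ->
  v 0 i = 0 \/ v 0 j = 0.
Proof.
move=> dg gi gj g0.
have li := difference_quotient (curve_coord i dg) gi.
have lj := difference_quotient (curve_coord j dg) gj.
have l1 : (fun t : R => gamma t 0 i / t * (gamma t 0 j / t)) @ (0 : R)^' -->
  v 0 i * v 0 j by exact: cvgM li lj.
have l0 : (fun t : R => gamma t 0 i / t * (gamma t 0 j / t)) @ (0 : R)^' --> (0 : R).
  apply: cvg_near_cst; apply: nbhs_dnbhs.
  by apply: filterS g0 => t [->|->]; rewrite !mul0r ?mulr0.
have E : v 0 i * v 0 j = 0 by exact: (cvg_unique (@norm_hausdorff _ R) l1 l0).
by move/eqP: E; rewrite mulf_eq0 => /orP[] /eqP; [left|right].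
Qed.

End Velocities.

(** * Generic restriction to the singular set *)

Section Bump.
Context {R : realType}.
Variables (rho : R^o -> R^o) (r : R).
Hypotheses (srho : smooth_on setT rho) (r0 : 0 < r)
  (rho1 : forall x : R, `|x| <= 2 -> rho x = 1)
  (rho0 : forall x : R, 3 <= `|x| -> rho x = 0).

(** A product over the coordinates suits the norm of row vectors, which is the maximum of the
    coordinates. *)
Definition bump (x : 'rV[R]_3) : R^o :=
  rho (r^-1 * x 0 0) * rho (r^-1 * x 0 1) * rho (r^-1 * x 0 2).

Lemma smooth_bump : smooth_on setT bump.
Proof.
have s j : smooth_on setT (fun x : 'rV[R]_3 => rho (r^-1 * x 0 j) : R^o).
  have s1 := smooth_mul openT (smooth_cst r^-1) (@smooth_coord R 3 setT j).
  exact: (smooth_comp1 openT openT srho (fun _ _ => I) s1).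
exact: (smooth_mul openT (smooth_mul openT (s 0) (s 1)) (s 2)).
Qed.

Lemma norm_scaled (x : R) : `|r^-1 * x| = `|x| / r.
Proof. by rewrite normrM normfV (gtr0_norm r0) mulrC. Qed.

Lemma bump1 (x : 'rV[R]_3) : `|x| <= 2 * r -> bump x = 1.
Proof.
move=> xr; have b j : rho (r^-1 * x 0 j) = 1.
  by apply: rho1; rewrite norm_scaled ler_pdivrMr // (le_trans (coord_le_norm _ _)).
by rewrite /bump !b !mulr1.
Qed.

Lemma bump0 (x : 'rV[R]_3) : 3 * r < `|x| -> bump x = 0.
Proof.
move=> xr; have [j jr] : exists j, 3 * r < `|x 0 j|.
  apply: contrapT => nj; move: xr; rewrite ltNge => /negP; apply.
  apply: norm_le_coord => [|j]; first by rewrite mulr_ge0 // ltW.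
  by rewrite leNgt; apply/negP => jr; apply: nj; exists j.
have z : rho (r^-1 * x 0 j) = 0.
  by apply: rho0; rewrite norm_scaled ler_pdivlMr // ltW.
rewrite /bump; case: j z {jr} => -[|[|[|//]]] hj.
- by rewrite (_ : Ordinal hj = 0) => [->|]; [rewrite !mul0r|exact: val_inj].
- by rewrite (_ : Ordinal hj = 1) => [->|]; [rewrite mulr0 mul0r|exact: val_inj].
- by rewrite (_ : Ordinal hj = 2) => [->|]; [rewrite mulr0|exact: val_inj].
Qed.

End Bump.

Section Axes.
Context {R : realType} {M : oriented_3manifold R}.
Implicit Types (c : chart R M) (p q : M) (P : set M) (K : set 'rV[R]_3).

Definition axis_vector (k : 'I_2) : 'rV[R]_3 := delta_mx 0 (plane_axis k).

Lemma axis_vectorE k j : axis_vector k 0 j = (j == plane_axis k)%:R.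
Proof. by rewrite mxE. Qed.

Lemma axis_vector_height k : axis_vector k 0 2 = 0.
Proof. by rewrite axis_vectorE; case: k => -[|[]]. Qed.

Lemma axis_vector_neq0 k : axis_vector k != 0.
Proof.
apply/eqP => /rowP /(_ (plane_axis k)); rewrite axis_vectorE eqxx mxE => /eqP.
by rewrite oner_eq0.
Qed.

Lemma norm_axis_vector k (t : R) : `|t *: axis_vector k| <= `|t|.
Proof.
apply: norm_le_coord => // j; rewrite mxE axis_vectorE.
by case: eqP => _; rewrite ?mulr1 // mulr0 normr0.
Qed.

Definition axis_point c k (t : R) : M := chart_inv c (t *: axis_vector k).

(* The restriction of beta to an axis of the chart, as a function: it vanishes
   where the foliation is tangent to the axis. *)
Definition axis_form (beta : form_on M) c k : R^o -> R^o :=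
  fun t => beta c (axis_point c k t) (axis_vector k).

(** The radii are nested: zeros are controlled up to [r], cutoffs are 1 up to 2 * r and 0 beyond 3 *
    r, and the chart reaches 4 * r. *)
Definition visible_box P c (r : R) : Prop :=
  [/\ exists2 K, boxed P K c & box_model K, 0 < r
    & forall x : 'rV[R]_3, `|x| <= 4 * r -> (c @` dom c) x].

Lemma image_point c (x : 'rV[R]_3) : chart_axiom c -> (c @` dom c) x ->
  dom c (chart_inv c x) /\ c (chart_inv c x) = x.
Proof. by move=> ac [q dq <-]; rewrite chart_invK. Qed.

(** All three models contain the whole plane z = 0, so a straight line in it is a curve in [P]. *)
Lemma plane_tangent P K c q (w : 'rV[R]_3) : boxed P K c -> box_model K ->
  dom c q -> c q 0 2 = 0 -> w 0 2 = 0 -> tangent P c q w.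
Proof.
move=> [oc PK] mK dq q2 w2; have [[_ od _ _ _] _] := oc.
have iq : (c @` dom c) (c q) by exists q.
exists (fun t : R^o => c q + t *: w); split.
- by rewrite scale0r addr0.
- apply: filterS (line_near w od iq) => t [q' dq' E].
  exists q' => //; split=> //; apply/PK => //; rewrite E; apply: box_plane mK _.
  by rewrite !mxE q2 w2 mulr0 addr0.
have d : derivable (id : 'rV[R]_3 -> 'rV[R]_3) (c q) w by exact: derivable_id.
by have := is_derive_line0 d; rewrite derive_id.
Qed.

Lemma axis_in_box P c r k (t : R) : visible_box P c r -> `|t| <= 4 * r ->
  [/\ dom c (axis_point c k t), c (axis_point c k t) = t *: axis_vector k,
      P (axis_point c k t) & tangent P c (axis_point c k t) (axis_vector k)].
Proof.
move=> [[K bc mK] r0 rd] tr; have [oc PK] := bc; have [ac _] := oc.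
have [|dq cq] := image_point (x := t *: axis_vector k) ac.
  by apply: rd; exact: le_trans (norm_axis_vector _ _) tr.
have c2 : c (axis_point c k t) 0 2 = 0.
  by rewrite cq mxE axis_vector_height mulr0.
split => //; last by apply: (plane_tangent bc mK) => //; exact: axis_vector_height.
by apply/PK => //; exact: box_plane.
Qed.

Lemma smooth_axis (U : set R^o) k j :
  smooth_on U (fun t : R^o => (t *: axis_vector k) 0 j : R^o).
Proof.
apply: smooth_subset (_ : smooth_on setT _) => //.
have s1 := smooth_mul openT (@smooth_id R setT) (smooth_cst (axis_vector k 0 j)).
by apply: (smooth_eq openT _ s1) => t _; rewrite [RHS]mxE.
Qed.

Lemma axis_open (W : set 'rV[R]_3) k : open W ->
  open [set t : R^o | W (t *: axis_vector k)].
Proof.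
move=> oW; apply: nbhs_open => t Wt.
have c : {for t, continuous (fun s : R^o => s *: axis_vector k)}.
  by apply: continuous_row => j; exact: smooth_continuous (@smooth_axis setT k j) I.
exact: c (open_near oW Wt).
Qed.

Lemma in_ball0 (r t : R) : ball (0 : R^o) r t <-> `|t| < r.
Proof. by rewrite -ball_normE /= sub0r normrN. Qed.

Lemma axis_form_smooth P beta c r k : one_form P beta -> visible_box P c r ->
  smooth_on (ball (0 : R^o) (2 * r)) (axis_form beta c k).
Proof.
move=> [_ bl] vb; have [[K [oc _] _] r0 _] := vb.
have r42 (t : R) : `|t| < 2 * r -> `|t| <= 4 * r by lra.
apply: smooth_local => t /in_ball0 tr.
have [dq cq Pq _] := axis_in_box k vb (r42 t tr).
have [a [W [Wq [oW Wd sa ab]]]] := bl c oc _ Pq dq.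
pose U := ball (0 : R^o) (2 * r) `&` [set t : R^o | W (t *: axis_vector k)].
have oU : open U by apply: openI; [exact: ball_open|exact: axis_open].
exists U; first by split; [exact/in_ball0|rewrite /= -cq].
have s1 := smooth_comp oU oW (sa (plane_axis k)) (fun t (Ut : U t) => Ut.2)
  (fun j => @smooth_axis U k j).
apply: (smooth_eq oU _ s1) => s [/in_ball0 sr Ws].
have [ds cs Ps ts] := axis_in_box k vb (r42 s sr).
rewrite /axis_form ab //; last by rewrite cs.
rewrite (bigD1 (plane_axis k)) //= axis_vectorE eqxx mulr1 big1 ?addr0 ?cs //.
by move=> j /negbTE jk; rewrite axis_vectorE jk mulr0.
Qed.

Lemma diff_form_axis_smooth P h c r k : smooth_fun h -> visible_box P c r ->
  smooth_on (ball (0 : R^o) (2 * r)) (axis_form (diff_form h) c k).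
Proof.
move=> sh vb; have [[K [oc _] _] r0 rd] := vb.
have [[_ od _ _ _] _] := oc.
have Ud (t : R^o) : ball (0 : R^o) (2 * r) t -> (c @` dom c) (t *: axis_vector k).
  move=> /in_ball0 tr; apply: rd; apply: le_trans (norm_axis_vector _ _) _.
  by rewrite (le_trans (ltW tr)) // ler_wpM2r ?(ltW r0) // ler_nat.
have s1 := smooth_comp (ball_open (0 : R^o) (2 * r)) od
  (smooth_derive (axis_vector k) (sh c oc)) Ud (fun j => @smooth_axis _ k j).
apply: (smooth_eq (ball_open _ _) _ s1) => t /in_ball0 tr.
have [|_ ct _ _] := axis_in_box (t := t) k vb.
  by rewrite (le_trans (ltW tr)) // ler_wpM2r ?(ltW r0) // ler_nat.
by rewrite /axis_form /diff_form ct.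
Qed.

Lemma smooth_funZ (e : R) (h : M -> R) : smooth_fun h -> smooth_fun (fun q => e * h q).
Proof.
move=> sh c oc; have [[_ od _ _ _] _] := oc.
exact: (smooth_mul od (smooth_cst e) (sh c oc)).
Qed.

Lemma diff_formZ (e : R) h c p v : smooth_fun h -> oriented_chart c -> dom c p ->
  diff_form (fun q => e * h q) c p v = e * diff_form h c p v.
Proof.
move=> sh oc dp; have ip : (c @` dom c) (c p) by exists p.
have d : derivable (fun x => h (chart_inv c x) : R^o) (c p) v.
  exact: smooth_derivable (sh c oc) ip.
by have [_ E] := is_deriveZ e (derivableP d); exact: E.
Qed.

Lemma axis_form_perturb P beta h c r k (e t : R) : smooth_fun h ->
  visible_box P c r -> `|t| <= 4 * r ->
  axis_form (add_diff beta (fun q => e * h q)) c k t =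
  axis_form beta c k t + e * axis_form (diff_form h) c k t.
Proof.
move=> sh vb tr; have [[K [oc _] _] _ _] := vb.
have [dq _ _ _] := axis_in_box k vb tr.
by rewrite /axis_form /add_diff diff_formZ.
Qed.

Lemma regular_zeros_eq (b b' : R^o -> R^o) (r s : R) : 0 < r -> r < s ->
  (forall t : R, `|t| < s -> b t = b' t) -> regular_zeros b r -> regular_zeros b' r.
Proof.
move=> r0 rs E [b0 bz]; split.
  by rewrite -E // normr0 (lt_trans r0).
move=> t tr; have ts : `|t| < s by exact: le_lt_trans tr rs.
rewrite -E // => /(bz t tr); congr (_ != _); apply: near_eq_derive.
have o : \forall u \near (t : R^o), ball (0 : R^o) s u.
  by apply: open_near; [exact: ball_open|exact/in_ball0].
by apply: filterS o => u /in_ball0 us; exact: E.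
Qed.

(** The function [h] is the coordinate along the axis, cut off. Adding e * dh shifts the restriction
    of the form to the axis by the constant [e] on |t| <= r, which is the family needed for Sard's
    theorem. *)
Lemma axis_bump P c r k (rho : R^o -> R^o) : visible_box P c r ->
  smooth_on setT rho -> (forall x : R, `|x| <= 2 -> rho x = 1) ->
  (forall x : R, 3 <= `|x| -> rho x = 0) ->
  exists2 h : M -> R, smooth_fun h & forall t : R, `|t| <= r ->
    axis_form (diff_form h) c k t = 1 /\ 'D_1 (axis_form (diff_form h) c k) t = 0.
Proof.
move=> vb srho rho1 rho0; have [[K [oc _] _] r0 rd] := vb; have [ac _] := oc.
pose phi (x : 'rV[R]_3) : R^o := x 0 (plane_axis k) * bump rho r x.
have sphi : smooth_on setT phi.
  exact: (smooth_mul openT (@smooth_coord R 3 setT _) (smooth_bump r srho)).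
have r3 : 0 < 3 * r by rewrite mulr_gt0.
have [h [sh h1 _]] : exists h : M -> R, [/\ smooth_fun h,
    forall q, dom c q -> h q = phi (c q)
    & forall q, ~ chart_box c (3 * r) q -> h q = 0].
  apply: extend_smooth => //.
    by move=> x xr; apply: rd; apply: le_trans xr _; lra.
  by move=> x xr; rewrite /phi (bump0 r0 rho0) // mulr0.
exists h => //.
have one t : `|t| < 2 * r -> axis_form (diff_form h) c k t = 1.
  move=> tr; have t4 : `|t| <= 4 * r by lra.
  have [dq cq _ _] := axis_in_box k vb t4.
  rewrite /axis_form /diff_form cq.
  have -> : 1 = axis_vector k 0 (plane_axis k) by rewrite axis_vectorE eqxx.
  have [_ <-] := is_derive_coordinate (plane_axis k) (t *: axis_vector k) (axis_vector k).
  apply: near_eq_derive.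
  have o : \forall x \near (t *: axis_vector k), ball (0 : 'rV[R]_3) (2 * r) x.
    apply: open_near; first exact: ball_open.
    by rewrite -ball_normE /= sub0r normrN (le_lt_trans (norm_axis_vector _ _)).
  apply: filterS o => x; rewrite -ball_normE /= sub0r normrN => xr.
  have [|dx cx] := image_point (x := x) ac; first by apply: rd; lra.
  by rewrite h1 // cx /phi (bump1 r0 rho1) ?mulr1 // ltW.
move=> t tr; have t2 : `|t| < 2 * r by lra.
split; first exact: one.
rewrite -[RHS](@derive_cst _ R^o R^o 1 (t : R^o) (1 : R^o)).
apply: near_eq_derive.
have o : \forall u \near (t : R^o), ball (0 : R^o) (2 * r) u.
  by apply: open_near; [exact: ball_open|exact/in_ball0].
by apply: filterS o => u /in_ball0 ur; exact: one.
Qed.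

Definition regular_on beta (L : seq (chart R M * 'I_2 * R)) : Prop :=
  forall c k r, List.In (c, k, r) L -> regular_zeros (axis_form beta c k) r.

Definition visible_list P (L : seq (chart R M * 'I_2 * R)) : Prop :=
  forall c k r, List.In (c, k, r) L -> visible_box P c r.

Lemma regular_on_open P beta h L : one_form P beta -> smooth_fun h ->
  visible_list P L -> regular_on beta L ->
  exists2 d : R, 0 < d & forall e : R, `|e| < d ->
    regular_on (add_diff beta (fun q => e * h q)) L.
Proof.
move=> fb sh; elim: L => [_ _|[[c k] r] L IH vL rL]; first by exists 1.
have [||d d0 dL] := IH.
- by move=> c' k' r' H; apply: (vL c' k' r'); right.
- by move=> c' k' r' H; apply: rL; right.
have vb : visible_box P c r by apply: (vL c k r); left.
have [_ r0 _] := vb; have r2 : r < 2 * r by lra.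
have rb : regular_zeros (axis_form beta c k) r by apply: rL; left.
have [d' d'0 dr] := regular_zeros_open r0 r2 (axis_form_smooth k fb vb)
  (diff_form_axis_smooth k sh vb) rb.
exists (Num.min d d'); first by rewrite lt_min d0.
move=> e; rewrite lt_min => /andP[ed ed'] c' k' r' [[<- <- <-]|]; last exact: dL.
apply: (regular_zeros_eq r0 r2 _ (dr e ed')) => t tr.
  have t4 : `|t| <= 4 * r by lra.
  exact/esym/(axis_form_perturb _ _ _ sh vb t4).
Qed.

(** Induction over the axes: the multiple [e] that makes the new axis regular can be taken so small
    that the axes already treated remain regular. *)
Lemma perturb_regular (P : branched_simple_polyhedron M) beta L (rho : R^o -> R^o) :
  smooth_on setT rho -> (forall x : R, `|x| <= 2 -> rho x = 1) ->
  (forall x : R, 3 <= `|x| -> rho x = 0) ->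
  one_form P beta -> d_positive P beta -> visible_list P L ->
  exists beta', [/\ one_form P beta', d_positive P beta' & regular_on beta' L].
Proof.
move=> srho rho1 rho0 fb pb; elim: L => [_|[[c k] r] L IH vL].
  by exists beta; split.
have [|b1 [fb1 pb1 rL]] := IH.
  by move=> c' k' r' H; apply: (vL c' k' r'); right.
have vb : visible_box P c r by apply: (vL c k r); left.
have [_ r0 _] := vb; have r2 : r < 2 * r by lra.
have [h sh h1] := axis_bump k vb srho rho1 rho0.
have vL' : visible_list P L by move=> c' k' r' H; apply: (vL c' k' r'); right.
have [d d0 dL] := regular_on_open fb1 sh vL' rL.
have [e ed re] := regular_zeros_dense r0 r2 d0 (axis_form_smooth k fb1 vb)
  (diff_form_axis_smooth k sh vb) h1.
have she := smooth_funZ e sh.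
exists (add_diff b1 (fun q => e * h q)); split.
- exact: add_diff_one_form.
- exact: add_diff_d_positive.
- move=> c' k' r' [[<- <- <-]|]; last exact: dL.
  apply: (regular_zeros_eq r0 r2 _ re) => t tr.
  have t4 : `|t| <= 4 * r by lra.
  exact/esym/(axis_form_perturb _ _ _ sh vb t4).
Qed.

End Axes.

Section Cover.
Context {R : realType} {M : oriented_3manifold R}.
Variable P : branched_simple_polyhedron M.
Implicit Types (c : chart R M) (p q : M).

Definition covers (L : seq (chart R M * R)) p : Prop :=
  exists c r, [/\ List.In (c, r) L, visible_box P c r, dom c p & `|c p| < r].

Lemma model_boxed m c p : model_chart P m c p ->
  exists K, [/\ boxed P K c, m K, dom c p & c p = 0].
Proof. by move=> [oc dp cp [K mK PK]]; exists K. Qed.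

Lemma visible_center c p K : boxed P K c -> box_model K -> dom c p -> c p = 0 ->
  exists r, visible_box P c r.
Proof.
move=> bc mK dp cp; have [[[_ od _ _ _] _] _] := bc.
have : \forall x \near (0 : 'rV[R]_3), (c @` dom c) x.
  by apply: (open_near od); exists p.
(* Division by 5 puts the closed ball of radius 4 * (r / 5) inside the open ball of radius [r]. *)
move=> /nbhs_ballP[r /= r0 rd]; exists (r / 5); split.
- by exists K.
- by rewrite divr_gt0.
- by move=> x xr; apply: rd; rewrite -ball_normE /= sub0r normrN; lra.
Qed.

Lemma center_visible p : carrier P p -> exists c r,
  [/\ visible_box P c r, dom c p & c p = 0].
Proof.
move=> Pp; have [c] := polyhedron_flow_box Pp.
have vis m K : m K -> box_model K -> boxed P K c -> dom c p -> c p = 0 ->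
    exists c r, [/\ visible_box P c r, dom c p & c p = 0].
  move=> _ mK bc dp cp; have [r vr] := visible_center bc mK dp cp.
  by exists c, r.
by case=> -[/model_boxed[K [bc mK dp cp]] _]; apply: (vis _ K mK) => //;
  [constructor 1|constructor 2|constructor 3].
Qed.

Lemma finite_box_cover : exists L : seq (chart R M * R),
  forall p, carrier P p -> covers L p.
Proof.
have [cP _] := polyhedron_simple P.
(* Near-covering along the filter of lists that contain a given finite list. *)
pose F : set_system (seq (chart R M * R)) :=
  [set A | exists L0, forall L, (forall d, List.In d L0 -> List.In d L) -> A L].
have FF : Filter F.
  split.
  - by exists [::].
  - move=> A B [LA hA] [LB hB]; exists (LA ++ LB) => L hL; split.
      by apply: hA => d dA; apply: hL; apply/List.in_or_app; left.
    by apply: hB => d dB; apply: hL; apply/List.in_or_app; right.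
  - by move=> A B AB [L0 hA]; exists L0 => L hL; apply/AB/hA.
move/compact_near_coveringP : cP => /(_ _ F covers FF).
case=> [p Pp|L /(_ L (fun _ => id)) HL]; last by exists L.
have [c [r [vr dp cp]]] := center_visible Pp.
have [[K [[ac oc] _] _] r0 _] := vr.
pose U := dom c `&` c @^-1` ball (0 : 'rV[R]_3) r.
have oU : open U by apply: chart_preimage_open ac _; exact: ball_open.
have Up : U p by split=> //=; rewrite cp; exact: ballxx.
exists (U, [set L | List.In (c, r) L]).
  split; first exact: open_near.
  by exists [:: (c, r)] => L; apply; left.
move=> [q L] [/= [dq cq] cL]; exists c, r; split => //.
by move: cq; rewrite /= -ball_normE /= sub0r normrN.
Qed.

Lemma plane_not_singular K c q : boxed P K c -> plane_model K -> dom c q ->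
  ~ singular P q.
Proof.
move=> bc pK dq [Pq /(_ c bc.1 dq)]; apply; apply: (graph_near_regular bc dq).
exists setT, (cst 0); split; [exact: openT|by []|exact: smooth_zero|].
by move=> y _; rewrite pK.
Qed.

Lemma axis_velocity k c q :
  oriented_chart c -> dom c q ->
  (\forall t \near (0 : R^o), (c @` (dom c `&` singular P)) (c q + t *: axis_vector k)) ->
  sing_velocity P c q (axis_vector k).
Proof.
move=> oc dq nS; exists (fun t : R^o => c q + t *: axis_vector k); split => //.
  by rewrite scale0r addr0.
have d : derivable (id : 'rV[R]_3 -> 'rV[R]_3) (c q) (axis_vector k) by exact: derivable_id.
by have := is_derive_line0 d; rewrite derive_id.
Qed.

Lemma axis_near (c : chart R M) (q : M) k : chart_axiom c -> dom c q ->
  \forall t \near (0 : R^o), (c @` dom c) (c q + t *: axis_vector k).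
Proof. by move=> [_ od _ _ _] dq; apply: (line_near _ od); exists q. Qed.

Lemma triple_velocity K c q : boxed P K c -> triple_model K -> dom c q ->
  c q = 0 -> sing_velocity P c q (axis_vector 1).
Proof.
move=> bc tK dq cq; have [oc _] := bc; apply: axis_velocity => //.
apply: filterS (axis_near 1 oc.1 dq) => t [q' dq' E]; exists q' => //; split => //.
by apply: (triple_singular bc tK) => //; rewrite E cq !mxE /= mulr0 addr0.
Qed.

Lemma triple_velocity_axis K c q v : boxed P K c -> triple_model K ->
  sing_velocity P c q v -> v = v 0 (plane_axis 1) *: axis_vector 1.
Proof.
move=> bc tK [g [g0 gS dg]].
have nS : \forall t \near (0 : R^o), g t 0 2 = 0 /\ g t 0 0 = 0.
  by apply: filterS gS => t [q' [dq' Sq'] <-]; exact: singular_triple bc tK dq' Sq'.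
have v2 : v 0 2 = 0 by apply: (velocity_coord0 dg); apply: filterS nS => t [].
have v0 : v 0 0 = 0 by apply: (velocity_coord0 dg); apply: filterS nS => t [].
rewrite (_ : plane_axis 1 = 1); last exact: val_inj.
by apply: row3_eq; rewrite [RHS]mxE axis_vectorE /= ?mulr0 ?mulr1.
Qed.

Lemma vertex_velocity K c q k : boxed P K c -> vertex_model K -> dom c q ->
  c q = 0 -> sing_velocity P c q (axis_vector k).
Proof.
move=> bc vK dq cq; have [oc _] := bc; apply: axis_velocity => //.
apply: filterS (axis_near k oc.1 dq) => t [q' dq' E]; exists q' => //; split => //.
apply: (vertex_singular bc vK) => //; rewrite E cq add0r mxE axis_vectorE.
  by case: (k) => -[|[]] //= _; rewrite mulr0.
rewrite [X in _ \/ X = 0]mxE axis_vectorE.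
by case: (k) => -[|[]] //= _; rewrite mulr0; [right|left].
Qed.

Lemma velocity_axes K c q v : boxed P K c -> box_model K -> dom c q ->
  c q = 0 -> sing_velocity P c q v -> exists k, v = v 0 (plane_axis k) *: axis_vector k.
Proof.
move=> bc mK dq cq [g [g0 gS dg]].
have nS : \forall t \near (0 : R^o), g t 0 2 = 0 /\ (g t 0 0 = 0 \/ g t 0 1 = 0).
  by apply: filterS gS => t [q' [dq' Sq'] <-]; exact: singular_axes bc mK dq' Sq'.
have v2 : v 0 2 = 0 by apply: (velocity_coord0 dg); apply: filterS nS => t [].
have g00 j : g 0 0 j = 0 by rewrite g0 cq mxE.
have [v0|v1] : v 0 0 = 0 \/ v 0 1 = 0.
  by apply: (velocity_product0 dg) => //; apply: filterS nS => t [].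
- exists 1; rewrite (_ : plane_axis 1 = 1); last exact: val_inj.
  by apply: row3_eq; rewrite [RHS]mxE axis_vectorE /= ?mulr0 ?mulr1.
- exists 0; rewrite (_ : plane_axis 0 = 0); last exact: val_inj.
  by apply: row3_eq; rewrite [RHS]mxE axis_vectorE /= ?mulr0 ?mulr1.
Qed.

(** Near a point of an axis other than the centre, the coordinate along this axis stays nonzero,
    which excludes the other axis. *)
Lemma singular_near_axis K c q k (t : R) : boxed P K c -> box_model K -> dom c q ->
  c q = t *: axis_vector k -> t != 0 ->
  \forall q' \near q, dom c q' -> singular P q' ->
    c q' = c q' 0 (plane_axis k) *: axis_vector k.
Proof.
move=> bc mK dq cq t0; have [[ac _] _] := bc; have [od _ _ cc _] := ac.
have ck : c q 0 (plane_axis k) = t by rewrite cq mxE axis_vectorE eqxx mulr1.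
have cont : {for q, continuous (fun q' => c q' 0 (plane_axis k) : R)}.
  apply: (@continuous_comp _ _ _ c (fun x : 'rV[R]_3 => x 0 (plane_axis k))).
    exact: cc.
  exact: smooth_continuous (@smooth_coord R 3 setT _) I.
have t0' : 0 < `|t| by rewrite normr_gt0.
have := cont; rewrite /prop_for /continuous_at ck => /cvgrPdist_lt/(_ _ t0').
apply: filterS => q' q't dq' Sq'.
have xk : c q' 0 (plane_axis k) != 0.
  by apply/eqP => E; move: q't; rewrite E subr0 ltxx.
have [x2 x01] := singular_axes bc mK dq' Sq'.
apply/rowP => j; rewrite [RHS]mxE axis_vectorE.
have [->|jk] := eqVneq j (plane_axis k); first by rewrite mulr1.
rewrite mulr0; case: j jk => -[|[|[|//]]] hj jk.
- rewrite (_ : Ordinal hj = 0); last exact: val_inj.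
  case: x01 => // x1; move: xk jk; case: (k) => -[|[]] //= hk.
  by rewrite (_ : plane_axis _ = 1) ?x1 ?eqxx //; exact: val_inj.
- rewrite (_ : Ordinal hj = 1); last exact: val_inj.
  case: x01 => // x0; move: xk jk; case: (k) => -[|[]] //= hk.
  by rewrite (_ : plane_axis _ = 0) ?x0 ?eqxx //; exact: val_inj.
- by rewrite (_ : Ordinal hj = 2) //; exact: val_inj.
Qed.

End Cover.

(** * Each singular point is transverse or a nondegenerate tangency *)

Section Dichotomy.
Context {R : realType} {M : oriented_3manifold R}.
Variable P : branched_simple_polyhedron M.
Implicit Types (c : chart R M) (p q : M) (beta : form_on M).

Definition nondegenerate_at beta p : Prop :=
  exists c, [/\ triple_box P c p, axis_form beta c 1 0 = 0
    & 'D_1 (axis_form beta c 1) 0 != 0].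

Lemma form_scale beta c q (a : R) w : one_form P beta -> oriented_chart c ->
  dom c q -> carrier P q -> tangent P c q w -> tangent P c q (a *: w) ->
  beta c q (a *: w) = a * beta c q w.
Proof.
move=> [_ bl] oc dq Pq tw taw.
have [A [W [Wq [_ _ _ ab]]]] := bl c oc q Pq dq.
rewrite !ab // mulr_sumr; apply: eq_bigr => i _.
by rewrite mxE mulrCA.
Qed.

Lemma curve_near c q (g : R^o -> 'rV[R]_3) (v : 'rV[R]_3) (A : set M) :
  chart_axiom c -> dom c q -> g 0 = c q -> is_derive (0 : R^o) (1 : R^o) g v ->
  (\forall q' \near q, A q') -> \forall t \near (0 : R^o), A (chart_inv c (g t)).
Proof.
move=> ac dq g0 dg nA; have [_ _ _ _ ci] := ac.
have iq : (c @` dom c) (c q) by exists q.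
have cg := curve_continuous dg.
have cig : {for (0 : R^o), continuous (chart_inv c \o g)}.
  by apply: continuous_comp => //; rewrite g0; exact: ci.
by apply: cig; rewrite /= g0 (chart_invK ac).
Qed.

Lemma velocity_single K c q k (t : R) v : boxed P K c -> box_model K -> dom c q ->
  c q = t *: axis_vector k -> t != 0 -> sing_velocity P c q v ->
  v = v 0 (plane_axis k) *: axis_vector k.
Proof.
move=> bc mK dq cq t0 [g [g0 gS dg]]; have [[ac _] _] := bc.
have n1 := curve_near ac dq g0 dg (singular_near_axis bc mK dq cq t0).
apply/rowP => j; rewrite [RHS]mxE axis_vectorE.
have [->|jk] := eqVneq j (plane_axis k); first by rewrite mulr1.
rewrite mulr0; apply: (velocity_coord0 dg); apply: filterS (filterI gS n1) => s.
move=> [[q' [dq' Sq'] <-]]; rewrite (chart_invK ac) // => /(_ dq' Sq') ->.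
by rewrite mxE axis_vectorE (negbTE jk) mulr0.
Qed.

Lemma transverse_velocity beta K c p : one_form P beta -> boxed P K c ->
  box_model K -> dom c p -> carrier P p -> c p 0 2 = 0 ->
  (forall v, sing_velocity P c p v -> exists2 k,
     v = v 0 (plane_axis k) *: axis_vector k & beta c p (axis_vector k) != 0) ->
  transverse_at P beta p.
Proof.
move=> fb bc mK dp Pp p2 ax; have [oc _] := bc.
apply: (transverse_chart fb Pp oc dp) => v Sv v0.
have tv := sing_velocity_tangent Sv.
have [k vk bk] := ax v Sv.
have tk := plane_tangent bc mK dp p2 (axis_vector_height k).
rewrite vk (form_scale fb oc dp Pp tk) -?vk // mulf_neq0 //.
by apply/eqP => E; move: v0; rewrite vk E scale0r eqxx.
Qed.

(** At a vertex S(P) has two independent velocities, and the derivative of a transition is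
    injective, so no chart can see them on one line. *)
Lemma vertex_not_single c K c' p k : boxed P K c -> vertex_model K -> dom c p ->
  c p = 0 -> oriented_chart c' -> dom c' p ->
  ~ (forall v, sing_velocity P c' p v -> v = v 0 (plane_axis k) *: axis_vector k).
Proof.
move=> bc vK dp cp oc' dp' single; have [oc _] := bc.
have S i := sing_velocity_transition oc oc' dp dp' (vertex_velocity i bc vK dp cp).
have ox := overlap_point dp dp'.
set D := fun i => 'D_(axis_vector i) (transition c c') (c p).
have cancel (x y : R) (w : 'rV[R]_3) : y *: (x *: w) + (- x) *: (y *: w) = 0.
  by rewrite !scalerA -scalerDl mulNr mulrC subrr scale0r.
have E0 := single _ (S 0); have E1 := single _ (S 1).
set a := (D 0) 0 (plane_axis k); set b := (D 1) 0 (plane_axis k).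
(* If both velocities were multiples a and b of the same vector, this combination would be killed by
   the derivative of the transition. *)
have : b *: axis_vector 0 + (- a) *: axis_vector 1 = 0 :> 'rV[R]_3.
  apply/eqP/negPn/negP => ne.
  have := derive_transition_neq0 oc oc' dp dp' ne.
  move/eqP; apply; apply: etrans (derive_transitionD _ _ oc oc' ox) _.
  apply: etrans (congr2 +%R (derive_transitionZ b _ oc oc' ox)
    (derive_transitionZ (- a) _ oc oc' ox)) _.
  apply: etrans (congr2 (fun x y => b *: x + (- a) *: y) E0 E1) _.
  exact: cancel.
move=> /rowP /(_ 0); rewrite mxE [X in X + _]mxE [X in _ + X]mxE !axis_vectorE /=.
rewrite mulr1 mulr0 addr0 [RHS]mxE => b0.
have := derive_transition_neq0 oc oc' dp dp' (axis_vector_neq0 1).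
by rewrite E1 -/(D 1) -/b b0 scale0r eqxx.
Qed.

(** The box [c] of the cover is not centred at [p], whereas [c'] is. Along the triple line the
    transition is a change of parameter [s], so the two restrictions of the form satisfy b'(y) =
    s'(y) b(s(y)), where b' belongs to [c']. As b(t) = 0, the derivative at 0 is s'(0)^2 times that
    of b at t. *)
Lemma nondegenerate_transfer beta c r k (t : R) c' p : one_form P beta ->
  visible_box P c r -> `|t| < r -> dom c p -> c p = t *: axis_vector k -> t != 0 ->
  axis_form beta c k t = 0 -> 'D_1 (axis_form beta c k) t != 0 ->
  triple_box P c' p -> nondegenerate_at beta p.
Proof.
move=> fb vb tr dp cp t0 b0 db tb; exists c'.
have [[K bc mK] r0 rd] := vb; have [oc _] := bc; have [ac _] := oc.
have [_ [/model_boxed[K' [bc' tK' dp' cp']] _]] := tb.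
have [oc' _] := bc'; have [ac' _] := oc'.
have mK' : box_model K' by constructor 2.
have [r' vb'] := visible_center bc' mK' dp' cp'; have [_ r'0 _] := vb'.
pose tau := transition c' c.
have oO : open (overlap c' c) by exact: overlap_open.
have ox := overlap_point dp' dp.
pose sk (x : 'rV[R]_3) : R^o := tau x 0 (plane_axis k).
have ssk : smooth_on (overlap c' c) sk by exact: smooth_transition.
pose s (y : R) := sk (y *: axis_vector 1).
pose sigma (y : R) := 'D_(axis_vector 1) sk (y *: axis_vector 1).
(* The axis of [c'] consists of singular points, and near [p] these all lie on the axis [k] of [c],
   because t is not 0. *)
have key : \forall y \near (0 : R), overlap c' c (y *: axis_vector 1) /\
    tau (y *: axis_vector 1) = s y *: axis_vector k.
  have n1 : \forall y \near (0 : R), overlap c' c (y *: axis_vector 1).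
    have := line_near (axis_vector 1) oO ox.
    by rewrite cp'; apply: filterS => y; rewrite add0r.
  have [g [g0 gS dg]] : sing_velocity P c' p (axis_vector 1).
    exact: triple_velocity bc' tK' dp' cp'.
  have d : derivable (id : 'rV[R]_3 -> 'rV[R]_3) 0 (axis_vector 1) by exact: derivable_id.
  have dl := is_derive_line0 d; rewrite derive_id in dl.
  have n2 : \forall y \near (0 : R^o), dom c (chart_inv c' (0 + y *: axis_vector 1)) /\
     (dom c (chart_inv c' (0 + y *: axis_vector 1)) ->
     singular P (chart_inv c' (0 + y *: axis_vector 1)) ->
      c (chart_inv c' (0 + y *: axis_vector 1)) =
      c (chart_inv c' (0 + y *: axis_vector 1)) 0 (plane_axis k) *: axis_vector k).
    apply: (curve_near (A := fun q => dom c q /\ (dom c q -> singular P q ->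
       c q = c q 0 (plane_axis k) *: axis_vector k)) ac' dp' _ dl).
      by rewrite scale0r addr0.
    apply: filterI; first by case: ac => od _ _ _ _; exact: (open_near od dp).
    exact: singular_near_axis bc mK dp cp t0.
  apply: filterS (filterI n1 n2) => y [oy]; rewrite add0r => -[dy ky].
  split=> //; rewrite /s /sk /tau /transition; apply: ky => //.
  have [dq' cq'] : dom c' (chart_inv c' (y *: axis_vector 1)) /\
      c' (chart_inv c' (y *: axis_vector 1)) = y *: axis_vector 1.
    by apply: image_point => //; case: oy => q [dq _] <-; exists q.
  apply: (triple_singular bc' tK') => //; rewrite cq' mxE axis_vectorE /= ?mulr0 //.
have key2 : \forall y \near (0 : R), axis_form beta c' 1 y =
    sigma y * axis_form beta c k (s y).
  have /nbhs_ballP[e /= e0 ek] := key.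
  have n1 : \forall y \near (0 : R), ball (0 : R) e y /\ `|y| <= 4 * r'.
    apply: filterI; first exact: nbhsx_ballx.
    have o : \forall y \near (0 : R^o), ball (0 : R^o) (4 * r') y.
      by apply: open_near; [exact: ball_open|apply: ballxx; rewrite mulr_gt0].
    by apply: filterS o => y /in_ball0 /ltW.
  apply: filterS n1 => y [ey yr].
  have [oy ty] := ek y ey.
  have [dq' cq' Pq tq] := axis_in_box 1 vb' yr.
  set q := axis_point c' 1 y in dq' cq' Pq tq *.
  have dq : dom c q.
    case: oy => q1 [dq1' dq1] E; suff -> : q = q1 by [].
    by rewrite /q /axis_point -E chart_invK.
  have cq : c q = s y *: axis_vector k.
    by rewrite -ty -cq' /tau (transition_point _ ac').
  have Dt : 'D_(axis_vector 1) (transition c' c) (c' q) = sigma y *: axis_vector k.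
    have ox' := overlap_point dq' dq.
    apply/rowP => j; rewrite [RHS]mxE axis_vectorE derive_transition_coord //.
    have [->|jk] := eqVneq j (plane_axis k); first by rewrite mulr1 cq'.
    rewrite mulr0; apply: derive_near0.
      exact: smooth_derivable (smooth_transition j oc' oc) ox'.
    have o : \forall u \near (y : R), ball (0 : R) e u.
      by apply: open_near => //; exact: ball_open.
    have n0 : \forall h \near (0 : R), ball (0 : R) e (y + h * 1).
      exact: (line_near (E := R^o) (1 : R) (ball_open (0 : R^o) e) ey).
    apply: filterS n0 => h /ek[_ th].
    rewrite cq' -scalerDl -[h]mulr1 -/tau th mxE axis_vectorE (negbTE jk) mulr0 //.
  rewrite /axis_form -/q -(fb.1 c' c oc' oc q _ Pq dq' dq tq) Dt.
  have -> : axis_point c k (s y) = q by rewrite /axis_point -cq chart_invK.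
  have q2 : c q 0 2 = 0 by rewrite cq mxE axis_vector_height mulr0.
  apply: (form_scale fb oc dq Pq).
    by apply: (plane_tangent bc mK dq q2); exact: axis_vector_height.
  by apply: (plane_tangent bc mK dq q2); rewrite mxE axis_vector_height mulr0.
have st : s 0 = t.
  rewrite /s scale0r -cp' /sk /tau (transition_point _ ac') // cp mxE axis_vectorE.
  by rewrite eqxx mulr1.
(* The derivative of the transition sends the axis vector to a multiple of the axis vector of [c],
   with factor [sigma 0]; it cannot vanish. *)
have s0 : sigma 0 != 0.
  have [_ E] := nbhs_singleton key.
  have S := sing_velocity_transition oc' oc dp' dp (triple_velocity bc' tK' dp' cp').
  have vs := velocity_single bc mK dp cp t0 S.
  have := derive_transition_neq0 oc' oc dp' dp (axis_vector_neq0 1).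
  apply: contra_neq => z; rewrite vs derive_transition_coord //.
  by rewrite (_ : 'D_ _ _ _ = 0) ?scale0r // -z /sigma scale0r cp'.
split => //.
  by rewrite (nbhs_singleton key2) st b0 mulr0.
have ox0 : overlap c' c (0 : 'rV[R]_3) by rewrite -cp'.
have ds : is_derive (0 : R) (1 : R) (s : R -> R) (sigma 0).
  have d1 : derivable sk 0 (axis_vector 1) by exact: smooth_derivable ssk ox0.
  have := is_derive_line0 d1; rewrite /sigma scale0r.
  by rewrite (_ : (fun y : R => sk (0 + y *: axis_vector 1)) = s) //; apply/funext => y; rewrite add0r.
have dsig : derivable (sigma : R -> R) (0 : R) (1 : R).
  have d1 : derivable ('D_(axis_vector 1) sk) 0 (axis_vector 1).
    exact: smooth_derivable (smooth_derive _ ssk) ox0.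
  have [+ _] := is_derive_line0 d1.
  by rewrite (_ : (fun y : R => _) = sigma) //; apply/funext => y; rewrite add0r.
have sb := axis_form_smooth k fb vb.
have tb2 : ball (0 : R^o) (2 * r) t by apply/in_ball0; lra.
have dbt : differentiable (axis_form beta c k : R -> R) (s 0).
  by rewrite st; exact: smooth_differentiable1 sb tb2.
have [ds1 ds2] := ds.
have dcomp := is_derive_comp ds1 dbt.
have dprod := is_deriveM (derivableP dsig) dcomp.
have -> : 'D_1 (axis_form beta c' 1) 0 =
    'D_1 ((sigma : R -> R) * (axis_form beta c k \o s)) (0 : R).
  by apply: near_eq_derive.
have [_ ->] := dprod; rewrite ds2 /= st b0 scale0r addr0.
have -> : 'D_(sigma 0) (axis_form beta c k) t = sigma 0 * 'D_1 (axis_form beta c k) t.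
  have := @smooth_deriveZv R R^o _ _ (t : R^o) (1 : R) (sigma 0) sb tb2.
  by rewrite [sigma 0 *: (1 : R)]mulr1.
by rewrite !mulf_neq0.
Qed.

(** At the centre regularity makes the form nonzero on both axes. Elsewhere [p] lies on one axis,
    and the form is either nonzero on it or has a simple zero. In the latter case [p] is not a
    vertex, since all velocities lie on one line, so it has a flow box of triple type. *)
Lemma regular_dichotomy beta c r p : one_form P beta -> visible_box P c r ->
  (forall k, regular_zeros (axis_form beta c k) r) -> singular P p -> dom c p ->
  `|c p| < r -> transverse_at P beta p \/
  nondegenerate_at beta p /\ exists k, exists2 t, p = axis_point c k t &
    `|t| <= r /\ axis_form beta c k t = 0.
Proof.
move=> fb vb rz Sp dp pr; have [[K bc mK] r0 rd] := vb.
have [oc PK] := bc; have [ac _] := oc; have [Pp _] := Sp.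
have [p2 p01] := singular_axes bc mK dp Sp.
have [k [t cp]] : exists k t, c p = t *: axis_vector k.
  have ax0 : plane_axis 0 = 0 by exact: val_inj.
  have ax1 : plane_axis 1 = 1 by exact: val_inj.
  case: p01 => [x0|x1]; [exists 1, (c p 0 1)|exists 0, (c p 0 0)];
  by apply: row3_eq; rewrite [RHS]mxE axis_vectorE /= ?mulr0 ?mulr1.
have tr : `|t| < r.
  apply: le_lt_trans pr; have := coord_le_norm (c p) (plane_axis k).
  by rewrite {1}cp mxE axis_vectorE eqxx mulr1.
have pE : p = axis_point c k t by rewrite /axis_point -cp chart_invK.
have [t0|t0] := eqVneq t 0.
  left; have cp0 : c p = 0 by rewrite cp t0 scale0r.
  apply: (transverse_velocity fb bc mK dp Pp p2) => v Sv.
  have [k' vk'] := velocity_axes bc mK dp cp0 Sv; exists k' => //.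
  have [+ _] := rz k'; rewrite /axis_form /axis_point scale0r -cp0.
  by rewrite chart_invK.
have [b0|b0] := eqVneq (axis_form beta c k t) 0; last first.
  left; apply: (transverse_velocity fb bc mK dp Pp p2) => v Sv.
  exists k; first exact: velocity_single bc mK dp cp t0 Sv.
  by move: b0; rewrite /axis_form -pE.
right; split; last by exists k, t => //; split=> //; exact: ltW.
have db := (rz k).2 t (ltW tr) b0.
have [c' [pb|tb|vb']] := polyhedron_flow_box Pp.
- have [/model_boxed[K' [bc' pK' dp' _]] _] := pb.
  by case: (plane_not_singular bc' pK' dp' Sp).
- exact: (nondegenerate_transfer fb vb tr dp cp t0 b0 db (conj Pp tb)).
- have [/model_boxed[K' [bc' vK' dp' cp']] _] := vb'.
  exfalso; apply: (vertex_not_single bc' vK' dp' cp' oc dp (k := k)) => v Sv.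
  exact: velocity_single bc mK dp cp t0 Sv.
Qed.

Lemma exists_generic beta (rho : R^o -> R^o) :
  smooth_on setT rho -> (forall x : R, `|x| <= 2 -> rho x = 1) ->
  (forall x : R, 3 <= `|x| -> rho x = 0) ->
  one_form P beta -> d_positive P beta ->
  exists beta' (F : set M), [/\ one_form P beta', d_positive P beta', finite_set F &
    forall p, singular P p ->
      transverse_at P beta' p \/ F p /\ nondegenerate_at beta' p].
Proof.
move=> srho rho1 rho0 fb pb; have [L0 cov] := finite_box_cover P.
have [L1 L1L L1v] : exists2 L1 : seq (chart R M * R),
    forall c r, List.In (c, r) L0 -> visible_box P c r -> List.In (c, r) L1
    & forall c r, List.In (c, r) L1 -> visible_box P c r.
  (* The cover may list boxes it never uses, about which nothing is known; only visible ones are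
     kept. *)
  exists (List.filter (fun d => `[< visible_box P d.1 d.2 >]) L0) => c r.
    by move=> H vb; apply/List.filter_In; split=> //; apply/asboolP.
  by move=> /List.filter_In[_ /asboolP].
pose L := List.flat_map (fun d : chart R M * R => [:: (d.1, 0 : 'I_2, d.2); (d.1, 1 : 'I_2, d.2)]) L1.
have vL : visible_list P L.
  move=> c k r /List.in_flat_map[[c1 r1] [H]] /= [[<- _ <-]|[[<- _ <-]|//]]; exact: L1v.
have [b' [fb' pb' rL]] := perturb_regular srho rho1 rho0 fb pb vL.
pose Z (d : chart R M * 'I_2 * R) : set M :=
  axis_point d.1.1 d.1.2 @` [set t : R | `|t| <= d.2 /\ axis_form b' d.1.1 d.1.2 t = 0].
pose F := [set p | exists2 d, List.In d L & Z d p].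
have finF : finite_set F.
  have : forall L', (forall d, List.In d L' -> List.In d L) ->
      finite_set [set p | exists2 d, List.In d L' & Z d p].
    elim=> [_|[[c k] r] L' IH sub].
      by apply: (@sub_finite_set _ _ set0) => // p [].
    apply: (@sub_finite_set _ _ (Z (c, k, r) `|` [set p | exists2 d, List.In d L' & Z d p])).
      by move=> p [d [<-|H] Zp]; [left|right; exists d].
    rewrite finite_setU; split; last by apply: IH => d H; apply: sub; right.
    have H : List.In (c, k, r) L by apply: sub; left.
    have vb := vL c k r H; have [_ r0 _] := vb; have r2 : r < 2 * r by lra.
    apply: finite_image.
    exact: (regular_zeros_finite r0 r2 (axis_form_smooth k fb' vb) (rL c k r H)).
  by move=> /(_ L (fun _ => id)).
exists b', F; split => // p Sp.
have [c [r [H vb dp pr]]] := cov p Sp.1.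
have HL k : List.In (c, k, r) L.
  apply/List.in_flat_map; exists (c, r); split; first exact: L1L.
  case: k => -[|[|//]] hk /=; [left|right; left].
    by rewrite (_ : Ordinal hk = 0) //; exact: val_inj.
  by rewrite (_ : Ordinal hk = 1) //; exact: val_inj.
have [tp|[np [k [t pE [tr b0]]]]] :=
  regular_dichotomy fb' vb (fun k => rL c k r (HL k)) Sp dp pr; first by left.
by right; split=> //; exists (c, k, r) => //; exists t.
Qed.

End Dichotomy.

(** * Normalizing a tangency *)

Section LocalTools.
Context {R : realType}.
Local Notation mu := (@lebesgue_measure R).

Lemma smooth_antiderivative (F f : R^o -> R^o) : smooth_on setT f ->
  (forall x, is_derive (x : R^o) (1 : R^o) F (f x)) -> smooth_on setT F.
Proof.
move=> sf dF s x _; case/lastP: s => [|s v] /=.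
  have [d _] := dF x.
  split; first by apply: differentiable_continuous; exact/derivable1_diffP.
  move=> v; have := is_deriveZv (v : R) (dF x).
  by rewrite [v *: (1 : R^o)]mulr1 => -[].
rewrite -iterD_rcons.
have -> : 'D_v F = (fun y => (v : R) * f y).
  apply/funext => y; have := is_deriveZv (v : R) (dF y).
  by rewrite [v *: (1 : R^o)]mulr1 => -[_].
exact: (smooth_mul openT (smooth_cst (v : R)) sf).
Qed.

Lemma exists_antiderivative (f : R^o -> R^o) : smooth_on setT f ->
  (forall x : R, x <= -1 -> f x = 0) ->
  exists H : R^o -> R^o, [/\ smooth_on setT H, H 0 = 0
    & forall x, is_derive (x : R^o) (1 : R^o) H (f x)].
Proof.
move=> sf f0.
have cf : continuous (f : R -> R).
  by move=> x; exact: smooth_continuous sf (I : setT x).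
(* Since [f] vanishes up to -1, starting at -2 gives an antiderivative on the whole line: near any x
   <= -2 the integral is 0. *)
pose F (x : R) : R := (\int[mu]_(t in `[(-2)%R, x]) (f t : R))%R.
have dF (x : R) : is_derive x (1 : R) F (f x).
  have [x1|x1] := ltP (-2) x.
    have [||d E] := @continuous_FTC1_closed R f (-2) x (x + 1) _ _ x1 (cf x).
    - by rewrite ltrDl.
    - apply: continuous_compact_integrable; first exact: segment_compact.
      exact: continuous_subspaceT.
    by apply: DeriveDef; [exact: d|rewrite -derive1E; exact: E].
  rewrite f0; last by lra.
  have n0 : \forall y \near x, cst 0 y = F y.
    have o : \forall y \near x, y < -1 by apply: lt_nbhsl; lra.
    apply: filterS o => y y1; rewrite /F /Rintegral integral0_eq //= => t.
    by rewrite in_itv /= => /andP[_ ty]; rewrite f0 // (le_trans ty) // ltW.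
  by apply: near_eq_is_derive n0 _; exact: is_derive_cst.
have dH x : is_derive (x : R^o) (1 : R^o) (fun y : R^o => F y - F 0 : R^o) (f x).
  have [d1 d2] := is_deriveB (dF x) (is_derive_cst (F 0) (x : R) (1 : R)).
  by apply: DeriveDef; [exact: d1|rewrite -[RHS]subr0; exact: d2].
exists (fun y : R^o => F y - F 0 : R^o); split; last exact: dH.
  exact: smooth_antiderivative sf dH.
exact: subrr.
Qed.

Lemma cutoff_glue (rho E : R^o -> R^o) (d eta : R) : 0 < eta -> 3 * eta < d ->
  smooth_on setT rho -> (forall x : R, `|x| <= 2 -> rho x = 1) ->
  (forall x : R, 3 <= `|x| -> rho x = 0) -> smooth_on (ball (0 : R^o) d) E ->
  exists f : R^o -> R^o, [/\ smooth_on setT f,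
    forall y : R, `|y| <= 2 * eta -> f y = E y
    & forall y : R, 3 * eta <= `|y| -> f y = 0].
Proof.
move=> eta0 etad srho rho1 rho0 sE.
pose f (y : R) : R := if `|y| < d then rho (eta^-1 * y) * E y else 0.
have s2 : smooth_on setT (fun y : R^o => rho (eta^-1 * y) : R^o).
  have s1 := smooth_mul openT (smooth_cst eta^-1) (@smooth_id R setT).
  exact: (smooth_comp1 openT openT srho (fun _ _ => I) s1).
have f0 (y : R) : 3 * eta <= `|y| -> f y = 0.
  move=> ye; rewrite /f; case: ifP => // _; rewrite rho0 ?mul0r //.
  by rewrite norm_scaled // ler_pdivlMr.
have f1 (y : R) : `|y| <= 2 * eta -> f y = E y.
  move=> ye; rewrite /f ifT; last by lra.
  by rewrite rho1 ?mul1r // norm_scaled // ler_pdivrMr.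
exists f; split; [|exact: f1|exact: f0].
apply: smooth_local => y _.
have [yd|yd] := ltP `|y| d.
  exists (ball (0 : R^o) d); first exact/in_ball0.
  have s3 : smooth_on (ball (0 : R^o) d) (fun y : R^o => rho (eta^-1 * y) : R^o).
    by apply: smooth_subset s2.
  apply: (smooth_eq (ball_open _ _) _ (smooth_mul (ball_open _ _) s3 sE)) => z /in_ball0 zd.
  by rewrite /f zd.
pose U := ~` closed_ball (0 : R^o) (3 * eta).
have oU : open U by rewrite openC; exact: closed_ball_closed.
have UE (z : R) : U z -> 3 * eta <= `|z|.
  rewrite /U /= closed_ballE ?mulr_gt0 // /closed_ball_ /= sub0r normrN.
  by move=> /negP; rewrite -ltNge => /ltW.
exists U.
  rewrite /U /= closed_ballE ?mulr_gt0 // /closed_ball_ /= sub0r normrN.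
  by apply/negP; rewrite -ltNge (lt_le_trans etad).
apply: (@smooth_eq _ _ _ (cst 0)) => //; last exact: smooth_cst.
by move=> z /UE /f0 ->.
Qed.

Lemma linear_approximation (b : R^o -> R^o) (m e : R) :
  is_derive (0 : R^o) (1 : R^o) b m -> b 0 = 0 -> 0 < e ->
  \forall y \near (0 : R), `|b y - m * y| <= e * `|y|.
Proof.
move=> db b0 e0; have q := difference_quotient db b0.
move/cvgrPdist_le/(_ _ e0) : q; rewrite near_withinE.
apply: filterS => y yq; have [->|y0] := eqVneq y 0.
  by rewrite b0 mulr0 subrr normr0 mulr0.
have -> : b y - m * y = - (m - b y / y) * y by field.
by rewrite normrM normrN ler_wpM2r // yq.
Qed.

(** The derivative of the cutoff brings a factor 1/r, but H' = E is at most e |y|, so |H(y)| <= e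
    |y|^2 <= 3 r e |y| absorbs it. The deviations from m y add up to at most e (1 + C + 3 C') |y|,
    which is less than |m| |y|. *)
Lemma tangency_estimate (b E H rho : R^o -> R^o) (m e r C C' : R) :
  0 < r -> 0 < e -> smooth_on setT H -> H 0 = 0 ->
  e * (1 + C + 3 * C') < `|m| ->
  (forall u : R, `|u| <= 3 -> `|rho u| <= C) ->
  (forall u : R, `|u| <= 3 -> `|'D_1 rho u| <= C') ->
  (forall y : R, `|y| <= 3 * r ->
     [/\ `|b y - m * y| <= e * `|y|, `|E y| <= e * `|y| & 'D_1 H y = E y]) ->
  forall y : R, `|y| <= 3 * r -> y != 0 ->
    b y + (r^-1 * 'D_1 rho (r^-1 * y) * H y + rho (r^-1 * y) * E y) != 0.
Proof.
move=> r0 e0 sH H0 em rC rC' est y yr y0.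
have u3 : `|r^-1 * y| <= 3 by rewrite norm_scaled // ler_pdivrMr.
have [by_ Ey _] := est y yr.
have yy : 0 < `|y| by rewrite normr_gt0.
have Hy : `|H y| <= `|y| * (e * `|y|).
  have sb : smooth_on (ball (0 : R^o) (`|y| + 1)) H by apply: smooth_subset sH.
  have yy1 : `|y| < `|y| + 1 by rewrite ltrDl.
  have z0 : `|0 : R| <= `|y| by rewrite normr0.
  have [c [cy cy0 HE]] := segment_mvt yy1 sb (lexx `|y|) z0.
  rewrite -[H y]subr0 -H0 HE normrM subr0 ler_wpM2l //.
  have [_ Ec ->] := est c (le_trans cy yr).
  by rewrite (le_trans Ec) // ler_wpM2l // ltW.
have C0 : 0 <= C by exact: le_trans (normr_ge0 _) (rC _ u3).
have C'0 : 0 <= C' by exact: le_trans (normr_ge0 _) (rC' _ u3).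
apply/eqP => z.
have : `|m * y| < `|m| * `|y|.
  have -> : m * y = - (b y - m * y) - r^-1 * 'D_1 rho (r^-1 * y) * H y - rho (r^-1 * y) * E y.
    by move: z; lra.
  apply: (@le_lt_trans _ _ (e * `|y| + 3 * C' * (e * `|y|) + C * (e * `|y|))); last first.
    have -> : e * `|y| + 3 * C' * (e * `|y|) + C * (e * `|y|) =
      e * (1 + C + 3 * C') * `|y| by ring.
    by rewrite ltr_pM2r.
  rewrite (le_trans (ler_normB _ _)) // lerD //; last first.
    by rewrite normrM ler_pM // rC.
  rewrite (le_trans (ler_normB _ _)) // lerD ?normrN //.
  rewrite 2!normrM normfV (gtr0_norm r0).
  apply: (@le_trans _ _ (r^-1 * C' * (3 * r * (e * `|y|)))).
    apply: ler_pM => //.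
    - by rewrite mulr_ge0 // invr_ge0 ltW.
    - by rewrite ler_wpM2l ?rC' // invr_ge0 ltW.
    - by rewrite (le_trans Hy) // ler_wpM2r // mulr_ge0 // ltW.
  have -> : r^-1 * C' * (3 * r * (e * `|y|)) = 3 * C' * (e * `|y|).
    by field; rewrite gt_eqF.
  by [].
by rewrite normrM ltxx.
Qed.

End LocalTools.

Section Tangency.
Context {R : realType}.

Definition parabola (t : R^o) : 'rV[R]_3 :=
  (- (t ^+ 2 / 2)) *: axis_vector 0 + t *: axis_vector 1.

Definition parabola_velocity (t : R) : 'rV[R]_3 :=
  (- t) *: axis_vector 0 + axis_vector 1.

Lemma parabolaE t : [/\ parabola t 0 0 = - (t ^+ 2 / 2), parabola t 0 1 = t
  & parabola t 0 2 = 0].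
Proof. by split; rewrite !mxE /= ?mulr0 ?mulr1 ?addr0 ?add0r. Qed.

Lemma parabola_velocityE (t : R) : [/\ parabola_velocity t 0 0 = - t,
  parabola_velocity t 0 1 = 1 & parabola_velocity t 0 2 = 0].
Proof. by split; rewrite !mxE /= ?mulr0 ?mulr1 ?addr0 ?add0r. Qed.

Lemma parabola0 : parabola 0 = 0.
Proof. by rewrite /parabola expr0n mul0r oppr0 !scale0r addr0. Qed.

Lemma parabola_norm (t : R) : `|t| <= 1 -> `|parabola t| <= `|t|.
Proof.
have [p0 p1 p2] := parabolaE t.
move=> t1; apply: norm_le_coord => // -[[|[|[|//]]] hj].
- rewrite (_ : Ordinal hj = 0); last exact: val_inj.
  rewrite p0 normrN normrM normrX normfV (ger0_norm (ler0n R 2)).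
  have := normr_ge0 t; move: `|t| t1 => u u1 u0; nra.
- by rewrite (_ : Ordinal hj = 1) ?p1 //; exact: val_inj.
- by rewrite (_ : Ordinal hj = 2) ?p2 ?normr0 //; exact: val_inj.
Qed.

Lemma smooth_parabola (U : set R^o) j : smooth_on U (fun t => parabola t 0 j : R^o).
Proof.
apply: smooth_subset (_ : smooth_on setT _) => //.
have si := @smooth_id R setT.
have s0 := smooth_mul openT (smooth_cst (- (2^-1) * axis_vector 0 0 j)) (smooth_mul openT si si).
have s1 := smooth_mul openT si (smooth_cst (axis_vector 1 0 j)).
apply: (smooth_eq openT _ (smooth_add openT s0 s1)) => t _.
by rewrite [RHS]mxE [X in _ = X + _]mxE [X in _ = _ + X]mxE /cst; congr (_ + _); ring.
Qed.

Lemma is_derive_parabola (t : R) :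
  is_derive (t : R^o) (1 : R^o) parabola (parabola_velocity t).
Proof.
have dp : derivable parabola (t : R^o) (1 : R^o).
  by apply: derivable_row => j; exact: smooth_derivable (@smooth_parabola setT j) I.
have di := is_derive_id (t : R^o) (1 : R^o).
have [d1 d2] := is_deriveM di di.
apply: DeriveDef; first exact: dp.
apply/rowP => j; rewrite derive_row //.
have sq : is_derive (t : R^o) (1 : R^o) ((id * id) : R^o -> R^o) (2 * t).
  by apply: DeriveDef; [exact: d1|rewrite d2 /= /GRing.scale /=; ring].
have := is_deriveD (is_deriveZ (- (2^-1) * axis_vector 0 0 j) sq)
  (is_deriveZ (axis_vector 1 0 j) di).
case=> _; rewrite (_ : _ + _ = (fun y : R^o => parabola y 0 j)).
  move=> ->; rewrite [RHS]mxE [X in _ = X + _]mxE /GRing.scale /=.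
  by rewrite mulr1; congr (_ + _); field.
apply/funext => y; rewrite /= [RHS]mxE [X in _ = X + _]mxE [X in _ = _ + X]mxE.
change (- (2^-1) * axis_vector 0 0 j * (y * y) + axis_vector 1 0 j * y =
  - (y ^+ 2 / 2) * axis_vector 0 0 j + y * axis_vector 1 0 j :> R); ring.
Qed.

Lemma is_derive_corrector (H f : R^o -> R^o) (s : R) (x v : 'rV[R]_3) :
  (forall y, is_derive (y : R^o) (1 : R^o) H (f y)) ->
  is_derive x v (fun y : 'rV[R]_3 => s * y 0 0 + H (y 0 1) : R^o)
    (s * v 0 0 + v 0 1 * f (x 0 1)).
Proof.
move=> dH; have [d1 E1] := is_derive_coordinate 1 x v.
have [dHx EHx] := dH (x 0 1).
have dF : differentiable (H : R -> R) (x 0 1) by apply/derivable1_diffP.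
have [c1 c2] := is_derive_comp d1 dF.
have [z1 z2] := is_deriveZ s (is_derive_coordinate 0 x v).
have [a1 a2] := is_deriveD (derivableP z1) (derivableP c1).
apply: DeriveDef; first exact: a1.
apply: etrans a2 _; rewrite z2 c2 E1; congr (_ + _).
have [_] := is_deriveZv (v 0 1) (dH (x 0 1)).
by rewrite [v 0 1 *: (1 : R^o)]mulr1.
Qed.

(** On the triple line x = z = 0 the term s x vanishes and two of the three cutoff factors are 1, so
    only the product of a cutoff in y with H(y) remains. *)
Lemma is_derive_bump_axis (rho H f : R^o -> R^o) (r y : R) : r != 0 ->
  smooth_on setT rho -> rho 0 = 1 ->
  (forall y, is_derive (y : R^o) (1 : R^o) H (f y)) -> forall s : R,
  is_derive (y : R^o) (1 : R^o)
    (fun z : R^o => bump rho r (z *: axis_vector 1) *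
       (s * (z *: axis_vector 1) 0 0 + H ((z *: axis_vector 1) 0 1)) : R^o)
    (r^-1 * 'D_1 rho (r^-1 * y) * H y + rho (r^-1 * y) * f y).
Proof.
move=> r0 srho rho01 dH s.
have -> : (fun z : R^o => bump rho r (z *: axis_vector 1) *
   (s * (z *: axis_vector 1) 0 0 + H ((z *: axis_vector 1) 0 1)) : R^o) =
   (fun z : R^o => rho (r^-1 * z) : R^o) * H.
  apply/funext => z; rewrite /bump !mxE /= mulr1 !mulr0 rho01 add0r mulr1 mul1r.
  by [].
have ds : is_derive (y : R^o) (1 : R^o) (fun z : R^o => r^-1 * z : R^o) (r^-1).
  have [h1 h2] := is_deriveZ r^-1 (is_derive_id (y : R^o) (1 : R^o)).
  by apply: DeriveDef; [exact: h1|rewrite -[RHS]mulr1; exact: h2].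
have [ds1 ds2] := ds.
have dr : differentiable (rho : R -> R) (r^-1 * y).
  exact: smooth_differentiable1 srho (I : setT (r^-1 * y : R^o)).
have dc := is_derive_comp ds1 dr.
have [p1 p2] := is_deriveM dc (dH y).
apply: DeriveDef; first exact: p1.
apply: etrans p2 _; rewrite ds2 /= addrC /GRing.scale /=; congr (_ + _).
rewrite mulrC; congr (_ * _).
have := @smooth_deriveZv R R^o _ _ (r^-1 * y : R^o) (1 : R) r^-1 srho I.
by rewrite [r^-1 *: (1 : R)]mulr1.
Qed.

End Tangency.

Section Normalize.
Context {R : realType} {M : oriented_3manifold R}.
Variable P : branched_simple_polyhedron M.
Implicit Types (c : chart R M) (p q : M) (beta : form_on M).

(* The parabola x = - y^2 / 2 of the sheet z = 0 is a leaf through p. *)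
Definition tangency_at beta p : Prop :=
  exists c r, [/\ triple_box P c p, 0 < r,
    forall t : R, `|t| < r -> (c @` dom c) (parabola t) /\
      beta c (chart_inv c (parabola t)) (parabola_velocity t) = 0
    & beta c p (axis_vector 0) != 0].

Lemma form_coords beta c (a : 'rV[R]_3 -> 'rV[R]_3) W q (w : 'rV[R]_3) :
  restricts_to P a c W beta -> dom c q -> carrier P q -> W (c q) ->
  tangent P c q w -> w 0 2 = 0 ->
  beta c q w = a (c q) 0 0 * w 0 0 + a (c q) 0 1 * w 0 1.
Proof.
move=> [_ _ _ ab] dq Pq Wq tw w2; rewrite ab // !big_ord_recl big_ord0 addr0.
have e0 : (ord0 : 'I_3) = 0 by exact: val_inj.
have e1 : (lift ord0 (ord0 : 'I_2)) = 1 :> 'I_3 by exact: val_inj.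
have e2 : (lift ord0 (lift ord0 (ord0 : 'I_1))) = 2 :> 'I_3 by exact: val_inj.
by rewrite e0 e1 e2 w2 mulr0 addr0.
Qed.

Lemma small_radius (d D r1 : R) : 0 < d -> 0 < D -> D <= 1 -> 0 < r1 ->
  exists2 r : R, 0 < r & [/\ 3 * r < d, 3 * r <= 2 * (D / 4), 3 * r <= 4 * r1,
    r < D & r < 1].
Proof.
move=> d0 D0 D1 r10; exists (Num.min d (Num.min D r1) / 8).
  by rewrite divr_gt0 // !lt_min d0 D0.
have k1 : Num.min d (Num.min D r1) <= d by rewrite ge_min lexx.
have k2 : Num.min d (Num.min D r1) <= D by rewrite !ge_min lexx orbT.
have k3 : Num.min d (Num.min D r1) <= r1 by rewrite !ge_min lexx !orbT.
by move: (Num.min _ _) k1 k2 k3 => k k1 k2 k3; split; lra.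
Qed.

Lemma double_lt_triple (r : R) : 0 < r -> 2 * r < 3 * r.
Proof. by move=> r0; rewrite ltr_pM2r // ltr_nat. Qed.

Lemma lt_double (r : R) : 0 < r -> r < 2 * r.
Proof. by move=> r0; rewrite ltr_pMl // ltr1n. Qed.

(* h is a cutoff of s x + H(y): the term s x, which does not change beta along the
   triple line x = 0, gives beta(e_x) the sign of the derivative m of beta(e_y),
   and H' is the value which makes the parabola a leaf. Since H'(y) = o(y), the
   cutoff creates no other tangency. *)
Lemma normalize_tangency beta p (rho : R^o -> R^o) :
  smooth_on setT rho -> (forall x : R, `|x| <= 2 -> rho x = 1) ->
  (forall x : R, 3 <= `|x| -> rho x = 0) ->
  one_form P beta -> nondegenerate_at P beta p ->
  exists (h : M -> R) (B : set M), [/\ smooth_fun h, closed B,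
    forall q, ~ B q -> h q = 0,
    tangency_at (add_diff beta h) p
    & forall q, singular P q -> B q -> q <> p ->
        transverse_at P (add_diff beta h) q].
Proof.
move=> srho rho1 rho0 fb [c [tb b0 db]].
have [Pp [/model_boxed[K [bc tK dp cp]] _]] := tb.
have [oc PK] := bc; have [ac _] := oc; have [_ od _ _ _] := ac.
have mK : box_model K by constructor 2.
have [r1 vb] := visible_center bc mK dp cp; have [_ r10 r1d] := vb.
have [a [W [Wp rW]]] := fb.2 c oc p Pp dp; have [oW Wd sa ab] := rW.
rewrite cp in Wp.
have /nbhs_ballP[e1 /= e10 We1] := open_near oW Wp.
have inW (x : 'rV[R]_3) : `|x| < e1 -> W x.
  by move=> xe; apply: We1; rewrite -ball_normE /= sub0r normrN.
pose b := axis_form beta c 1; pose m := 'D_1 b 0.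
pose s := m - a 0 0 0.
pose D := Num.min e1 1.
have D0 : 0 < D by rewrite lt_min e10 ltr01.
have parW (t : R) : `|t| < D -> W (parabola t).
  rewrite lt_min => /andP[te t1]; apply: inW.
  exact: le_lt_trans (parabola_norm (ltW t1)) te.
have sA j : smooth_on (ball (0 : R^o) D) (fun t => a (parabola t) 0 j : R^o).
  apply: (smooth_comp (ball_open (0 : R^o) D) oW (sa j)).
    by move=> t /in_ball0; exact: parW.
  by move=> i; exact: smooth_parabola.
(* On the velocity (- t, 1, 0) of the parabola, the form plus d (s x + H(y)) takes the value - t
   (a_0 + s) + a_1 + H'(t). Solving for H' gives [E]. *)
pose E (t : R^o) : R^o := t * (s + a (parabola t) 0 0) + (-1) * a (parabola t) 0 1.
have oB := ball_open (0 : R^o) D.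
have sE : smooth_on (ball (0 : R^o) D) E.
  have s1 := smooth_add oB (smooth_cst s) (sA 0).
  have s2 := smooth_mul oB (@smooth_id R _) s1.
  have s3 := smooth_mul oB (smooth_cst (-1 : R)) (sA 1).
  exact: (smooth_add oB s2 s3).
have bA : \forall y \near (0 : R), b y = a (y *: axis_vector 1) 0 1.
  pose e2 := Num.min e1 (4 * r1).
  have e20 : 0 < e2 by rewrite lt_min e10 mulr_gt0.
  have o : \forall y \near (0 : R), ball (0 : R) e2 y by exact: nbhsx_ballx.
  apply: filterS o => y; rewrite -ball_normE /= sub0r normrN lt_min => /andP[ye yr].
  have [dq cq Pq tq] := axis_in_box 1 vb (ltW yr).
  rewrite /b /axis_form (form_coords rW) ?axis_vector_height ?cq //.
    by rewrite !axis_vectorE /= mulr0 mulr1 add0r.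
  by apply: inW; exact: le_lt_trans (norm_axis_vector _ _) ye.
have a10 : a 0 0 1 = 0 by have := nbhs_singleton bA; rewrite scale0r => <-; exact: b0.
have r12 : 0 < 2 * r1 by rewrite mulr_gt0.
have sb : smooth_on (ball (0 : R^o) (2 * r1)) b := axis_form_smooth 1 fb vb.
have dbm : is_derive (0 : R^o) (1 : R^o) b m.
  apply: derivableP; apply: smooth_derivable sb _; exact: ballxx.
have sa1 : smooth_on W (fun x => a x 0 1 : R^o) := sa 1.
have Da1 : 'D_(axis_vector 1) (fun x => a x 0 1 : R^o) 0 = m.
  have d1 : derivable (fun x => a x 0 1 : R^o) 0 (axis_vector 1).
    exact: smooth_derivable sa1 Wp.
  have [_ <-] := is_derive_line0 d1; rewrite /m.
  apply: near_eq_derive; apply: filterS bA => y ->; by rewrite add0r.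
(* The derivative is s + a_0 - m at the origin. This is why [s] has the exact value m - a_0, and not
   just one giving the right sign. *)
have dE : is_derive (0 : R^o) (1 : R^o) E 0.
  have bD : ball (0 : R^o) D 0 by exact: ballxx.
  have [dpar1 dpar2] := is_derive_parabola (0 : R).
  have sa0 : smooth_on W (fun x => a x 0 0 : R^o) := sa 0.
  have p0W : W (parabola 0) by rewrite parabola0.
  have c1 := is_derive_comp dpar1 (smooth_differentiable_row oW sa1 p0W).
  have d0 : derivable (fun t => a (parabola t) 0 0 : R^o) (0 : R^o) (1 : R^o).
    exact: smooth_derivable (sA 0) bD.
  have ad := is_deriveD (is_derive_cst s (0 : R^o) (1 : R^o)) (derivableP d0).
  have mu := is_deriveM (is_derive_id (0 : R^o) (1 : R^o)) ad.
  have [t1 t2] := is_deriveD mu (is_deriveZ (-1 : R) c1).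
  apply: DeriveDef; first exact: t1.
  apply: etrans t2 _; rewrite dpar2 parabola0.
  rewrite (_ : parabola_velocity 0 = axis_vector 1); last first.
    by rewrite /parabola_velocity oppr0 scale0r add0r.
  rewrite Da1.
  change (0 * (0 + 'D_1 (fun t => a (parabola t) 0 0 : R^o) (0 : R^o)) +
    (s + a (parabola 0) 0 0) * 1 + (-1) * m = 0 :> R).
  by rewrite parabola0 /s; ring.
have E0 : E 0 = 0 by rewrite /E parabola0 a10; ring.
(* The extension of [E] by a cutoff vanishes beyond 3 * eta, which is below [D], where [E] is
   smooth, and below 1, as the antiderivative requires. *)
pose eta := D / 4.
have eta0 : 0 < eta by rewrite divr_gt0.
have etaD : 3 * eta < D by clear -D0; rewrite /eta; lra.
have D1 : D <= 1 by rewrite ge_min lexx orbT.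
have [f [sf f1 f0]] := cutoff_glue eta0 etaD srho rho1 rho0 sE.
have fm1 (x : R) : x <= -1 -> f x = 0.
  move=> x1; apply: f0; clear -x1 D1; rewrite ler0_norm; last by lra.
  by rewrite /eta; lra.
have [H [sH H0 dH]] := exists_antiderivative sf fm1.
have lt34 : (3 : R) < 4 by rewrite ltr_nat.
have srho4 : smooth_on (ball (0 : R^o) 4) rho by apply: smooth_subset srho.
have [C C0 rC] := smooth_bounded (ltr0n R 3) lt34 srho4.
have [C' C'0 rC'] := smooth_bounded (ltr0n R 3) lt34 (smooth_derive (1 : R^o) srho4).
pose e := `|m| / (2 * (1 + C + 3 * C')).
have C1 : 0 < 1 + C + 3 * C' by rewrite !addr_gt0 ?mulr_gt0.
have m0 : 0 < `|m| by rewrite normr_gt0.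
have e0 : 0 < e by rewrite divr_gt0 // mulr_gt0.
have em : e * (1 + C + 3 * C') < `|m|.
  have -> : e * (1 + C + 3 * C') = `|m| / 2 by rewrite /e; field; rewrite gt_eqF.
  by rewrite ltr_pdivrMr // ltr_pMr // ltr1n.
have nE : \forall y \near (0 : R), `|b y - m * y| <= e * `|y| /\ `|E y| <= e * `|y|.
  apply: filterI; first exact: linear_approximation dbm b0 e0.
  have := linear_approximation dE E0 e0.
  by apply: filterS => y; rewrite mul0r subr0.
have /nbhs_ballP[d1 /= d10 nd1] := nE.
(* The support radius 3 * r lies where the linear estimates hold, where [f] equals [E], and in the
   chart; r < D and r < 1 keep the arc of the parabola in [W]. *)
have [r r0 [rd1 reta rr1 rD1 r1']] := small_radius d10 D0 D1 r10.
have r23 := double_lt_triple r0; have r2 := lt_double r0.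
have fE (y : R) : `|y| <= 3 * r -> f y = E y.
  by move=> yr; apply: f1; exact: le_trans yr reta.
pose phi (x : 'rV[R]_3) : R^o := bump rho r x * (s * x 0 0 + H (x 0 1)).
have sphi : smooth_on setT phi.
  have q1 := smooth_mul openT (smooth_cst s) (@smooth_coord R 3 setT 0).
  have q2 := smooth_comp1 openT openT sH (fun _ _ => I) (@smooth_coord R 3 setT 1).
  exact: (smooth_mul openT (smooth_bump r srho) (smooth_add openT q1 q2)).
have r3 : 0 < 3 * r by rewrite mulr_gt0.
have rD (x : 'rV[R]_3) : `|x| <= 3 * r -> (c @` dom c) x.
  by move=> xr; apply: r1d; exact: le_trans xr rr1.
have phi0 (x : 'rV[R]_3) : 3 * r < `|x| -> phi x = 0.
  by move=> xr; rewrite /phi (bump0 r0 rho0) // mul0r.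
have [h [sh h1 h0]] := extend_smooth oc r3 rD sphi phi0.
exists h, (chart_box c (3 * r)); split => //; first exact: chart_box_closed.
  exists c, r; split => //.
    move=> t tr; have t2 : `|t| <= 3 * r by rewrite ltW // (lt_trans tr) // (lt_trans r2).
    have pt : `|parabola t| <= `|t| by apply: parabola_norm; rewrite ltW // (lt_trans tr).
    have iq : (c @` dom c) (parabola t) by apply: rD; exact: le_trans pt t2.
    split => //; have [dq cq] := image_point ac iq.
    set q := chart_inv c (parabola t) in dq cq *.
    have [p0 p1 p2] := parabolaE t; have [w0 w1 w2] := parabola_velocityE t.
    have q2 : c q 0 2 = 0 by rewrite cq.
    have Pq : carrier P q by apply/PK => //; exact: box_plane.
    have tw := plane_tangent bc mK dq q2 w2.
    have tD : `|t| < D by exact: lt_trans tr rD1.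
    have Wq : W (c q) by rewrite cq; exact: parW.
    rewrite /add_diff (form_coords rW dq Pq Wq tw w2) w0 w1 cq.
    have -> : diff_form h c q (parabola_velocity t) = s * (- t) + E t.
      have [_ <-] : is_derive (parabola t) (parabola_velocity t)
          (fun y : 'rV[R]_3 => s * y 0 0 + H (y 0 1) : R^o) (s * - t + E t).
        have := is_derive_corrector s (parabola t) (parabola_velocity t) dH.
        by rewrite w0 w1 p1 mul1r fE.
      rewrite /diff_form cq; apply: near_eq_derive.
      have o : \forall x \near (parabola t), ball (0 : 'rV[R]_3) (2 * r) x.
        apply: open_near; first exact: ball_open.
        by rewrite -ball_normE /= sub0r normrN (le_lt_trans pt) // (lt_trans tr).
      apply: filterS o => x; rewrite -ball_normE /= sub0r normrN => xr.
      have [|dx cx] := image_point (x := x) ac; first by apply: rD; rewrite ltW // (lt_trans xr).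
      by rewrite h1 // cx /phi (bump1 r0 rho1) ?mul1r // ltW.
    by rewrite /E; ring.
  have w2 : axis_vector 0 0 2 = 0 :> R by rewrite axis_vector_height.
  have p2 : c p 0 2 = 0 by rewrite cp mxE.
  have tw := plane_tangent bc mK dp p2 w2.
  have Wcp : W (c p) by rewrite cp.
  rewrite /add_diff (form_coords rW dp Pp Wcp tw w2) cp !axis_vectorE /= mulr1 mulr0 addr0.
  have -> : diff_form h c p (axis_vector 0) = s.
    have [_ <-] : is_derive (0 : 'rV[R]_3) (axis_vector 0)
        (fun y : 'rV[R]_3 => s * y 0 0 + H (y 0 1) : R^o) s.
      have := is_derive_corrector s (0 : 'rV[R]_3) (axis_vector 0) dH.
      by rewrite !axis_vectorE /= mulr1 mul0r addr0.
    rewrite /diff_form cp; apply: near_eq_derive.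
    have o : \forall x \near (0 : 'rV[R]_3), ball (0 : 'rV[R]_3) (2 * r) x.
      by apply: nbhsx_ballx; rewrite mulr_gt0.
    apply: filterS o => x; rewrite -ball_normE /= sub0r normrN => xr.
    have [|dx cx] := image_point (x := x) ac; first by apply: rD; rewrite ltW // (lt_trans xr).
    by rewrite h1 // cx /phi (bump1 r0 rho1) ?mul1r // ltW.
  by rewrite /s addrC subrK.
(* The remaining singular points of the support lie on the triple line with y not 0, where the
   estimate excludes a zero. *)
move=> q Sq [dq /= qr] qp.
have [q2 q0] := singular_triple bc tK dq Sq.
pose y := c q 0 1.
have cq : c q = y *: axis_vector 1.
  by apply: row3_eq; rewrite [RHS]mxE axis_vectorE /= ?mulr0 ?mulr1.
have y0 : y != 0.
  apply/eqP => y0; apply: qp; rewrite -(chart_invK ac dq) cq y0 scale0r -cp.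
  exact: chart_invK.
have yr : `|y| <= 3 * r by exact: le_trans (coord_le_norm _ _) qr.
have qE : q = axis_point c 1 y by rewrite /axis_point -cq chart_invK.
have fb' := add_diff_one_form sh fb.
apply: (transverse_velocity fb' bc mK dq Sq.1 q2) => v Sv.
exists 1; first exact: triple_velocity_axis bc tK Sv.
have rho00 : rho 0 = 1 by apply: rho1; rewrite normr0.
have -> : add_diff beta h c q (axis_vector 1) =
    b y + (r^-1 * 'D_1 rho (r^-1 * y) * H y + rho (r^-1 * y) * E y).
  rewrite /add_diff /b /axis_form -qE; congr (_ + _).
  rewrite -(fE y yr).
  have [_ <-] := is_derive_bump_axis y (lt0r_neq0 r0) srho rho00 dH s.
  have dphi : derivable phi (0 + y *: axis_vector 1) (axis_vector 1).
    exact: smooth_derivable sphi I.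
  have [_] := is_derive_line dphi.
  rewrite add0r (_ : (fun u : R => phi (0 + u *: axis_vector 1)) =
    (fun z : R^o => phi (z *: axis_vector 1))); last first.
    by apply/funext => u; rewrite add0r.
  move=> ->; rewrite /diff_form cq; apply: near_eq_derive.
  have ox : (c @` dom c) (y *: axis_vector 1) by exists q.
  apply: filterS (open_near od ox) => _ [q' dq' <-].
  by rewrite chart_invK // h1.
apply: (tangency_estimate r0 e0 sH H0 em) => //.
move=> z zr; have [|bz Ez] := nd1 z.
  by rewrite -ball_normE /= sub0r normrN (le_lt_trans zr).
split => //; have [_ ->] := dH z; exact: fE.
Qed.

End Normalize.

(** * The two-sheet side does not depend on the flow box *)

Section TangencyIsSimple.
Context {R : realType} {M : oriented_3manifold R}.
Variable P : branched_simple_polyhedron M.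
Implicit Types (c : chart R M) (p q : M) (beta : form_on M).

Lemma half_line_derive0 (g : R^o -> R^o) (d : R) :
  is_derive (0 : R^o) (1 : R^o) g d -> g 0 = 0 ->
  (\forall t \near (0 : R), 0 < t -> g t = 0) -> d = 0.
Proof.
move=> dg g0 gt; apply/eqP/negPn/negP => d0.
have e0 : 0 < `|d| / 2 by rewrite divr_gt0 ?normr_gt0.
have nb : \forall t \near (0 : R), (0 < t -> g t = 0) /\
    `|g t - d * t| <= `|d| / 2 * `|t|.
  exact: filterI gt (linear_approximation dg g0 e0).
have /nbhs_ballP[r /= r0 rg] := nb.
have r20 : 0 < r / 2 by rewrite divr_gt0.
have [|g1 g2] := rg (r / 2).
  by rewrite -ball_normE /= sub0r normrN (gtr0_norm r20); lra.
move: g2; rewrite (g1 r20) sub0r normrN normrM ler_pM2r ?normr_gt0 ?gt_eqF //.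
have : 0 < `|d| by rewrite normr_gt0.
by lra.
Qed.

Lemma half_line_positive (g : R^o -> R^o) (d : R) :
  is_derive (0 : R^o) (1 : R^o) g d -> g 0 = 0 -> 0 < d ->
  \forall t \near (0 : R), 0 < t -> 0 < g t.
Proof.
move=> dg g0 d0; have d20 : 0 < d / 2 by rewrite divr_gt0.
apply: filterS (linear_approximation dg g0 d20) => t gt t0.
move: gt; rewrite (gtr0_norm t0) ler_norml => /andP[gt _].
have := mulr_gt0 d20 t0; lra.
Qed.

Lemma is_derive_lift (phi : R^o -> R^o) (v w : 'rV[R]_3) :
  is_derive (0 : R^o) (1 : R^o) phi 0 ->
  is_derive (0 : R^o) (1 : R^o) (fun m : R^o => m *: v + phi m *: w) v.
Proof.
move=> dphi.
have dj j : is_derive (0 : R^o) (1 : R^o)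
    (fun m : R^o => (m *: v + phi m *: w) 0 j : R^o) (v 0 j).
  have [d1 d2] := is_deriveD (is_deriveZ (v 0 j) (is_derive_id (0 : R^o) (1 : R^o)))
    (is_deriveZ (w 0 j) dphi).
  have E : (fun m : R^o => (m *: v + phi m *: w) 0 j : R^o) =
      (v 0 j *: (id : R^o -> R^o) + w 0 j *: phi).
    apply/funext => m; rewrite [LHS]mxE [X in X + _]mxE [X in _ + X]mxE.
    change (m * v 0 j + phi m * w 0 j = v 0 j * m + w 0 j * phi m); ring.
  rewrite E; apply: DeriveDef; first exact: d1.
  apply: etrans d2 _.
  change (v 0 j * 1 + w 0 j * 0 = v 0 j); ring.
have dd : derivable (fun m : R^o => m *: v + phi m *: w) (0 : R^o) (1 : R^o).
  by apply: derivable_row => j; have [] := dj j.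
apply: DeriveDef; first exact: dd.
by apply/rowP => j; apply: etrans (derive_row j dd) _; have [] := dj j.
Qed.

Lemma wing_derive0 (f : 'rV[R]_2 -> R^o) (e : R) i : wing i e f ->
  'D_(- axis_vector i) (fun x : 'rV[R]_3 => f (xy x) : R^o) 0 = 0.
Proof.
move=> [sf f0 f1].
have df : derivable (fun x : 'rV[R]_3 => f (xy x) : R^o) 0 (axis_vector i).
  exact: smooth_derivable (smooth_xy sf) I.
have z : 'D_(axis_vector i) (fun x : 'rV[R]_3 => f (xy x) : R^o) 0 = 0.
  apply: (half_line_derive0 (is_derive_line0 df)).
    by rewrite scale0r addr0 f0 // xyE mxE.
  apply: filterE => t t0; rewrite add0r f0 // xyE mxE axis_vectorE eqxx mulr1.
  exact: ltW.
have [_] := is_deriveZv (-1) (derivableP df).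
by rewrite scaleN1r z scaler0.
Qed.

Lemma dxdy_neq0 (u v : 'rV[R]_3) (A : R) : u 0 0 = A -> v 0 0 = 0 ->
  0 < dxdy u v -> A != 0.
Proof.
rewrite /dxdy => -> ->; rewrite mulr0 subr0.
by apply: contraTneq => ->; rewrite mul0r ltxx.
Qed.

(* Were the last derivative negative, both sheets over x < 0 would go to the single
   sheet over x > 0, and by Rolle's theorem the transition would be singular. *)
Lemma triple_orientation c c' p : triple_box P c p -> triple_box P c' p ->
  let tau0 := fun x => transition c c' x 0 0 : R in
  [/\ \forall y \near (0 : R), tau0 (y *: axis_vector 1) = 0,
      'D_(axis_vector 1) tau0 0 = 0 & 0 < 'D_(axis_vector 0) tau0 0].
Proof.
move=> [Pp [mc oP]] [_ [mc' oP']] tau0.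
have [K [bc tK dp cp]] := model_boxed mc.
have [K' [bc' tK' dp' cp']] := model_boxed mc'.
have [oc PK] := bc; have [oc' PK'] := bc'; have [ac _] := oc; have [ac' _] := oc'.
have [_ od _ _ _] := ac.
have mK : box_model K by constructor 2.
have oO : open (overlap c c') by exact: overlap_open.
have ox := overlap_point dp dp'; rewrite cp in ox.
have axis0 : \forall y \near (0 : R), transition c c' (y *: axis_vector 1) 0 0 = 0 /\
    transition c c' (y *: axis_vector 1) 0 2 = 0.
  have := line_near (axis_vector 1) oO ox.
  apply: filterS => y; rewrite add0r => -[q [dq dq'] cq].
  have Sq : singular P q.
    by apply: (triple_singular bc tK) => //; rewrite cq mxE axis_vectorE /= mulr0.
  rewrite -cq (transition_point _ ac) //.
  by have [] := singular_triple bc' tK' dq' Sq.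
have st j : smooth_on (overlap c c') (fun x => transition c c' x 0 j : R^o).
  exact: smooth_transition.
have dt j v : derivable (fun x => transition c c' x 0 j : R^o) 0 v.
  exact: smooth_derivable (st j) ox.
have D10 : 'D_(axis_vector 1) tau0 0 = 0.
  apply: derive_near0; first exact: dt.
  by apply: filterS axis0 => y []; rewrite add0r.
split=> //; first by apply: filterS axis0 => y [].
set A := 'D_(axis_vector 0) tau0 0.
have p2 : c p 0 2 = 0 by rewrite cp mxE.
have tg k := plane_tangent bc mK dp p2 (axis_vector_height k).
(* The transition preserves the orientation of the tangent plane and keeps x = 0 along the triple
   line, so the image basis has area [A] times the y-component of the second vector. *)
have A0 : A != 0.
  have : pos P c p (axis_vector 0) (axis_vector 1).
    apply/(oP p dp Pp); split; [exact: tg|exact: tg|].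
    by rewrite /dxdy !axis_vectorE /= mulr1 mulr0 subr0.
  move=> /(pos_transition oc oc' Pp dp dp') /(oP' p dp' Pp) [_ _].
  have oxp : overlap c c' (c p) by exact: overlap_point.
  have e0 : ('D_(axis_vector 0) (transition c c') (c p)) 0 0 = A.
    by rewrite (derive_transition_coord _ _ oc oc' oxp) cp.
  have e1 : ('D_(axis_vector 1) (transition c c') (c p)) 0 0 = 0.
    by rewrite (derive_transition_coord _ _ oc oc' oxp) cp; exact: D10.
  exact: dxdy_neq0 e0 e1.
rewrite lt_neqAle eq_sym A0 leNgt; apply/negP => An.
have [f wf KE] := tK; have [sf f0 f1] := wf; have [f' wf' KE'] := tK'.
have [sf' f0' f1'] := wf'.
pose G x := transition c c' x 0 2 : R^o.
set v := - axis_vector 0 : 'rV[R]_3.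
pose phi (m : R^o) : R^o := f (xy (m *: v)).
have dphi : is_derive (0 : R^o) (1 : R^o) phi 0.
  have df : derivable (fun x : 'rV[R]_3 => f (xy x) : R^o) 0 v.
    exact: smooth_derivable (smooth_xy sf) I.
  have := is_derive_line0 df; rewrite (wing_derive0 wf).
  rewrite (_ : (fun s : R => f (xy (0 + s *: v))) = phi) //.
  by apply/funext => m; rewrite add0r.
(* The curves m *: v and [lift m] run in the two sheets over x < 0 with the same velocity [v], as
   the wing is flat along its attaching line. With A negative, both enter the one-sheet side of
   [c']. *)
pose lift (m : R^o) : 'rV[R]_3 := m *: v + phi m *: e_z.
have dlift : is_derive (0 : R^o) (1 : R^o) lift v by exact: is_derive_lift.
have phi0 : phi 0 = 0 by rewrite /phi scale0r f0 // xyE mxE.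
have lift0 : lift 0 = 0 by rewrite /lift phi0 !scale0r addr0.
have dtau0 : differentiable (tau0 : 'rV[R]_3 -> R) 0.
  exact: (smooth_differentiable_row oO (st 0) ox).
have Dv : 'D_v tau0 0 = - A.
  by rewrite /v -scaleN1r; apply: etrans (deriveZv _ (-1) dtau0) _; exact: mulN1r.
have nA : 0 < - A by rewrite oppr_gt0.
have tau00 : tau0 0 = 0.
  by have [] := nbhs_singleton axis0; rewrite scale0r.
have pos1 : \forall m \near (0 : R), 0 < m -> 0 < tau0 (m *: v).
  have d1 : is_derive (0 : R^o) (1 : R^o) (fun m : R^o => tau0 (0 + m *: v) : R^o) (- A).
    by have := is_derive_line0 (dt 0 v); rewrite -/tau0 Dv.
  have z1 : tau0 (0 + 0 *: v) = 0 by rewrite scale0r addr0.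
  by apply: filterS (half_line_positive d1 z1 nA) => m; rewrite add0r.
have pos2 : \forall m \near (0 : R), 0 < m -> 0 < tau0 (lift m).
  have [dl1 dl2] := dlift.
  have dtl : differentiable (tau0 : 'rV[R]_3 -> R) (lift 0) by rewrite lift0.
  have d1 := is_derive_comp dl1 dtl; rewrite dl2 lift0 Dv in d1.
  have z1 : (tau0 \o lift) 0 = 0 by rewrite /= lift0.
  exact: half_line_positive d1 z1 nA.
have in1 : \forall m \near (0 : R), overlap c c' (m *: v).
  by have := line_near v oO ox; apply: filterS => m; rewrite add0r.
have in2 : \forall m \near (0 : R^o), overlap c c' (lift m).
  have cl := curve_continuous dlift.
  by apply: cl; rewrite lift0; exact: open_near oO ox.
(* On the one-sheet side of [c'] the wing coincides with z = 0, so the height [G] in [c'] vanishes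
   on the images of both sheets. *)
have flat x : overlap c c' x -> K x -> 0 < tau0 x -> G x = 0.
  move=> [q [dq dq'] <-]; rewrite /tau0 /G (transition_point _ ac) // => Kq q0.
  have Kq' : K' (c' q) by apply/PK' => //; apply/PK.
  move: Kq'; rewrite KE' /= => -[//|->]; apply: f0'.
  by rewrite xyE (_ : plane_axis 0 = 0) ?ltW //; exact: val_inj.
have v2 m : (m *: v) 0 2 = 0 by rewrite !mxE /= oppr0 mulr0.
have K1 m : K (m *: v) by apply: box_plane.
have K2 m : K (lift m).
  rewrite KE /=; right; rewrite /lift xy_vertical [LHS]mxE v2 add0r [LHS]mxE.
  by rewrite [e_z _ _]mxE /= mulr1.
have flat1 : \forall m \near (0 : R), 0 < m -> G (m *: v) = 0.
  by apply: filterS (filterI pos1 in1) => m [pm im] m0; apply: flat => //; exact: pm.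
have flat2 : \forall m \near (0 : R), 0 < m -> G (lift m) = 0.
  by apply: filterS (filterI pos2 in2) => m [pm im] m0; apply: flat => //; exact: pm.
have DGz : 'D_e_z G 0 = 0.
  have nb : \forall m \near (0 : R), (0 < m -> G (m *: v) = 0) /\
      (0 < m -> G (lift m) = 0) by exact: filterI flat1 flat2.
  have /nbhs_ballP[r /= r0 nr] := nb.
  (* The half-space x > - r ensures that [wing_rolle] asks only about vertical segments over x = - m
     with m < r. *)
  pose W := overlap c c' `&` [set x : 'rV[R]_3 | 0 < r - (-1) * x 0 0].
  have oW : open W.
    apply: openI => //; apply: open_positive.
    apply: smooth_sub (smooth_cst r) _.
    exact: smooth_mul openT (smooth_cst (-1 : R)) (@smooth_coord R 3 setT 0).
  have W0 : W 0 by split=> //=; rewrite mxE mulr0 subr0.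
  have sG : smooth_on W G by apply: smooth_subset (st 2) => x [].
  apply: (wing_rolle wf oW W0 sG); rewrite ?mxE //.
  move=> m t m0.
  have -> : 0 - m *: delta_mx 0 (plane_axis 0) = m *: v by rewrite sub0r scalerN.
  move=> [_ /= Wm] tf.
  have mr : ball (0 : R) r m.
    rewrite -ball_normE /= sub0r normrN (gtr0_norm m0).
    by move: Wm; rewrite !mxE /=; lra.
  have [g1 g2] := nr m mr.
  case: tf => ->; first by rewrite scale0r addr0; exact: g1.
  exact: g2.
have DG1 : 'D_(axis_vector 1) G 0 = 0.
  apply: derive_near0; first exact: dt.
  by apply: filterS axis0 => y []; rewrite add0r.
have DG0 : 'D_(axis_vector 0) G 0 = 0.
  have dG : differentiable (G : 'rV[R]_3 -> R) 0.
    exact: (smooth_differentiable_row oO (st 2) ox).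
  have z : 'D_v G 0 = 0.
    apply: (half_line_derive0 (is_derive_line0 (dt 2 v))).
      by rewrite scale0r addr0; have [_] := nbhs_singleton axis0; rewrite scale0r.
    by apply: filterS flat1 => m; rewrite add0r.
  have E : axis_vector 0 = (-1) *: v by rewrite /v scaleN1r opprK.
  by rewrite E; apply: etrans (deriveZv _ (-1) dG) _; rewrite z; exact: scaler0.
have DG w : 'D_w G 0 = 0.
  rewrite derive_coord; last exact: (smooth_differentiable_row oO (st 2) ox).
  rewrite big1 // => -[[|[|[|//]]] hj] _.
  - rewrite (_ : Ordinal hj = plane_axis 0); last exact: val_inj.
    by rewrite -/(axis_vector 0) DG0 mulr0.
  - rewrite (_ : Ordinal hj = plane_axis 1); last exact: val_inj.
    by rewrite -/(axis_vector 1) DG1 mulr0.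
  - rewrite (_ : Ordinal hj = 2); last exact: val_inj.
    by rewrite -/e_z DGz mulr0.
have oxp : overlap c c' (c p) by exact: overlap_point.
have := derive_transitionK e_z oc' oc dp' dp.
set w := 'D_e_z _ _ => /(congr1 (fun x : 'rV[R]_3 => x 0 2)).
rewrite (derive_transition_coord _ _ oc oc' oxp) cp => E.
have : (1 : R) = 0 by rewrite -(DG w) /G E /e_z mxE.
by move/eqP; rewrite oner_eq0.
Qed.

End TangencyIsSimple.

(** * Simple tangencies in every flow box and the final assembly *)

Section Final.
Context {R : realType} {M : oriented_3manifold R}.
Variable P : branched_simple_polyhedron M.
Implicit Types (c : chart R M) (p q : M) (beta : form_on M).

(** The leaf arc in an arbitrary box [c'] is the image of the parabola. Its first coordinate has
    derivative - t A(t) + B(t), with A and B the partial derivatives of the transition along the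
    parabola, so its second derivative at 0 is - A(0), which is negative by [triple_orientation]. *)
Lemma tangency_simple beta p c' : one_form P beta -> tangency_at P beta p ->
  triple_box P c' p -> positive_simple_tangency P beta c' p.
Proof.
move=> fb [c [r [tb r0 leaf b0]]] tb'.
have [Pp [mc oP]] := tb; have [_ [mc' oP']] := tb'.
have [K [bc tK dp cp]] := model_boxed mc.
have [K' [bc' tK' dp' cp']] := model_boxed mc'.
have [oc PK] := bc; have [oc' PK'] := bc'; have [ac _] := oc; have [ac' _] := oc'.
have mK : box_model K by constructor 2.
have p2 : c p 0 2 = 0 by rewrite cp mxE.
have tg k := plane_tangent bc mK dp p2 (axis_vector_height k).
split; [exact: tb'|by exists c, (axis_vector 0); split|].
have [axis0 D10 A0] := triple_orientation tb tb'.
pose tau0 x : R^o := transition c c' x 0 0.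
rewrite -/tau0 in axis0 D10 A0.
have oO : open (overlap c c') by exact: overlap_open.
have ox := overlap_point dp dp'; rewrite cp in ox.
have stau : smooth_on (overlap c c') tau0 by exact: smooth_transition.
have cpar : {for (0 : R^o), continuous parabola}.
  exact: curve_continuous (is_derive_parabola (0 : R)).
have nO : \forall t \near (0 : R^o), overlap c c' (parabola t).
  by apply: cpar; rewrite parabola0; exact: open_near oO ox.
have /nbhs_ballP[r1 /= r10 nr1] := nO.
pose r2 := Num.min r r1.
have r20 : 0 < r2 by rewrite lt_min r0 r10.
pose gam := transition c c' \o parabola.
have inO t : ball (0 : R^o) r2 t -> overlap c c' (parabola t).
  move=> /in_ball0; rewrite lt_min => /andP[_ tr].
  by apply: nr1; rewrite -ball_normE /= sub0r normrN.
have inr t : ball (0 : R^o) r2 t -> `|t| < r.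
  by move=> /in_ball0; rewrite lt_min => /andP[].
have ball2 := ball_open (0 : R^o) r2.
have sgam i : smooth_on (ball (0 : R^o) r2) (fun t => gam t 0 i : R^o).
  apply: (smooth_comp ball2 oO (smooth_transition i oc oc') inO) => j.
  exact: smooth_parabola.
have dgam t : ball (0 : R^o) r2 t -> is_derive (t : R^o) (1 : R^o) gam
    ('D_(parabola_velocity t) (transition c c') (parabola t)).
  move=> tr; apply: is_derive_transition_curve (is_derive_parabola t) => //.
  exact: inO.
exists gam; split.
- split; first by rewrite /gam /= parabola0 -cp (transition_point _ ac).
  exists r2; split; [exact: r20|exact: sgam|].
  move=> t tr; have [leaf1 leaf2] := leaf t (inr t tr).
  have [dq cq] := image_point ac leaf1.
  set q := chart_inv c (parabola t) in dq cq leaf2.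
  have dq' : dom c' q.
    by have [q1 [dq1 dq1'] E] := inO t tr; rewrite /q -E (chart_invK ac).
  have [_ p1 p2'] := parabolaE t; have [w0 w1 w2] := parabola_velocityE t.
  have q2 : c q 0 2 = 0 by rewrite cq.
  have Pq : carrier P q by apply/PK => //; exact: box_plane.
  have tw := plane_tangent bc mK dq q2 w2.
  have wn0 : parabola_velocity t != 0.
    by apply/eqP => /rowP /(_ 1); rewrite w1 mxE => /eqP; rewrite oner_eq0.
  have [_ ->] := dgam t tr; split.
    by rewrite -cq; exact: derive_transition_neq0.
  exists q; split; [exact: dq'|exact: Pq|by []|].
  by rewrite -cq; apply: etrans (fb.1 c c' oc oc' q _ Pq dq dq' tw) leaf2.
- have tauD t : ball (0 : R^o) r2 t -> 'D_(1 : R^o) (fun t : R^o => gam t 0 0 : R^o) t =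
      (- t) * 'D_(axis_vector 0) tau0 (parabola t) + 'D_(axis_vector 1) tau0 (parabola t).
    move=> tr; have dt : differentiable (tau0 : 'rV[R]_3 -> R) (parabola t).
      exact: smooth_differentiable_row oO stau (inO t tr).
    have [dp1 dp2] := is_derive_parabola t.
    have [_ E] := is_derive_comp dp1 dt.
    apply: etrans E _; rewrite dp2 /parabola_velocity.
    apply: etrans (deriveDv _ _ dt) _; congr (_ + _).
    exact: deriveZv.
  have b00 : ball (0 : R^o) r2 0 by exact: ballxx.
  split; first by rewrite tauD // parabola0 D10 oppr0 mul0r addr0.
  pose A (t : R^o) : R^o := 'D_(axis_vector 0) tau0 (parabola t).
  pose B (t : R^o) : R^o := 'D_(axis_vector 1) tau0 (parabola t).
  have sA : smooth_on (ball (0 : R^o) r2) A.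
    apply: (smooth_comp ball2 oO (smooth_derive (axis_vector 0) stau) inO) => j.
    exact: smooth_parabola.
  have dA : derivable A (0 : R^o) (1 : R^o) by exact: smooth_derivable sA b00.
  (* The parabola is tangent to the triple line at 0, and along that line the y-derivative of [tau0]
     is identically 0. *)
  have dB : is_derive (0 : R^o) (1 : R^o) B 0.
    have [dp1 dp2] := is_derive_parabola (0 : R).
    have pO : overlap c c' (parabola 0) by rewrite parabola0.
    have dt : differentiable ('D_(axis_vector 1) tau0 : 'rV[R]_3 -> R) (parabola 0).
      exact: smooth_differentiable_row oO (smooth_derive (axis_vector 1) stau) pO.
    have [c1 c2] := is_derive_comp dp1 dt.
    apply: DeriveDef; first exact: c1.
    apply: etrans c2 _; rewrite dp2 parabola0.
    rewrite (_ : parabola_velocity 0 = axis_vector 1); last first.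
      by rewrite /parabola_velocity oppr0 scale0r add0r.
    apply: derive_near0.
      exact: smooth_derivable (smooth_derive (axis_vector 1) stau) ox.
    have nb : \forall y \near (0 : R), overlap c c' (y *: axis_vector 1) /\
        tau0 (y *: axis_vector 1) = 0.
      apply: filterI axis0; have := line_near (axis_vector 1) oO ox.
      by apply: filterS => y; rewrite add0r.
    have /nbhs_ballP[e /= e0 ne] := nb.
    have o : \forall y \near (0 : R), ball (0 : R) e y by exact: nbhsx_ballx.
    apply: filterS o => y ye; rewrite add0r.
    have [oy _] := ne y ye.
    apply: derive_near0; first exact: smooth_derivable stau oy.
    have o2 := line_near (E := R^o) (1 : R) (ball_open (0 : R^o) e) ye.
    apply: filterS o2 => h /ne[_].
    by rewrite -scalerDl [h *: (1 : R)]mulr1.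
  have mu := is_deriveM (is_deriveN (is_derive_id (0 : R^o) (1 : R^o))) (derivableP dA).
  have [_ E] := is_deriveD mu dB.
  have -> : 'D_(1 : R^o) ('D_(1 : R^o) (fun t : R^o => gam t 0 0 : R^o)) 0 =
      'D_(1 : R^o) (((- (id : R^o -> R^o)) * A) + B) (0 : R^o).
    apply: near_eq_derive; apply: filterS (open_near ball2 b00) => t tr.
    exact: tauD.
  rewrite E.
  change ((- 0) * 'D_(1 : R^o) A 0 + A 0 * (- 1) + 0 != 0 :> R).
  rewrite oppr0 mul0r add0r addr0 mulrN1 oppr_eq0 /A parabola0.
  exact: lt0r_neq0.
have cA := smooth_continuous (smooth_derive (axis_vector 0) stau) ox.
have nA : \forall x \near (0 : 'rV[R]_3), overlap c c' x /\ 0 < 'D_(axis_vector 0) tau0 x.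
  apply: filterI; first exact: open_near oO ox.
  exact: (cvgr_gt _ cA 0 A0).
have /nbhs_ballP[e /= e0 ne] := nA.
have o : \forall t \near (0 : R^o), ball (0 : R^o) (Num.min e 1) t.
  by apply: nbhsx_ballx; rewrite lt_min e0 ltr01.
rewrite /on_two_sheet_side.
apply: filterS (filterI o axis0) => t [/in_ball0]; rewrite lt_min => /andP[te t1] t0.
(* The point of the parabola is joined to the triple line, where [tau0] is 0, by a segment in the
   direction x; by the mean value theorem [tau0] is then - t^2 / 2 times a positive derivative. *)
pose v : 'rV[R]_3 := (- (t ^+ 2 / 2)) *: axis_vector 0.
have inb (s : R) : 0 <= s <= 1 -> ball (0 : 'rV[R]_3) e (t *: axis_vector 1 + s *: v).
  move=> /andP[s0 s1]; rewrite -ball_normE /= sub0r normrN.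
  apply: le_lt_trans te; apply: norm_le_coord => // -[[|[|[|//]]] hj].
  - rewrite (_ : Ordinal hj = 0); last exact: val_inj.
    have -> : (t *: axis_vector 1 + s *: v) 0 0 = - (s * (t ^+ 2 / 2)).
      by rewrite !mxE /= mulr0 add0r mulr1 mulrN.
    have tq : `|t ^+ 2 / 2| = `|t| ^+ 2 / 2.
      by rewrite normrM normrX normfV (ger0_norm (ler0n R 2)).
    rewrite normrN normrM (ger0_norm s0) tq.
    have tt := normr_ge0 t; clear -s0 s1 t1 tt.
    have : `|t| ^+ 2 / 2 <= `|t| by move: `|t| t1 tt => u t1 tt; nra.
    move=> h; apply: le_trans h; by rewrite ler_piMl.
  - rewrite (_ : Ordinal hj = 1); last exact: val_inj.
    by rewrite !mxE /= !mulr0 addr0 mulr1.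
  - rewrite (_ : Ordinal hj = 2); last exact: val_inj.
    by rewrite !mxE /= !mulr0 addr0 normr0.
have [s s01|s /andP[s0 s1] E] := @segment_MVT R _ tau0 (t *: axis_vector 1) v.
  exact: smooth_derivable stau (ne _ (inb s s01)).1.
have s01 : 0 <= s <= 1 by rewrite !ltW.
have [os As] := ne _ (inb s s01).
have -> : gam t 0 0 = tau0 (t *: axis_vector 1 + v).
  by rewrite /gam /tau0 /= /parabola addrC.
have t0' : tau0 (t *: axis_vector 1) = 0 by [].
move: E; rewrite t0' subr0 => ->.
rewrite (smooth_deriveZv _ _ stau os) mulNr oppr_le0 mulr_ge0 ?(ltW As) //.
by rewrite divr_ge0 // sqr_ge0.
Qed.

Lemma add_diff_off beta h (B : set M) c q v : oriented_chart c -> closed B ->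
  (forall q, ~ B q -> h q = 0) -> dom c q -> ~ B q ->
  add_diff beta h c q v = beta c q v.
Proof.
move=> oc cB h0 dq nB; rewrite /add_diff (@diff_form0 _ _ h (~` B)) ?addr0 //.
by rewrite openC.
Qed.

Lemma tangency_at_off beta h (B : set M) p : closed B ->
  (forall q, ~ B q -> h q = 0) -> ~ B p ->
  tangency_at P beta p -> tangency_at P (add_diff beta h) p.
Proof.
move=> cB h0 nB [c [r [tb r0 leaf b0]]].
have [Pp [mc oP]] := tb; have [K [bc tK dp cp]] := model_boxed mc.
have [oc _] := bc; have [ac _] := oc.
have nBo : \forall q \near p, ~ B q by apply: (open_near (A := ~` B)) => //; rewrite openC.
have p0 : parabola 0 = c p by rewrite parabola0 cp.
have n1 := curve_near ac dp p0 (is_derive_parabola (0 : R)) nBo.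
have /nbhs_ballP[e /= e0 ne] := n1.
exists c, (Num.min r e); split => //; first by rewrite lt_min r0.
- move=> t; rewrite lt_min => /andP[tr te]; have [l1 l2] := leaf t tr; split=> //.
  have [dq _] := image_point ac l1.
  rewrite (add_diff_off _ _ oc cB h0 dq) //; apply: ne.
  by rewrite -ball_normE /= sub0r normrN.
- by rewrite (add_diff_off _ _ oc cB h0 dp).
Qed.

Lemma nondegenerate_at_off beta h (B : set M) p : closed B ->
  (forall q, ~ B q -> h q = 0) -> ~ B p ->
  nondegenerate_at P beta p -> nondegenerate_at P (add_diff beta h) p.
Proof.
move=> cB h0 nB [c [tb b0 db]].
have [Pp [mc oP]] := tb; have [K [bc tK dp cp]] := model_boxed mc.
have [oc _] := bc; have [ac _] := oc.
have mK : box_model K by constructor 2.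
have [r vb] := visible_center bc mK dp cp; have [_ r0 _] := vb.
have nBo : \forall q \near p, ~ B q by apply: (open_near (A := ~` B)) => //; rewrite openC.
have d : derivable (id : 'rV[R]_3 -> 'rV[R]_3) 0 (axis_vector 1) by exact: derivable_id.
have dl := is_derive_line0 d; rewrite derive_id in dl.
have p0 : (0 : 'rV[R]_3) + 0 *: axis_vector 1 = c p by rewrite scale0r addr0 cp.
have n1 := curve_near ac dp p0 dl nBo.
have n2 : \forall y \near (0 : R^o), ball (0 : R^o) (4 * r) y.
  by apply: nbhsx_ballx; rewrite mulr_gt0.
have E : \forall y \near (0 : R^o), axis_form beta c 1 y = axis_form (add_diff beta h) c 1 y.
  apply: filterS (filterI n1 n2) => y [ny /in_ball0 yr].
  have [dq _ _ _] := axis_in_box 1 vb (ltW yr).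
  rewrite /axis_form (add_diff_off _ _ oc cB h0 dq) //.
  by move: ny; rewrite add0r.
exists c; split => //; first by rewrite -(nbhs_singleton E).
by rewrite -(near_eq_derive (1 : R^o) E).
Qed.

(** The list [s] holds the candidates not yet treated. Normalizing one of them leaves the other
    tangencies outside its box [B] as they are and makes those inside transverse, so all tangencies
    remain in [F]. *)
Lemma normalize_all beta (s : seq M) (F : set M) (rho : R^o -> R^o) :
  smooth_on setT rho -> (forall x : R, `|x| <= 2 -> rho x = 1) ->
  (forall x : R, 3 <= `|x| -> rho x = 0) ->
  one_form P beta -> d_positive P beta -> (forall q, q \in s -> F q) ->
  (forall q, singular P q -> [\/ transverse_at P beta q,
     F q /\ tangency_at P beta q | q \in s /\ nondegenerate_at P beta q]) ->
  exists beta', [/\ one_form P beta', d_positive P beta' & forall q, singular P q ->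
    transverse_at P beta' q \/ F q /\ tangency_at P beta' q].
Proof.
move=> srho rho1 rho0; elim: s beta => [|p s IH] beta fb pb sF st.
  exists beta; split=> // q /st[tq|tq|[]//]; [by left|by right].
have sF' q : q \in s -> F q by move=> qs; apply: sF; rewrite in_cons qs orbT.
(* An earlier normalization may have made [p] transverse; then it is simply dropped. *)
have [np|np] := pselect (nondegenerate_at P beta p); last first.
  apply: (IH _ fb pb sF') => q /st[tq|tq|[qs nq]]; [by constructor 1|by constructor 2|].
  constructor 3; split=> //; move: qs; rewrite in_cons => /orP[/eqP qp|//].
  by case: np; rewrite -qp.
have [h [B [sh cB h0 tp tB]]] := normalize_tangency srho rho1 rho0 fb np.
have fb' := add_diff_one_form sh fb; have pb' := add_diff_d_positive sh pb.
apply: (IH _ fb' pb' sF') => q Sq; have [->|/eqP qp] := eqVneq q p.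
  by constructor 2; split=> //; apply: sF; rewrite in_cons eqxx.
have [Bq|nBq] := pselect (B q); first by constructor 1; exact: tB.
have [tq|[Fq tq]|[qs nq]] := st q Sq.
- constructor 1; apply: transverse_local tq => c v oc dq.
  by rewrite (add_diff_off _ _ oc cB h0 dq).
- by constructor 2; split=> //; exact: (tangency_at_off cB h0 nBq tq).
- constructor 3; split; last exact: (nondegenerate_at_off cB h0 nBq nq).
  by move: qs; rewrite in_cons => /orP[/eqP /qp|].
Qed.

Lemma triple_box_singular c p : triple_box P c p -> singular P p.
Proof.
move=> [Pp [mc _]]; have [K [bc tK dp cp]] := model_boxed mc.
by apply: (triple_singular bc tK dp); rewrite cp mxE.
Qed.

Lemma vertex_box_singular c p : vertex_box P c p -> singular P p.
Proof.
move=> [Pp [mc _]]; have [K [bc vK dp cp]] := model_boxed mc.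
by apply: (vertex_singular bc vK dp); [|left]; rewrite cp mxE.
Qed.

Lemma triple_vertex_disjoint c c' p : triple_box P c p -> vertex_box P c' p -> False.
Proof.
move=> [_ [mc _]] [_ [mc' _]]; have [K [bc tK dp cp]] := model_boxed mc.
have [K' [bc' vK' dp' cp']] := model_boxed mc'.
apply: (vertex_not_single bc' vK' dp' cp' bc.1 dp (k := 1)) => v Sv.
exact: triple_velocity_axis bc tK Sv.
Qed.

Lemma axis_vector_e_x : axis_vector 0 = e_x R.
Proof. by rewrite /axis_vector /e_x; congr (delta_mx _ _); exact: val_inj. Qed.

Lemma axis_vector_e_y : axis_vector 1 = e_y R.
Proof. by rewrite /axis_vector /e_y; congr (delta_mx _ _); exact: val_inj. Qed.

Lemma stable_of_generic beta (F : set M) : one_form P beta -> finite_set F ->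
  (forall q, singular P q ->
    transverse_at P beta q \/ F q /\ tangency_at P beta q) -> S_stable P beta.
Proof.
move=> fb finF st.
have vel c p : triple_box P c p -> sing_velocity P c p (axis_vector 1).
  by move=> [_ [/model_boxed[K [bc tK dp cp]] _]]; exact: triple_velocity bc tK dp cp.
have vvel c p k : vertex_box P c p -> sing_velocity P c p (axis_vector k).
  by move=> [_ [/model_boxed[K [bc vK dp cp]] _]]; exact: vertex_velocity bc vK dp cp.
have box c p : triple_box P c p \/ vertex_box P c p -> oriented_chart c /\ dom c p.
  by case=> -[_ [/model_boxed[K [[oc _] _ dp _]] _]].
split.
- move=> p [c cb]; have [oc dp] := box c p cb.
  have Sp : singular P p by case: cb => [/triple_box_singular|/vertex_box_singular].
  have Sv : sing_velocity P c p (axis_vector 1) by case: cb => [/vel|/vvel].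
  have [tp|[_ tp]] := st p Sp.
    exists c, (axis_vector 1); split => //; first exact: sing_velocity_tangent.
    by apply: tp => //; exact: axis_vector_neq0.
  have [c1 [r [tb _ _ _]]] := tp.
  by have [] := tangency_simple fb tp tb.
- move=> p c vb; have [oc dp] := box c p (or_intror vb).
  have [tp|[_ [c1 [r [tb _ _ _]]]]] := st p (vertex_box_singular vb); last first.
    by case: (triple_vertex_disjoint tb vb).
  rewrite -axis_vector_e_x -axis_vector_e_y.
  by split; apply: tp => //; [exact: vvel|exact: axis_vector_neq0|exact: vvel|
    exact: axis_vector_neq0].
(* The set [F] may contain points at which the form has become transverse, while [S_stable] requires
   a simple tangency at each point of a triple line in the set. *)
exists (F `&` [set q | tangency_at P beta q /\ ~ transverse_at P beta q]).
  by apply: sub_finite_set finF => q [].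
move=> p c tb; have [oc dp] := box c p (or_introl tb); split.
  move=> nF; rewrite -axis_vector_e_y.
  have tp : transverse_at P beta p.
    have [//|[Fp tp]] := st p (triple_box_singular tb).
    by apply: contrapT => ntp; apply: nF.
  by apply: tp => //; [exact: vel|exact: axis_vector_neq0].
by move=> [_ [tp _]]; exact: tangency_simple.
Qed.

Lemma singular_wing p : singular P p ->
  exists (i : 'I_2) (e : R) (f : 'rV[R]_2 -> R^o), wing i e f.
Proof.
move=> Sp; have [c [[/model_boxed[K [bc pK dp _]] _]|
  [/model_boxed[K [_ [f wf _] _ _]] _]|[/model_boxed[K [_ [e [f [g [_ wf _ _]]]] _ _]] _]]]
  := polyhedron_flow_box Sp.1.
- by case: (plane_not_singular bc pK dp Sp).
- by exists 0, 1, f.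
- by exists 0, e, f.
Qed.

End Final.

Theorem theorem1p1 (R : realType) (M : oriented_3manifold R)
    (P : branched_simple_polyhedron M) :
  (exists beta : form_on M, one_form P beta /\ d_positive P beta) ->
  exists beta' : form_on M,
    [/\ one_form P beta', d_positive P beta' & S_stable P beta'].
Proof.
move=> [beta [fb pb]].
(* Without singular points there is no wing from which to build cutoffs, but then the given form
   already satisfies the conclusion vacuously. *)
have [[p Sp]|nS] := pselect (exists p, singular P p); last first.
  exists beta; split=> //; apply: (stable_of_generic fb (finite_set0 _)) => q Sq.
  by case: nS; exists q.
have [i [e [f wf]]] := singular_wing Sp.
have [psi [spsi psi0 psi1]] := wing_flat wf.
have [rho [srho rho1 rho0]] := exists_cutoff spsi psi0 psi1.
have [b1 [F [fb1 pb1 finF gen]]] := exists_generic srho rho1 rho0 fb pb.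
have [s FE] : exists s : seq M, F = [set` s] by exact/finite_seqP.
have [|q Sq|b2 [fb2 pb2 st]] := @normalize_all R M P b1 s F rho srho rho1 rho0 fb1 pb1.
- by move=> q qs; rewrite FE.
- have [tq|[Fq nq]] := gen q Sq; first by constructor 1.
  by constructor 3; split=> //; move: Fq; rewrite FE.
exists b2; split=> //; exact: stable_of_generic fb2 finF st.
Qed.
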